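(* Let $\Omega\subset\mathbb{R}^d$, $d\in\{2,3\}$, be a bounded polyhedral domain and $\mathbb{T}_h$ a conformal simplicial mesh of $\overline\Omega$. For any $w\in H^1(\Omega)^d$ and $\psi_h\in P_{dc,h}^1$, $$\int_\Omega\big(\mathcal{I}_h^{RT}w\cdot\nabla_h\psi_h+\operatorname{div}\mathcal{I}_h^{RT}w\,\psi_h\big)dx=\sum_{F\in\mathcal{F}_h^i}\int_F\{\!\{w\}\!\}_{\omega,F}\cdot n_F\,\Pi_F^0[\![\psi_h]\!]_F\,ds+\sum_{F\in\mathcal{F}_h^\partial}\int_F(w\cdot n_F)\,\Pi_F^0\psi_h\,ds .$$
   Context: $\mathbb{T}_h$ consists of closed $d$-simplices without hanging nodes. $\mathcal{F}_h^i$, $\mathcal{F}_h^\partial$ are the sets of interior and boundary faces. For $F=T_1\cap T_2\in\mathcal{F}_h^i$, $n_F$ is the unit normal to $F$ that is outward to $T_1$ (pointing from $T_1$ to $T_2$); for $F\in\mathcal{F}_h^\partial$, $n_F$ is the unit outward normal to $\partial\Omega$. For $F\in\mathcal{F}_h^i$, with $\varphi_k=\varphi|_{T_k}$: $[\![\varphi]\!]_F=\varphi_1-\varphi_2$; for vector fields $v$, $\{\!\{v\}\!\}_{\omega,F}=\omega_{T_1,F}v_1+\omega_{T_2,F}v_2$, where $\omega_{T_1,F},\omega_{T_2,F}\ge0$ and $\omega_{T_1,F}+\omega_{T_2,F}=1$. $\Pi_F^0$ is the $L^2(F)$-projection onto constants on $F$. $\nabla_h$ is the elementwise gradient. $P_{dc,h}^1$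 is the space of functions in $L^2(\Omega)$ whose restriction to each $T\in\mathbb{T}_h$ is a polynomial of degree at most $1$ (no interelement continuity). $\mathcal{I}_h^{RT}$ is the lowest-order Raviart–Thomas interpolation: for each $T\in\mathbb{T}_h$, $(\mathcal{I}_h^{RT}w)|_T$ is the unique element of $\mathbb{RT}^0(T)=\mathbb{P}^0(T)^d+x\,\mathbb{P}^0(T)$ such that $\int_F(\mathcal{I}_h^{RT}w)|_T\cdot n_T\,ds=\int_Fw\cdot n_T\,ds$ for every face $F$ of $T$, with $n_T$ the outward unit normal of $T$ ($\mathbb{P}^0(T)$: constants). *)

(* Defs.v *)
From HB Require Import structures.
From mathcomp Require Import all_boot all_order all_algebra.
From mathcomp Require Import all_classical all_reals all_analysis.
Set Implicit Arguments.
Unset Strict Implicit.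
Unset Printing Implicit Defensive.
Import Order.TTheory GRing.Theory Num.Theory.
Import numFieldNormedType.Exports.
Local Open Scope classical_set_scope.
Local Open Scope ring_scope.

(* Product sigma-algebra on R^n, generated by the coordinates. *)
Definition measure_rV_display : measure_display -> measure_display.
Proof. exact. Qed.

Section measurable_rV.
Context {d} {T : measurableType d}.
Variable n : nat.

Let coord : 'I_n -> 'rV[T]_n -> T := fun i x => x ord0 i.

Let rV_set0 : g_sigma_preimage coord set0.
Proof. exact: sigma_algebra0. Qed.

Let rV_setC A : g_sigma_preimage coord A -> g_sigma_preimage coord (~` A).
Proof. exact: sigma_algebraC. Qed.

Let rV_bigcup (F : _^nat) : (forall i, g_sigma_preimage coord (F i)) ->
  g_sigma_preimage coord (\bigcup_i (F i)).
Proof. exact: sigma_algebra_bigcup. Qed.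

HB.instance Definition _ := @isMeasurable.Build (measure_rV_display d)
  'rV[T]_n (g_sigma_preimage coord) rV_set0 rV_setC rV_bigcup.

Lemma measurable_rV_coord (i : 'I_n) :
  measurable_fun [set: 'rV[T]_n] (fun x : 'rV[T]_n => x ord0 i).
Proof.
move=> _ Y mY; rewrite setTI; apply: sub_sigma_algebra => /=.
rewrite -bigcup_seq/=; exists i => /=; first by rewrite mem_index_enum.
by exists Y => //; rewrite setTI.
Qed.

Lemma measurable_fun_rV d1 (T1 : measurableType d1) (f : T1 -> 'rV[T]_n) :
  (forall i, measurable_fun [set: T1] (fun x => f x ord0 i)) ->
  measurable_fun [set: T1] f.
Proof.
move=> mf.
have H : g_sigma_preimage (fun i => coord i \o f) `<=` measurable.
  apply: smallest_sub; first exact: sigma_algebra_measurable.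
  rewrite -bigcup_seq => A [i _] [B mB <-].
  exact: (mf i).
rewrite g_sigma_preimage_comp in H.
by move=> _ A mA; apply: H; exists A.
Qed.

End measurable_rV.

Section lebesgue_rV.
Context {R : realType}.
Local Open Scope ereal_scope.

Definition rV_cons n (p : R * 'rV[R]_n) : 'rV[R]_n.+1 :=
  (row_mx (const_mx p.1) p.2 : 'rV_(1 + n)).

Definition rV_uncons n (x : 'rV[R]_n.+1) : R * 'rV[R]_n :=
  (x ord0 ord0, \row_i x ord0 (lift ord0 i)).

Lemma rV_consK n : cancel (@rV_cons n) (@rV_uncons n).
Proof.
case=> a v; rewrite /rV_uncons /rV_cons /=; congr pair.
  by rewrite mxE; case: split_ordP => j e; [rewrite mxE | have := congr1 val e].
apply/rowP => i; rewrite !mxE; case: split_ordP => j e; have := congr1 val e.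
  by move=> /= h; have := ltn_ord j; rewrite -h.
by move=> /= [h]; congr (v _ _); exact: val_inj.
Qed.

Lemma measurable_rV_cons n : measurable_fun [set: R * 'rV[R]_n] (@rV_cons n).
Proof.
apply: measurable_fun_rV => i; rewrite /rV_cons.
case: (split_ordP (i : 'I_(1 + n))) => j ->.
  rewrite [X in measurable_fun _ X](_ : _ = fst) ?measurable_fst//.
  by apply/funext => p; apply: etrans (row_mxEl _ _ _ _) _; rewrite mxE.
rewrite [X in measurable_fun _ X](_ : _ = (fun x : 'rV[R]_n => x ord0 j) \o snd).
  exact: (measurableT_comp (measurable_rV_coord j) measurable_snd).
by apply/funext => p; apply: etrans (row_mxEr _ _ _ _) _.
Qed.

Lemma measurable_rV_uncons n : measurable_fun [set: 'rV[R]_n.+1] (@rV_uncons n).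
Proof.
apply: measurable_fun_pair; first exact: measurable_rV_coord.
apply: measurable_fun_rV => i; under eq_fun do rewrite mxE.
exact: measurable_rV_coord.
Qed.

Section step.
Variables (n : nat) (mu : {sigma_finite_measure set 'rV[R]_n -> \bar R}).

Definition lebesgue_rV_step : set 'rV[R]_n.+1 -> \bar R :=
  pushforward (lebesgue_measure \x mu) (@rV_cons n).

Let mcons A : measurable A -> measurable ((@rV_cons n) @^-1` A).
Proof. by move=> mA; rewrite -[X in measurable X]setTI; exact: measurable_rV_cons. Qed.

Let step0 : lebesgue_rV_step set0 = 0.
Proof. by rewrite /lebesgue_rV_step /pushforward preimage_set0 measure0. Qed.

Let step_ge0 A : 0 <= lebesgue_rV_step A.
Proof. exact: (measure_ge0 (lebesgue_measure \x mu)). Qed.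

Let step_sigma_additive : semi_sigma_additive lebesgue_rV_step.
Proof.
move=> F mF tF mUF; rewrite /lebesgue_rV_step /pushforward preimage_bigcup.
apply: measure_semi_sigma_additive.
- by move=> k; exact: mcons.
- apply/trivIsetP => /= i j _ _ ij; rewrite -preimage_setI.
  by move/trivIsetP : tF => /(_ _ _ _ _ ij) ->//; rewrite preimage_set0.
- by rewrite -preimage_bigcup; exact: mcons.
Qed.

HB.instance Definition _ := isMeasure.Build _ _ _ lebesgue_rV_step
  step0 step_ge0 step_sigma_additive.

Let step_sigma_finite : sigma_finite setT lebesgue_rV_step.
Proof.
have /sigma_finiteP[F [TF ndF Foo]] := sigma_finiteT (@lebesgue_measure R).
have /sigma_finiteP[G [TG ndG Goo]] := sigma_finiteT mu.
exists (fun k => (@rV_uncons n) @^-1` (F k `*` G k)).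
  rewrite -preimage_bigcup (_ : \bigcup_i _ = setT) ?preimage_setT//.
  apply/seteqP; split=> // -[x y] _.
  have [i _ Fx] : (\bigcup_i F i) x by rewrite -TF.
  have [j _ Gy] : (\bigcup_i G i) y by rewrite -TG.
  exists (maxn i j) => //; split => /=.
  - by move: x Fx; exact/subsetPset/ndF/leq_maxl.
  - by move: y Gy; exact/subsetPset/ndG/leq_maxr.
move=> k; have [mF Fk] := Foo k; have [mG Gk] := Goo k; split.
  rewrite -[X in measurable X]setTI; apply: measurable_rV_uncons => //.
  exact: measurableX.
rewrite /lebesgue_rV_step /pushforward -comp_preimage.
rewrite (_ : _ \o _ = id); last by apply/funext => p /=; rewrite rV_consK.
by rewrite preimage_id product_measure1E// lte_mul_pinfty// ge0_fin_numE.
Qed.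

HB.instance Definition _ := Measure_isSigmaFinite.Build _ _ _ lebesgue_rV_step
  step_sigma_finite.
End step.

(* n-dimensional Lebesgue measure, as the iterated product of the
   one-dimensional one along R^(n+1) = R x R^n. *)
Fixpoint lebesgue_rV n : {sigma_finite_measure set 'rV[R]_n -> \bar R} :=
  if n is m.+1 then lebesgue_rV_step (lebesgue_rV m) else \d_(0%R : 'rV[R]_0).

End lebesgue_rV.
Arguments lebesgue_rV {R} n.

Section euclidean.
Variables (R : realType) (d : nat).
Implicit Types (u v x : 'rV[R]_d) (f : 'rV[R]_d -> R) (D : set 'rV[R]_d).

Definition dot u v : R := \sum_(i < d) u ord0 i * v ord0 i.

Definition partial (i : 'I_d) f : 'rV[R]_d -> R :=
  fun x => 'D_(delta_mx ord0 i) f x.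

Definition grad f (x : 'rV[R]_d) : 'rV[R]_d := \row_i partial i f x.

Definition divergence (r : 'rV[R]_d -> 'rV[R]_d) (x : 'rV[R]_d) : R :=
  \sum_(i < d) partial i (fun y => r y ord0 i) x.

Fixpoint contdiff (k : nat) f : Prop :=
  if k is k'.+1 then
    continuous f /\ forall i : 'I_d,
      (forall x, derivable f x (delta_mx ord0 i)) /\ contdiff k' (partial i f)
  else continuous f.

Definition smooth f : Prop := forall k, contdiff k f.

Definition test_function D f : Prop :=
  smooth f /\
  exists K, [/\ compact K, K `<=` D & forall x, ~ K x -> f x = 0].

Definition L2 D f : Prop :=
  measurable_fun D f /\
  (\int[lebesgue_rV d]_(x in D) ((f x) ^+ 2)%:E < +oo)%E.

Definition weak_partial D (i : 'I_d) f (g : 'rV[R]_d -> R) : Prop :=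
  forall phi, test_function D phi ->
    \int[lebesgue_rV d]_(x in D) (f x * partial i phi x) =
    - \int[lebesgue_rV d]_(x in D) (g x * phi x).

Definition H1 D f : Prop :=
  L2 D f /\ forall i : 'I_d, exists g, L2 D g /\ weak_partial D i f g.

Definition H1vec D (w : 'rV[R]_d -> 'rV[R]_d) : Prop :=
  forall i : 'I_d, H1 D (fun x => w x ord0 i).

(* The condition int (cl D) = D rules out slits: n_F would not be defined on
   a face having D on both sides. *)
Definition polyhedral_domain D : Prop :=
  [/\ open D, D !=set0, connected D, bounded_set D &
   interior (closure D) = D /\
   exists H : seq ('rV[R]_d * R),
     (forall h, h \in H -> h.1 != 0) /\
     forall x, closure D x -> ~ D x ->
       exists2 h, h \in H & dot h.1 x = h.2].

Definition affine_fun (q : 'rV[R]_d -> R) : Prop :=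
  exists (c : R) (g : 'rV[R]_d), forall x, q x = c + dot g x.

Definition RT0 (r : 'rV[R]_d -> 'rV[R]_d) : Prop :=
  exists (a : 'rV[R]_d) (b : R), forall x, r x = a + b *: x.

End euclidean.

(* Simplices and their faces are identified with their sets of vertices;
   see [hull] for the closed convex set they span. *)
Definition hull (R : realType) (d : nat) (V : finType) (pos : V -> 'rV[R]_d)
    (S : {set V}) : set 'rV[R]_d :=
  fun x => exists l : V -> R,
    [/\ forall v, v \in S -> 0 <= l v,
        \sum_(v in S) l v = 1 &
        x = \sum_(v in S) l v *: pos v].

Definition affinely_independent (R : realType) (d : nat) (V : finType)
    (pos : V -> 'rV[R]_d) (S : {set V}) : Prop :=
  forall l : V -> R,
    \sum_(v in S) l v = 0 -> \sum_(v in S) l v *: pos v = 0 ->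
    forall v, v \in S -> l v = 0.

Record simplicial_mesh (R : realType) (d : nat) := SimplicialMesh {
  vertex :> finType;
  pos : vertex -> 'rV[R]_d;
  cells : {set {set vertex}};
  pos_inj : injective pos;
  card_cell : forall T, T \in cells -> #|T| = d.+1;
  cell_indep : forall T, T \in cells -> affinely_independent pos T;
  (* no hanging nodes; S is empty when T and T' are disjoint *)
  conformal : forall T T', T \in cells -> T' \in cells ->
    exists S : {set vertex}, [/\ S \subset T, S \subset T' &
      hull pos T `&` hull pos T' = hull pos S]
}.

Section mesh.
Variables (R : realType) (d : nat) (Th : simplicial_mesh R d).
Implicit Types (T F S : {set Th}) (x n : 'rV[R]_d).
Implicit Types (w r : 'rV[R]_d -> 'rV[R]_d).

Local Notation hull := (hull (@pos R d Th)).

Definition mesh_of (Omega : set 'rV[R]_d) : Prop :=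
  closure Omega = [set x | exists2 T, T \in cells Th & hull T x].

Definition relint S : set 'rV[R]_d :=
  fun x => exists l : Th -> R,
    [/\ forall v, v \in S -> 0 < l v,
        \sum_(v in S) l v = 1 &
        x = \sum_(v in S) l v *: pos v].

Definition face_of T F : bool := (F \subset T) && (#|F| == d).

Definition interior_face F : bool :=
  (#|F| == d) &&
  [exists T1 in cells Th, exists T2 in cells Th,
     (T1 != T2) && (F == T1 :&: T2)].

Definition boundary_face (Omega : set 'rV[R]_d) F : bool :=
  [exists T in cells Th, face_of T F] &&
  `[< hull F `<=` closure Omega `\` Omega >].

Definition unit_normal F n : Prop :=
  dot n n = 1 /\
  forall a b : Th, a \in F -> b \in F -> dot n (pos a - pos b) = 0.

Definition outward_normal T F n : Prop :=
  unit_normal F n /\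
  forall a v : Th, a \in F -> v \in T -> v \notin F ->
    dot n (pos v - pos a) < 0.

Definition boundary_normal (Omega : set 'rV[R]_d) F n : Prop :=
  unit_normal F n /\
  forall x, relint F x ->
    exists2 e : R, 0 < e & forall t : R, 0 < t -> t < e ->
      Omega (x - t *: n) /\ ~ closure Omega (x + t *: n).

(* Surface integrals over F, through the affine parametrization
   t |-> p_0 + \sum_i t_i (p_(i+1) - p_0) of F by the standard simplex of
   R^(d-1), with Gram determinant weight; p_0, ..., p_(d-1) are the vertices
   of F. *)
Definition face_pt F (i : nat) : 'rV[R]_d := nth 0 [seq pos v | v <- enum F] i.

Definition face_edges F : 'M[R]_(d.-1, d) :=
  \matrix_(i < d.-1) (face_pt F i.+1 - face_pt F 0).

Definition face_param F (t : 'rV[R]_d.-1) : 'rV[R]_d :=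
  face_pt F 0 + t *m face_edges F.

Definition face_jac F : R :=
  Num.sqrt (\det (face_edges F *m (face_edges F)^T)).

Definition std_simplex (m : nat) : set 'rV[R]_m :=
  [set t | (forall i, 0 <= t ord0 i) /\ \sum_i t ord0 i <= 1].

Definition face_eint F (f : 'rV[R]_d -> \bar R) : \bar R :=
  ((face_jac F)%:E *
   \int[lebesgue_rV d.-1]_(t in @std_simplex d.-1) f (face_param F t))%E.

Definition face_int F (f : 'rV[R]_d -> R) : R :=
  fine (face_eint F (fun x => (f x)%:E)).

Definition L2_face F (f : 'rV[R]_d -> R) : Prop :=
  measurable_fun (@std_simplex d.-1) (f \o face_param F) /\
  (face_eint F (fun x => ((f x) ^+ 2)%:E) < +oo)%E.

(* g is the trace on F of f|_T, f|_T being in H^1(int T): the image of f|_T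
   under the continuous extension H^1(T) -> L^2(F) of the restriction map
   from smooth functions on T. *)
Definition is_trace T F (f g : 'rV[R]_d -> R) : Prop :=
  L2_face F g /\
  exists (df : 'I_d -> 'rV[R]_d -> R) (u : nat -> 'rV[R]_d -> R),
    [/\ forall i, L2 (interior (hull T)) (df i) /\
                  weak_partial (interior (hull T)) i f (df i),
        forall k, smooth (u k),
        (\int[lebesgue_rV d]_(x in interior (hull T))
           ((u k x - f x) ^+ 2)%:E)%E @[k --> \oo] --> 0%E,
        forall i,
          (\int[lebesgue_rV d]_(x in interior (hull T))
             ((partial i (u k) x - df i x) ^+ 2)%:E)%E @[k --> \oo] --> 0%E &
        face_eint F (fun x => ((u k x - g x) ^+ 2)%:E) @[k --> \oo] --> 0%E].

(* tr T F : trace on F of w|_T *)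
Definition traces w (tr : {set Th} -> {set Th} -> 'rV[R]_d -> 'rV[R]_d) : Prop :=
  forall T F, T \in cells Th -> face_of T F -> forall i : 'I_d,
    is_trace T F (fun x => w x ord0 i) (fun x => tr T F x ord0 i).

(* L^2(F)-projection onto constants, by orthogonality of the residual. *)
Definition Pi0 F (f : 'rV[R]_d -> R) : R :=
  xget 0 [set c : R | forall q : R, face_int F (fun x => (f x - c) * q) = 0].

(* The function equal to f T on int T, for each cell T. *)
Definition glue (A : nmodType) (f : {set Th} -> 'rV[R]_d -> A) (x : 'rV[R]_d) : A :=
  if [pick T in cells Th | `[< interior (hull T) x >]] is Some T then f T x else 0.

Definition affine_on T (f q : 'rV[R]_d -> R) : Prop :=
  affine_fun q /\
  {ae lebesgue_rV d, forall x, hull T x -> f x = q x}.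

Definition P1dc (Omega : set 'rV[R]_d) (f : 'rV[R]_d -> R) : Prop :=
  L2 Omega f /\ forall T, T \in cells Th -> exists q, affine_on T f q.

(* The polynomial f|_T, for f in P1dc. *)
Definition restr (f : 'rV[R]_d -> R) T : 'rV[R]_d -> R :=
  xget (cst 0) [set q | affine_on T f q].

Definition grad_h (f : 'rV[R]_d -> R) : 'rV[R]_d -> 'rV[R]_d :=
  glue (fun T => grad (restr f T)).

Section RT_interpolation.
Variable tr : {set Th} -> {set Th} -> 'rV[R]_d -> 'rV[R]_d.

Definition RT_interpolant T r : Prop :=
  RT0 r /\
  forall F, face_of T F -> forall n, outward_normal T F n ->
    face_int F (fun x => dot (r x) n) = face_int F (fun x => dot (tr T F x) n).

Definition RT_local T : 'rV[R]_d -> 'rV[R]_d :=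
  xget (cst 0) [set r | RT_interpolant T r].

Definition RT_interp : 'rV[R]_d -> 'rV[R]_d := glue RT_local.

(* RT_interp is in H(div), hence its divergence is computed cellwise. *)
Definition div_RT_interp : 'rV[R]_d -> R :=
  glue (fun T => divergence (RT_local T)).

End RT_interpolation.

Definition orientation (T1 T2 : {set Th} -> {set Th}) : Prop :=
  forall F, interior_face F ->
    [/\ T1 F \in cells Th, T2 F \in cells Th, T1 F != T2 F &
        F = T1 F :&: T2 F].

(* for a boundary face, the only cell containing it *)
Definition boundary_cell F : {set Th} :=
  odflt finset.set0 [pick T in cells Th | face_of T F].

Definition jump (T1 T2 : {set Th} -> {set Th}) (f : 'rV[R]_d -> R) F :
    'rV[R]_d -> R :=
  fun x => restr f (T1 F) x - restr f (T2 F) x.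

Definition average (T1 T2 : {set Th} -> {set Th})
    (omega : {set Th} -> {set Th} -> R)
    (tr : {set Th} -> {set Th} -> 'rV[R]_d -> 'rV[R]_d) F : 'rV[R]_d -> 'rV[R]_d :=
  fun x => omega (T1 F) F *: tr (T1 F) F x + omega (T2 F) F *: tr (T2 F) F x.

End mesh.

(* Main.v *)
Require Import Defs.
From HB Require Import structures.
From mathcomp Require Import all_boot all_order all_algebra.
From mathcomp Require Import all_classical all_reals all_analysis.
From mathcomp Require Import measurable_realfun.
From mathcomp Require Import perm ring lra.
Set Implicit Arguments.
Unset Strict Implicit.
Unset Printing Implicit Defensive.
Import Order.TTheory GRing.Theory Num.Theory.
Import numFieldNormedType.Exports.
Local Open Scope classical_set_scope.
Local Open Scope ring_scope.

(* On a cell T, Green's formula for the interpolant r of w and the affine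
   function q = psi|_T expresses the integral of r . grad q + div r q as the sum
   over the faces F of T of the integral of (r . n_T) q.  Since r . n_T is
   constant on F, q may be replaced by Pi_F^0 q there, and then r . n_T by
   w . n_T, which has the same integral over F.  Summing over the cells, a
   boundary face occurs once and an interior face twice, with opposite normals.
   The two traces of w on an interior face have the same integral: test the weak
   derivatives of w against smooth cutoffs, supported in the two cells and
   tending to 1 on F, and apply Green's formula (extended to traces by density)
   on both sides.  Hence any average of the two traces with weights of sum 1 may
   be used. *)

(** * Lebesgue measure on row vectors *)

Section lebesgue_rV_theory.
Context {R : realType}.
Local Open Scope ereal_scope.

(** The delicate place is an interior face, where the two traces come from approximations attached
    to different cells. The cutoffs are products of exp(-1/(k l - 1)), where l runs over the
    barycentric coordinates of both cells at the vertices of F; the coordinates of the two opposite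
    vertices are left out. Such a cutoff vanishes near the other faces of both cells, so each Green
    formula keeps only its term on F, while nothing is cut off across F. Its gradient blows up with
    k, which does no harm: for each fixed k the volume terms of the two cells add up to zero
    exactly, and the limit is taken in the face integrals alone. On one cell, the fundamental
    theorem of calculus along an edge leaves the two faces opposite its ends. Metric factors are
    then restored by [face_jac F *: n = - (cell_scale T *: g)], where [g] is the gradient of the
    barycentric coordinate of the vertex opposite F. *)

Lemma ge0_integral_affine1 (a b : R) (f : R -> \bar R) : a != 0%R ->
  measurable_fun [set: R] f -> (forall x, 0 <= f x) ->
  `|a|%:E * \int[lebesgue_measure]_x f (a * x + b)%R =
  \int[lebesgue_measure]_x f x.
Proof.
move=> a0 mf f0; pose phi (x : R) : measurableTypeR R := (a * x + b)%R.
have mphi : measurable_fun [set: R] phi.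
  by apply: measurable_funD => //; exact: measurable_funM.
pose nu0 : {measure set (measurableTypeR R) -> \bar R} :=
  measure_function_pushforward__canonical__measure_function_Measure
    (@lebesgue_measure R) mphi.
pose nu := mscale (NngNum (normr_ge0 a)) nu0.
transitivity (\int[nu]_x f x).
  rewrite ge0_integral_mscale//; congr (_ * _).
  by rewrite ge0_integral_pushforward//.
(* By uniqueness of Lebesgue measure, the scaled pushforward only has to be compared with it on
   half-open intervals; a negative slope moves the closed end to the left. *)
apply: eq_measure_integral => A mA _; apply/esym/lebesgue_measure_unique => //.
move=> _ [[u v]] _ <-; rewrite /= /mscale/= /pushforward /=.
have [a_gt0|a_lt0|aE] := ltrgt0P a; last by rewrite aE eqxx in a0.
  have -> : phi @^-1` `]u, v] = `]((u - b) / a)%R, ((v - b) / a)%R]%classic.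
    apply/seteqP; split=> x; rewrite /= !in_itv/= ltr_pdivrMr// ler_pdivlMr//;
    by rewrite /phi ltrBlDr lerBrDr mulrC.
  rewrite !lebesgue_measure_itv/= !lte_fin ltr_pM2r ?invr_gt0// ltrD2r.
  case: ifPn => _; last by rewrite mule0.
  by rewrite -!EFinB -EFinM; congr EFin; field.
have -> : phi @^-1` `]u, v] = `[((v - b) / a)%R, ((u - b) / a)%R[%classic.
  apply/seteqP; split=> x; rewrite /= !in_itv/= ltr_ndivlMr// ler_ndivrMr//;
  by rewrite /phi ltrBlDr lerBrDr mulrC andbC.
rewrite !lebesgue_measure_itv/= !lte_fin ltr_nM2r ?invr_lt0// ltrD2r.
case: ifPn => _; last by rewrite mule0.
by rewrite -!EFinB -EFinM; congr EFin; field.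
Qed.

Lemma ge0_integral_rVS n (f : 'rV[R]_n.+1 -> \bar R) :
  measurable_fun setT f -> (forall x, 0 <= f x) ->
  \int[lebesgue_rV n.+1]_x f x =
  \int[lebesgue_measure]_a \int[lebesgue_rV n]_v f (rV_cons (a, v)).
Proof.
move=> mf f0; rewrite /= ge0_integral_pushforward//; last exact: measurable_rV_cons.
rewrite preimage_setT fubini_tonelli1//; last by move=> x; exact: f0.
by apply: measurableT_comp => //; exact: measurable_rV_cons.
Qed.

Lemma ge0_integral_rVS_swap n (f : 'rV[R]_n.+1 -> \bar R) :
  measurable_fun setT f -> (forall x, 0 <= f x) ->
  \int[lebesgue_rV n.+1]_x f x =
  \int[lebesgue_rV n]_v \int[lebesgue_measure]_a f (rV_cons (a, v)).
Proof.
move=> mf f0; rewrite ge0_integral_rVS//.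
apply: (@fubini_tonelli _ _ (measurableTypeR R) _ R lebesgue_measure
  (lebesgue_rV n) (f \o @rV_cons R n)); last by move=> x; exact: f0.
by apply: measurableT_comp => //; exact: measurable_rV_cons.
Qed.

Lemma measurable_rV_affine m n (A : 'M[R]_(m, n)) (b : 'rV[R]_n) :
  measurable_fun [set: 'rV[R]_m] (fun x : 'rV[R]_m => (x *m A + b)%R).
Proof.
apply: measurable_fun_rV => i; under eq_fun do rewrite !mxE.
apply: measurable_funD => //; apply: measurable_sum => j.
by apply: measurable_funM => //; exact: measurable_rV_coord.
Qed.

Lemma rV_unconsK n : cancel (@rV_uncons R n) (@rV_cons R n).
Proof.
move=> x; apply/rowP => i; rewrite /rV_cons/= mxE.
case: (split_ordP (i : 'I_(1 + n))) => j ->; rewrite !mxE;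
  by congr (x _ _); apply: val_inj => //=; rewrite ord1.
Qed.

Lemma rV_cons0 n (p : R * 'rV[R]_n) : rV_cons p ord0 ord0 = p.1.
Proof. by rewrite -[in RHS](rV_consK p). Qed.

Lemma rV_consS n  (p : R * 'rV[R]_n) (i : 'I_n) :
  rV_cons p ord0 (lift ord0 i) = p.2 ord0 i.
Proof. by have := congr1 snd (rV_consK p) => /rowP/(_ i); rewrite mxE. Qed.

Lemma rV_consP n (x y : 'rV[R]_n.+1) : x ord0 ord0 = y ord0 ord0 ->
  (forall i : 'I_n, x ord0 (lift ord0 i) = y ord0 (lift ord0 i)) -> x = y.
Proof.
by move=> e0 eS; apply/rowP => i; case: (unliftP ord0 i) => [j|] ->.
Qed.

Lemma rV_consD n (a b : R) (u v : 'rV[R]_n) :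
  (rV_cons (a, u) + rV_cons (b, v))%R = rV_cons ((a + b)%R, (u + v)%R).
Proof. by apply: rV_consP => [|i]; rewrite mxE !(rV_cons0, rV_consS)//= mxE. Qed.

Lemma ge0_integral_rV_shift n (b : 'rV[R]_n) (f : 'rV[R]_n -> \bar R) :
  measurable_fun setT f -> (forall x, 0 <= f x) ->
  \int[lebesgue_rV n]_x f (x + b)%R = \int[lebesgue_rV n]_x f x.
Proof.
elim: n b f => [b f mf f0|n IH b f mf f0].
  by apply: eq_integral => x _; congr f; rewrite [LHS]thinmx0 [RHS]thinmx0.
have ms : measurable_fun setT (fun x : 'rV[R]_n.+1 => f (x + b)%R).
  apply: (measurableT_comp mf).
  by have := measurable_rV_affine 1%:M b; under eq_fun do rewrite mulmx1.
rewrite !ge0_integral_rVS//.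
pose G a : \bar R := \int[lebesgue_rV n]_v f (rV_cons (a, v)).
have mfc : measurable_fun setT (f \o rV_cons (n:=n)).
  by apply: measurableT_comp => //; exact: measurable_rV_cons.
have mG : measurable_fun [set: measurableTypeR R] G.
  by apply: (measurable_fun_fubini_tonelli_F (f \o rV_cons (n:=n))) => // x; exact: f0.
have G0 a : 0 <= G a by apply: integral_ge0.
have := @ge0_integral_affine1 1%R (rV_uncons b).1 G (oner_neq0 _) mG G0.
rewrite normr1 mul1e => <-; apply: eq_integral => a _; rewrite /G mul1r.
rewrite -(IH (rV_uncons b).2 (fun v => f (rV_cons ((a + (rV_uncons b).1)%R, v))))//.
  by apply: eq_integral => v _; rewrite -rV_consD (rV_unconsK b).
by apply: (measurableT_comp mfc); exact: measurable_pair1.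
Qed.

(** The linear change of variables as a property of the matrix: being stable under products, it need
    only be checked on the factors of an elimination. *)
Let cov n (A : 'M[R]_n) := forall f : 'rV[R]_n -> \bar R,
  measurable_fun setT f -> (forall x, 0 <= f x) ->
  `|\det A|%:E * \int[lebesgue_rV n]_x f (x *m A)%R = \int[lebesgue_rV n]_x f x.

Let measurable_lin n (A : 'M[R]_n) (f : 'rV[R]_n -> \bar R) :
  measurable_fun setT f -> measurable_fun setT (fun x : 'rV[R]_n => f (x *m A)%R).
Proof.
move=> mf; apply: (measurableT_comp mf).
by have := measurable_rV_affine A 0; under eq_fun do rewrite addr0.
Qed.

Let covM n (A B : 'M[R]_n) : cov A -> cov B -> cov (A *m B).
Proof.
move=> cA cB f mf f0; rewrite det_mulmx normrM mulrC EFinM -muleA.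
rewrite -(cB f mf f0); congr (_ * _).
rewrite -(cA (fun x => f (x *m B)%R))//; last exact: measurable_lin.
by congr (_ * _); apply: eq_integral => x _; rewrite mulmxA.
Qed.

Let rV_cons_block n (a : R) (v : 'rV[R]_n) (A : R) (B : 'rV[R]_n) (C : 'cV[R]_n)
    (D : 'M[R]_n) :
  (rV_cons (a, v) *m (block_mx (const_mx A) B C D : 'M[R]_(1 + n)) =
  rV_cons (a * A + (v *m C) ord0 ord0, a *: B + v *m D))%R.
Proof.
rewrite /rV_cons/= (mul_row_block (const_mx a : 'M[R]_1) v (const_mx A) B C D).
congr row_mx.
  by apply/matrixP => i j; rewrite !ord1 !mxE big_ord1 !mxE.
congr (_ + _)%R; apply/rowP => i; rewrite !mxE big_ord1 !mxE//.
Qed.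

(** With the first coordinate [a] frozen, this shear translates the others by [a *: e], which leaves
    the inner integral unchanged. *)
Let cov_upper n (e : 'rV[R]_n) :
  cov (block_mx (const_mx 1%R) e 0 1%:M : 'M[R]_(1 + n)).
Proof.
move=> f mf f0; rewrite det_ublock det1 mulr1 det_mx11 mxE normr1 mul1e.
rewrite !ge0_integral_rVS//; last exact: measurable_lin.
apply: eq_integral => a _.
rewrite -[RHS](ge0_integral_rV_shift (a *: e)%R)//; last first.
  apply: (measurableT_comp mf); apply: (measurableT_comp (@measurable_rV_cons R n)).
  exact: measurable_pair1.
by apply: eq_integral => v _; rewrite rV_cons_block mulmx0 mxE addr0 mulr1 mulmx1 addrC.
Qed.

(** Here the first coordinate is translated by an amount depending on the others, hence the opposite
    order of integration. *)
Let cov_lower n (c : 'cV[R]_n) :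
  cov (block_mx (const_mx 1%R) 0 c 1%:M : 'M[R]_(1 + n)).
Proof.
move=> f mf f0; rewrite det_lblock det1 mulr1 det_mx11 mxE normr1 mul1e.
rewrite !ge0_integral_rVS_swap//; last exact: measurable_lin.
apply: eq_integral => v _.
rewrite -[RHS](@ge0_integral_affine1 1%R ((v *m c) ord0 ord0)%R)//; last first.
  apply: (measurableT_comp mf); apply: (measurableT_comp (@measurable_rV_cons R n)).
  exact: measurable_pair2.
rewrite normr1 mul1e; apply: eq_integral => a _.
by rewrite rV_cons_block scaler0 add0r mulr1 mulmx1 mul1r.
Qed.

Let cov_diag n (a : R) (D : 'M[R]_n) : a != 0%R -> cov D ->
  cov (block_mx (const_mx a) 0 0 D : 'M[R]_(1 + n)).
Proof.
move=> a0 cD f mf f0; rewrite det_ublock det_mx11 mxE normrM EFinM -muleA.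
rewrite !ge0_integral_rVS//; last exact: measurable_lin.
pose G a : \bar R := \int[lebesgue_rV n]_v f (rV_cons (a, v)).
have mfc : measurable_fun setT (f \o rV_cons (n:=n)).
  by apply: measurableT_comp => //; exact: measurable_rV_cons.
have mG : measurable_fun [set: measurableTypeR R] G.
  by apply: (measurable_fun_fubini_tonelli_F (f \o rV_cons (n:=n))) => // x; exact: f0.
have G0 b : 0 <= G b by apply: integral_ge0.
rewrite -(@ge0_integral_affine1 a 0%R G)//; congr (_ * _).
rewrite -ge0_integralZl//; last 2 first.
- apply: (@measurable_fun_fubini_tonelli_F _ _ (measurableTypeR R) _ _ _
    (fun p => f (rV_cons p *m (block_mx (const_mx a) 0 0 D : 'M[R]_(1 + n))))%R) => //.
  exact: (measurableT_comp (measurable_lin _ mf) (@measurable_rV_cons R n)).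
- by move=> x _; exact: integral_ge0.
apply: eq_integral => x _; rewrite /G -[RHS]cD//; last first.
  exact: (measurableT_comp mfc (measurable_pair1 _)).
congr (_ * _); apply: eq_integral => v _.
by rewrite rV_cons_block mulmx0 mxE scaler0 add0r mulrC.
Qed.

Let cov_unit n (A : 'M[R]_n) : \det A != 0%R -> cov A.
Proof.
elim: n A => [A _ f mf f0|n IH A].
  rewrite det_mx00 normr1 mul1e; apply: eq_integral => x _; congr f.
  by rewrite [LHS]thinmx0 [RHS]thinmx0.
have c1 : const_mx 1%R = 1%:M :> 'M[R]_1.
  by apply/matrixP => i j; rewrite !mxE !ord1.
have pivot (B : 'M[R]_(1 + n)) : \det B != 0%R -> B ord0 ord0 != 0%R -> cov B.
  move=> dB B00; set a := B ord0 ord0.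
  (* [S] is the Schur complement of the pivot: [B] is a lower shear, times a block diagonal matrix
     with blocks [a] and [S], times an upper shear. *)
  pose S := (drsubmx B - dlsubmx B *m (a^-1 *: ursubmx B))%R.
  have BE : (B = block_mx (const_mx 1%R) 0 (a^-1 *: dlsubmx B) 1%:M *m
     (block_mx (const_mx a) 0 0 S *m
      block_mx (const_mx 1%R) (a^-1 *: ursubmx B) 0 1%:M))%R.
    rewrite -[LHS]submxK !mulmx_block !(mulmx0, mul0mx, addr0, add0r, mulmx1, mul1mx).
    have ca : const_mx a = a%:M :> 'M[R]_1.
      by apply/matrixP => i j; rewrite !mxE !ord1.
    rewrite c1 ca !mulmx1 !mul1mx mul_scalar_mx mul_mx_scalar !scalerA mulfV// !scale1r.
    congr block_mx; last by rewrite /S -scalemxAr scalemxAl addrC subrK.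
    apply/matrixP => i j; rewrite !mxE !ord1 eqxx mulr1n /a.
    by congr (B _ _); exact: val_inj.
  rewrite BE; apply: covM; first exact: cov_lower.
  apply: covM; last exact: cov_upper.
  apply: cov_diag => //; apply: IH; apply: contra_neq dB => S0.
  by rewrite BE !det_mulmx det_ublock S0 mulr0 mul0r mulr0.
move=> dA; have [A00|] := eqVneq (A ord0 ord0) 0%R; last exact: pivot.
(* A zero pivot is repaired by adding to the first row another row with a nonzero first entry; that
   operation and its inverse are upper shears. *)
have [i Ai] : exists i : 'I_n, A (lift ord0 i) ord0 != 0%R.
  apply/existsP; apply: contra_neqT dA; rewrite negb_exists => /forallP Ai.
  rewrite (expand_det_col _ ord0) big1// => j _.
  case: (unliftP ord0 j) => [k|] ->; last by rewrite A00 mul0r.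
  by have /negPn/eqP -> := Ai k; rewrite mul0r.
pose U e : 'M[R]_(1 + n) := (block_mx (const_mx 1) e 0 1%:M)%R.
pose d : 'rV[R]_n := delta_mx ord0 i.
have AE : (A = U (- d) *m (U d *m A))%R.
  rewrite mulmxA -[LHS]mul1mx; congr (_ *m _).
  rewrite /U c1 mulmx_block !(mulmx0, mul0mx, addr0, add0r, mulmx1, mul1mx).
  by rewrite subrr -scalar_mx_block.
rewrite AE; apply: covM; first exact: cov_upper.
apply: pivot.
  by rewrite det_mulmx det_ublock det1 mulr1 det_mx11 mxE mul1r.
have Ud (k : 'I_n) : U d ord0 (lift ord0 k) = d ord0 k.
  rewrite (_ : lift ord0 k = rshift 1 k); last exact: val_inj.
  rewrite (_ : ord0 = lshift n ord0 :> 'I_(1 + n)); last exact: val_inj.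
  by rewrite block_mxEur.
rewrite mxE big_ord_recl A00 mulr0 add0r (bigD1 i)//= big1 => [|k ki].
  by rewrite Ud mxE !eqxx mul1r addr0.
by rewrite Ud mxE eqxx (negbTE ki) mul0r.
Qed.

Lemma ge0_integral_rV_affine n (A : 'M[R]_n) (b : 'rV[R]_n)
    (f : 'rV[R]_n -> \bar R) : \det A != 0%R ->
  measurable_fun setT f -> (forall x, 0 <= f x) ->
  `|\det A|%:E * \int[lebesgue_rV n]_x f (x *m A + b)%R =
  \int[lebesgue_rV n]_x f x.
Proof.
move=> dA mf f0; rewrite -[RHS](ge0_integral_rV_shift b)//.
rewrite -[RHS](cov_unit dA)//; apply: (measurableT_comp mf).
by have := measurable_rV_affine 1%:M b; under eq_fun do rewrite mulmx1.
Qed.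

(** Infinite values are allowed, so that the change of variables below asks for measurability of [f]
    only. *)
Let pmuleBr (r : R) (x y : \bar R) : (0 < r)%R ->
  r%:E * (x - y) = r%:E * x - r%:E * y.
Proof.
move=> r0; case: x => [x| |]; case: y => [y| |];
  rewrite ?(gt0_muley, gt0_muleNy, gt0_mulye, gt0_mulNye) ?lte_fin//.
by rewrite -EFinB -!EFinM -EFinB mulrBr.
Qed.

Lemma integral_rV_affine n (A : 'M[R]_n) (b : 'rV[R]_n) (D : set 'rV[R]_n)
    (f : 'rV[R]_n -> \bar R) : \det A != 0%R ->
  measurable D -> measurable_fun D f ->
  `|\det A|%:E * \int[lebesgue_rV n]_(x in [set x | D (x *m A + b)%R])
    f (x *m A + b)%R =
  \int[lebesgue_rV n]_(x in D) f x.
Proof.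
move=> dA mD mf.
have mDf : measurable_fun setT (f \_ D) by exact/(measurable_restrictT _ mD).
rewrite integral_mkcond [RHS]integral_mkcond.
rewrite (_ : (fun x => f (x *m A + b)%R) \_ _ =
  (f \_ D) \o (fun x : 'rV[R]_n => (x *m A + b)%R)); last first.
  by apply/funext => x; rewrite /= !patchE; congr (if _ then _ else _);
    apply/idP/idP; rewrite !inE.
rewrite integralE [RHS]integralE.
rewrite pmuleBr ?normr_gt0// funepos_comp funeneg_comp.
have := ge0_integral_rV_affine b dA (measurable_funepos mDf) (fun x => funepos_ge0 _ x).
have := ge0_integral_rV_affine b dA (measurable_funeneg mDf) (fun x => funeneg_ge0 _ x).
by move=> -> ->.
Qed.

Lemma measurable_dot n (g : 'rV[R]_n) : measurable_fun setT (dot g).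
Proof.
apply: measurable_sum => i; apply: measurable_funM => //.
exact: measurable_rV_coord.
Qed.

Lemma dot_cons n (g x : 'rV[R]_n.+1) : dot g x =
  (g ord0 ord0 * x ord0 ord0 + dot (rV_uncons g).2 (rV_uncons x).2)%R.
Proof.
rewrite /dot big_ord_recl; congr (_ + _)%R.
by apply: eq_bigr => i _; rewrite !mxE.
Qed.

(** Slicing along the first coordinate: if its coefficient is zero, every slice is a hyperplane in
    one dimension less; otherwise every line in that direction meets the set in one point. *)
Lemma hyperplane_null n (g : 'rV[R]_n) (c : R) : g != 0%R ->
  lebesgue_rV n [set x | dot g x = c] = 0.
Proof.
elim: n g c => [g c|n IH g c g0]; first by rewrite [g]thinmx0 eqxx.
have mH k (h : 'rV[R]_k) e : measurable [set x | dot h x = e].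
  by have := measurable_dot h measurableT (measurable_set1 e); rewrite setTI.
pose f (x : 'rV[R]_n.+1) : \bar R := (\1_[set x | dot g x = c] x)%:E.
have mf : measurable_fun setT f.
  by apply/measurable_EFinP; apply: measurable_indic; exact: mH.
have f0 x : 0 <= f x by rewrite lee_fin.
have -> : lebesgue_rV n.+1 [set x | dot g x = c] = \int[lebesgue_rV n.+1]_x f x.
  by rewrite /f (integral_indic _ measurableT (mH _ g c)) setIT.
have fE a v : f (rV_cons (a, v)) =
    (\1_[set p | g ord0 ord0 * p.1 + dot (rV_uncons g).2 p.2 = c]%R (a, v))%:E.
  by rewrite /f !indicE; congr ((nat_of_bool _)%:R%:E); apply/idP/idP;
    rewrite !inE/= dot_cons rV_consK rV_cons0.
have [g00|g00] := eqVneq (g ord0 ord0) 0%R.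
  rewrite ge0_integral_rVS//; apply: integral0_eq => a _.
  rewrite -(IH (rV_uncons g).2 c); last first.
    apply: contra_neq g0 => h; apply: rV_consP => [|i]; first by rewrite g00 mxE.
    by have /rowP/(_ i) := h; rewrite !mxE.
  rewrite -[X in _ = lebesgue_rV n X]setIT -(integral_indic _ measurableT (mH _ _ _)).
  apply: eq_integral => v _.
  by rewrite fE g00 !indicE; congr ((nat_of_bool _)%:R%:E); apply/idP/idP;
    rewrite !inE/= mul0r add0r.
rewrite ge0_integral_rVS_swap//; apply: integral0_eq => v _.
rewrite -(lebesgue_measure_set1 ((c - dot (rV_uncons g).2 v) / g ord0 ord0)%R).
rewrite -[X in _ = lebesgue_measure X]setIT.
rewrite -(@integral_indic _ (measurableTypeR R) _ lebesgue_measure _ measurableT)//.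
apply: eq_integral => a _.
rewrite fE !indicE; congr ((nat_of_bool _)%:R%:E); apply/idP/idP; rewrite !inE/=.
  by move=> <-; field.
by move=> ->; field.
Qed.

(** The sigma-algebra is generated by the coordinates, not by the open sets; an open set belongs to
    it as a countable union of boxes with rational centre and radius. *)
Lemma open_measurable_rV n (U : set 'rV[R]_n) : open U -> measurable U.
Proof.
move=> oU.
pose box (p : 'rV[rat]_n * rat) : set 'rV[R]_n :=
  [set x | forall i, `|x ord0 i - ratr (p.1 ord0 i)| < ratr p.2]%R.
have mbox p : measurable (box p).
  have -> : box p = \bigcap_(i in [set: 'I_n])
      [set x | `|x ord0 i - ratr (p.1 ord0 i)| < ratr p.2]%R.
    by apply/seteqP; split=> x /=; [move=> h i _|move=> h i]; exact: h.
  apply: fin_bigcap_measurable; first exact: finite_finset.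
  move=> i _; pose B := ball (ratr (p.1 ord0 i) : R) (ratr p.2 : R).
  rewrite [X in measurable X](_ : _ = (fun x : 'rV[R]_n => x ord0 i) @^-1` B); last first.
    by apply/seteqP; split=> x; rewrite /B /ball/= distrC.
  by rewrite -[X in measurable X]setTI; apply: measurable_rV_coord => //;
    exact: measurable_ball.
have -> : U = \bigcup_p (if `[< box p `<=` U >] then box p else set0).
  apply/seteqP; split=> [x Ux|x [p _]]; last by case: asboolP => // + bx; exact.
  have /nbhs_ballP[e /= e0 eU] := open_nbhs_nbhs (conj oU Ux).
  (* With a rational radius below [e / 2] and a rational centre within that radius of [x], the box
     contains [x] and lies in the ball of radius [e]. *)
  have [r /[!in_itv]/= /andP[r0 re]] := rat_in_itvoo (divr_gt0 e0 (ltr0Sn R 1)).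
  have /boolp.choice[q Hq] (i : 'I_n) : exists q : rat,
      ratr q \in `](x ord0 i - ratr r)%R, (x ord0 i)[.
    by apply: rat_in_itvoo; rewrite ltrBlDr ltrDl.
  exists (\row_i q i, r) => //; case: asboolP => [_ i|].
    by rewrite mxE; have := Hq i; rewrite in_itv/= => /andP[? ?];
      rewrite ltr_norml; apply/andP; split; lra.
  case=> y yb; apply: eU; split=> // i j; rewrite ord1.
  have := yb j; rewrite /ball/= mxE => {}yb.
  have := Hq j; rewrite in_itv/= => /andP[? ?].
  by move: yb; rewrite !ltr_norml => /andP[? ?]; apply/andP; split; lra.
apply: countable_bigcupT_measurable => [|p]; first exact: countableP.
by case: ifP.
Qed.

Lemma continuous_measurable_rV n (f : 'rV[R]_n -> R) :
  continuous f -> measurable_fun setT f.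
Proof.
move=> /continuousP cf; apply: (measurability _ (RGenOpens.measurableE R)).
move=> _ [_ [a [b ->] <-]]; rewrite setTI; apply: open_measurable_rV.
exact/cf/interval_open.
Qed.

End lebesgue_rV_theory.

(** * Smooth functions and cutoffs *)

Section directional.
Context {R : realType} {V : normedModType R}.
Implicit Types (u : V -> R) (x v w : V).

Lemma is_derive_lineP u x v (s l : R) :
  is_derive (s *: v + x) v u l <->
  is_derive s (1 : R) (fun t => u (t *: v + x)) l.
Proof.
have E : (fun h : R => h^-1 *: (((fun t => u (t *: v + x)) \o shift s) (h *: 1) -
      u (s *: v + x))) =
    (fun h => h^-1 *: ((u \o shift (s *: v + x)) (h *: v) - u (s *: v + x))).
  by apply/funext => h /=; rewrite [h%:A]mulr1 scalerDl addrA.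
by split; case=> du ul; split; move: du ul; rewrite /derivable /derive E.
Qed.

Lemma is_deriveZdir u x v (a l : R) :
  is_derive x v u l -> is_derive x (a *: v) u (a * l).
Proof.
move=> ul; have x0 w : x = 0 *: w + x by rewrite scale0r add0r.
rewrite {1}(x0 (a *: v)); apply/is_derive_lineP.
rewrite (_ : (fun t => _) = (fun t => u (t *: v + x)) \o (fun t => a * t)); last first.
  by apply/funext => t /=; rewrite scalerA mulrC.
rewrite mulrC; apply: is_derive1_comp.
  by rewrite mulr0; apply/is_derive_lineP; rewrite -x0.
rewrite (_ : (fun t : R => a * t) = (a *: id)) //.
by rewrite -[X in is_derive _ _ _ X]mulr1; exact: is_deriveZ.
Qed.

(** Directional derivatives are not additive in the direction in general. Continuity of the one
    along [v] saves it: the increment along [v] starts from the moving point [h *: w + x], and the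
    mean value theorem compares it with ['D_v u x]. *)
Lemma is_deriveDdir u x v w :
  (forall y, derivable u y v) -> {for x, continuous ('D_v u)} ->
  derivable u x w -> is_derive x (v + w) u ('D_v u x + 'D_w u x).
Proof.
move=> dv cv dw.
suff C : (fun h : R => h^-1 *: ((u \o shift x) (h *: (v + w)) - u x)) @ 0^' -->
    ('D_v u x + 'D_w u x).
  by split; [apply/cvg_ex; eexists; exact: C|exact/cvg_lim].
have -> : (fun h : R => h^-1 *: ((u \o shift x) (h *: (v + w)) - u x)) =
   (fun h => h^-1 *: (u (h *: v + (h *: w + x)) - u (h *: w + x)) +
     h^-1 *: ((u \o shift x) (h *: w) - u x)).
  by apply/funext => h /=; rewrite -scalerDr [h *: (v + w)]scalerDr -addrA subrKA.
apply: cvgD; last exact: dw.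
apply/cvgrPdist_lt => e e0.
have /cvgrPdist_lt/(_ e e0)/nbhs_ballP[d /= d0 dP] := cv.
(* The mean value point is at distance at most [|h| (|v| + |w|)] from [x]; the added 1 makes [M]
   positive when both directions vanish. *)
pose M := `|v| + `|w| + 1.
have M0 : 0 < M by rewrite ltr_wpDl// addr_ge0.
near=> h.
have h0 : h != 0 by near: h; exact: nbhs_dnbhs_neq.
have hd : `|h| < d / M.
  near: h; apply: dnbhs0_lt; exact: divr_gt0.
pose F t := u (t *: v + (h *: w + x)).
have dF t : is_derive t (1 : R) F ('D_v u (t *: v + (h *: w + x))).
  by apply/is_derive_lineP/derivableP.
have cF : continuous F.
  by move=> t; apply/differentiable_continuous/derivable1_diffP; have [] := dF t.
have [c hc] : exists2 c, `|c| <= `|h| &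
    F h - F 0 = 'D_v u (c *: v + (h *: w + x)) * h.
  have [hpos|hneg|h00] := ltrgtP 0 h; last by rewrite -h00 eqxx in h0.
    have [c] := MVT hpos (fun t _ => dF t) (continuous_subspaceT cF).
    rewrite in_itv/= subr0 => /andP[c0 ch] ->; exists c => //.
    by rewrite !ger0_norm// ltW.
  have [c] := MVT hneg (fun t _ => dF t) (continuous_subspaceT cF).
  rewrite in_itv/= sub0r => /andP[c0 ch] FE; exists c.
    by rewrite !ler0_norm ?lerN2// ltW.
  by rewrite -opprB FE mulrN opprK.
rewrite /F scale0r add0r => ->.
rewrite mulrC -[_ *: _]/(h^-1 * _) mulKf//.
apply: dP; rewrite -ball_normE/= distrC [_ + (_ + x)]addrA addrK.
apply: le_lt_trans (ler_normD _ _) _; rewrite !normrZ.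
rewrite ltr_pdivlMr// in hd; apply: le_lt_trans hd.
rewrite /M !mulrDr mulr1; have := ler_wpM2r (normr_ge0 v) hc.
by have := normr_ge0 h; lra.
Unshelve. all: by end_near. Qed.
End directional.

Section contdiff.
Context {R : realType} (d : nat).
Implicit Types (u f g : 'rV[R]_d -> R) (x e : 'rV[R]_d).

(** [contdiff] knows the coordinate directions only; a general direction is built by adding them one
    at a time, the one added having a continuous derivative. *)
Lemma contdiff1_is_derive u x e :
  contdiff 1 u -> is_derive x e u (dot e (grad u x)).
Proof.
move=> [cu du]; have -> : dot e (grad u x) = \sum_i e ord0 i * partial i u x.
  by apply: eq_bigr => i _; rewrite mxE.
suff H (s : seq 'I_d) : is_derive x (\sum_(i <- s) e ord0 i *: delta_mx ord0 i) u
    (\sum_(i <- s) e ord0 i * partial i u x) by rewrite {1}(row_sum_delta e); exact: H.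
elim: s => [|i s IH]; first by rewrite !big_nil; exact: is_derive0.
have di y : is_derive y (e ord0 i *: delta_mx ord0 i) u (e ord0 i * partial i u y).
  by apply: is_deriveZdir; apply/derivableP; exact: (du i).1.
rewrite !big_cons; have [ds <-] := IH; have [dxi <-] := di x.
apply: is_deriveDdir; last exact: ds; first by move=> y; have [] := di y.
rewrite (_ : 'D__ u = (fun y => e ord0 i * partial i u y)); last first.
  by apply/funext => y; have [] := di y.
exact: (cvgM (cvg_cst _) ((du i).2 x)).
Qed.

Lemma dgrad_continuous u e : contdiff 1 u -> continuous (fun y => dot e (grad u y)).
Proof.
move=> [_ du]; rewrite (_ : (fun y => _) =
    (fun y => \sum_i e ord0 i * partial i u y)); last first.
  by apply/funext => z; apply: eq_bigr => i _; rewrite mxE.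
apply: continuous_big => [|i _ y]; first exact: add_continuous.
exact: (cvgM (cvg_cst _) ((du i).2 y)).
Qed.

Lemma contdiff1_FTC u x e (b : R) : 0 <= b -> contdiff 1 u ->
  (\int[lebesgue_measure]_(t in `[0%R, b]) (dot e (grad u (t *: e + x)))%:E =
   (u (b *: e + x) - u x)%:E)%E.
Proof.
rewrite le_eqVlt => /predU1P[<-|b0] cu.
  by rewrite set_itv1 integral_set1 scale0r add0r subrr.
have dF t : is_derive t (1 : R) (fun t => u (t *: e + x)) (dot e (grad u (t *: e + x))).
  have H := contdiff1_is_derive (t *: e + x) e cu.
  exact: ((is_derive_lineP u x e t _).1 H).
have cl : continuous (fun t : R => t *: e + x).
  move=> t; apply: cvgD; last exact: cvg_cst.
  by apply: cvgZr_tmp => //.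
have cg : continuous (fun t : R => dot e (grad u (t *: e + x))).
  have dc := @dgrad_continuous u e cu.
  have E : (fun t : R => dot e (grad u (t *: e + x))) =
    (fun y => dot e (grad u y)) \o (fun t : R => t *: e + x) by [].
  rewrite E => t; apply: continuous_comp; [exact: cl|exact: dc].
rewrite (continuous_FTC2 (F := fun t => u (t *: e + x)))//.
- by rewrite scale0r add0r.
- by apply: continuous_subspaceT; exact: cg.
- split.
  + by move=> t _; have [] := dF t.
  + apply: cvg_at_right_filter; by apply: (@cvg_comp _ _ _ (fun t : R => t *: e + x) u _ _ _ (cl _)); exact: cu.1.
  + apply: cvg_at_left_filter; by apply: (@cvg_comp _ _ _ (fun t : R => t *: e + x) u _ _ _ (cl _)); exact: cu.1.
- by move=> t _; rewrite derive1E; have [] := dF t.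
Qed.

Lemma contdiffW k f : contdiff k.+1 f -> contdiff k f.
Proof.
elim: k f => [f []//|k IH f [cf df]]; split=> // i.
by have [di ci] := df i; split=> //; exact: IH.
Qed.

Lemma contdiff_cst k (c : R) : contdiff k (cst c : 'rV[R]_d -> R).
Proof.
elim: k c => [c|k IH c]; first exact: cst_continuous.
split=> [|i]; first exact: cst_continuous.
split=> [x|]; first exact: derivable_cst.
rewrite (_ : partial i _ = cst 0) //.
by apply/funext => x; rewrite /partial derive_cst.
Qed.

Lemma contdiff_continuous k f : contdiff k f -> continuous f.
Proof. by case: k => [|k []]. Qed.

Lemma contdiffD k f g : contdiff k f -> contdiff k g -> contdiff k (f \+ g).
Proof.
elim: k f g => [f g cf cg x|k IH f g [cf df] [cg dg]].
  exact: (cvgD (cf x) (cg x)).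
split=> [x|i]; first exact: (cvgD (cf x) (cg x)).
have [dfi cfi] := df i; have [dgi cgi] := dg i.
split=> [x|]; first exact: derivableD.
rewrite (_ : partial i _ = partial i f \+ partial i g); first exact: IH.
by apply/funext => x; rewrite /partial deriveD.
Qed.

Lemma partialM i f g x : derivable f x (delta_mx ord0 i) ->
  derivable g x (delta_mx ord0 i) ->
  partial i (f \* g) x = f x * partial i g x + g x * partial i f x.
Proof. by move=> df dg; rewrite /partial deriveM. Qed.

Lemma contdiffM k f g : contdiff k f -> contdiff k g -> contdiff k (f \* g).
Proof.
elim: k f g => [f g cf cg x|k IH f g Cf Cg].
  exact: (cvgM (cf x) (cg x)).
have [cf df] := Cf; have [cg dg] := Cg.
split=> [x|i]; first exact: (cvgM (cf x) (cg x)).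
have [dfi cfi] := df i; have [dgi cgi] := dg i.
split=> [x|]; first exact: derivableM.
rewrite (_ : partial i _ = (f \* partial i g) \+ (g \* partial i f)).
  by apply: contdiffD; apply: IH => //; exact: contdiffW.
by apply/funext => x; rewrite partialM.
Qed.

Lemma smooth_contdiff k f : smooth f -> contdiff k f.
Proof. exact. Qed.

Lemma smoothM f g : smooth f -> smooth g -> smooth (f \* g).
Proof. by move=> sf sg k; exact: contdiffM. Qed.

Lemma smooth_prod (I : Type) (s : seq I) (F : I -> 'rV[R]_d -> R) :
  (forall i, smooth (F i)) -> smooth (fun x => \prod_(i <- s) F i x).
Proof.
move=> sF; elim: s => [|i s IH].
  by under eq_fun do rewrite big_nil; move=> k; exact: contdiff_cst.
by under eq_fun do rewrite big_cons; exact: smoothM.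
Qed.

Lemma dot_continuous (a : 'rV[R]_d) : continuous (dot a).
Proof.
apply: continuous_big => [|i _ x]; first exact: add_continuous.
have := @coord_continuous R 1 d ord0 i x.
by move=> h; exact: (cvgM (cvg_cst (a ord0 i)) h).
Qed.

Lemma affine_fun_continuous (q : 'rV[R]_d -> R) : affine_fun q -> continuous q.
Proof.
move=> [c [a qE]] x; rewrite (_ : q = (fun x => c + dot a x)); last exact/funext.
exact: (cvgD (cvg_cst c) (@dot_continuous a x)).
Qed.

Lemma dot_delta (a : 'rV[R]_d) i : dot a (delta_mx ord0 i) = a ord0 i.
Proof.
rewrite /dot (bigD1 i)//= mxE !eqxx mulr1 big1 ?addr0// => j ji.
by rewrite mxE (negbTE ji) andbF mulr0.
Qed.

Lemma dotDr (a x y : 'rV[R]_d) : dot a (x + y) = dot a x + dot a y.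
Proof. by rewrite -big_split; apply: eq_bigr => i _; rewrite mxE mulrDr. Qed.

Lemma dotZr (a x : 'rV[R]_d) (k : R) : dot a (k *: x) = k * dot a x.
Proof. by rewrite /dot big_distrr; apply: eq_bigr => i _; rewrite mxE mulrCA. Qed.

Lemma dotC (a x : 'rV[R]_d) : dot a x = dot x a.
Proof. by apply: eq_bigr => i _; rewrite mulrC. Qed.

Lemma dotDl (a b x : 'rV[R]_d) : dot (a + b) x = dot a x + dot b x.
Proof. by rewrite !(dotC _ x) dotDr. Qed.

Lemma dotZl (a x : 'rV[R]_d) (k : R) : dot (k *: a) x = k * dot a x.
Proof. by rewrite !(dotC _ x) dotZr. Qed.

Lemma is_derive_ridge (H : R -> R) (c l : R) (a x e : 'rV[R]_d) :
  is_derive (c + dot a x) (1 : R) H l ->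
  is_derive x e (fun y => H (c + dot a y)) (l * dot a e).
Proof.
move=> dH; have x0 : x = 0 *: e + x by rewrite scale0r add0r.
rewrite [x in is_derive x]x0; apply/is_derive_lineP.
rewrite (_ : (fun t : R => _) = H \o (fun t => dot a e * t + (c + dot a x))); last first.
  by apply/funext => t /=; rewrite dotDr dotZr; congr H; ring.
apply: is_derive1_comp; first by rewrite mulr0 add0r.
rewrite -[X in is_derive _ _ _ X]addr0; apply: is_deriveD.
rewrite (_ : *%R (dot a e) = (dot a e *: id))//.
by rewrite -[X in is_derive _ _ _ X]mulr1; exact: is_deriveZ.
Qed.

Lemma partial_affine (q : 'rV[R]_d -> R) (c : R) (a : 'rV[R]_d) i x :
  (forall x, q x = c + dot a x) ->
  derivable q x (delta_mx ord0 i) /\ partial i q x = a ord0 i.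
Proof.
move=> qE; have -> : q = (fun y => id (c + dot a y)) by exact/funext.
have [dq dE] := @is_derive_ridge id c 1 a x (delta_mx ord0 i) (is_derive_id _ _).
by split=> //; rewrite /partial dE mul1r dot_delta.
Qed.

Lemma smooth_affine (q : 'rV[R]_d -> R) : affine_fun q -> smooth q.
Proof.
move=> aq [|k]; first exact: affine_fun_continuous.
split; first exact: affine_fun_continuous.
have [c [a qE]] := aq; move=> i; split=> [x|].
  by have [] := @partial_affine q c a i x qE.
rewrite (_ : partial i q = cst (a ord0 i)); first exact: contdiff_cst.
by apply/funext => x; have [] := @partial_affine q c a i x qE.
Qed.
End contdiff.

Section flat.
Context {R : realType}.
Implicit Types (p : {poly R}) (s : R).

(* The family of the functions p(1/s) exp(-1/s), extended by 0 to s <= 0, is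
   stable under derivation. *)
Definition flat p s : R := if 0 < s then p.[s^-1] * expR (- s^-1) else 0.

(** Chain rule with t = 1/s: the derivative of p(t) exp(-t) with respect to s is t^2 (p - p')(t)
    exp(-t). *)
Definition flat' p : {poly R} := 'X^2 * (p - p^`()).

(** From exp(t) >= t^(i+1) / (i+1)! with t = 1/s, each monomial t^i exp(-t) is at most (i+1)! s.
    This linear bound settles differentiability at 0. *)
Lemma flat_small p : exists2 C : R, 0 <= C & forall s, `|flat p s| <= C * `|s|.
Proof.
exists (\sum_(i < size p) `|p`_i| * (i.+1)`!%:R) => [|s].
  by apply: sumr_ge0 => i _; rewrite mulr_ge0.
rewrite /flat; case: ifPn => [s0|_]; last first.
  by rewrite normr0 mulr_ge0// sumr_ge0// => i _; rewrite mulr_ge0.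
rewrite normrM (ger0_norm (expR_ge0 _)) horner_coef (gtr0_norm s0).
apply: le_trans (ler_wpM2r (expR_ge0 _) (ler_norm_sum _ _ _)) _.
rewrite !big_distrl/=; apply: ler_sum => i _; rewrite normrM -!mulrA.
apply: ler_wpM2l => //; rewrite ger0_norm; last by rewrite exprn_ge0// invr_ge0 ltW.
rewrite expRN ler_pdivrMr ?expR_gt0//.
have := @expR_ge1Dxn R s^-1 i; rewrite invr_ge0 ltW// => /(_ isT) H.
have f0 : 0 < (i.+1)`!%:R :> R by rewrite ltr0n fact_gt0.
apply: le_trans (_ : (i.+1)`!%:R * s * (s^-1 ^+ i.+1 / (i.+1)`!%:R) <= _).
  by rewrite exprS le_eqVlt; apply/orP; left; apply/eqP; field; rewrite !gt_eqF.
by apply: ler_wpM2l; [rewrite mulr_ge0// ltW|apply: le_trans H; rewrite lerDr].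
Qed.

Lemma flatX p s : s != 0 -> flat p s / s = flat ('X * p) s.
Proof.
move=> s0; rewrite /flat; case: ifP => sp; last by rewrite mul0r.
by rewrite hornerM hornerX; ring.
Qed.

Lemma is_derive_flat p s : is_derive s (1 : R) (flat p) (flat (flat' p) s).
Proof.
have [s0|s0|->] := ltgtP s 0.
- have E : \near s, cst 0 s = flat p s.
    near=> x; rewrite /flat ifF//; apply/negbTE; rewrite -leNgt ltW//.
    by near: x; exact: lt_nbhsl.
  rewrite {2}/flat ltNge (ltW s0)/=; exact: near_eq_is_derive E _.
- have E : \near s, p.[s^-1] * expR (- s^-1) = flat p s.
    near=> x; rewrite /flat ifT//.
    by near: x; exact: lt_nbhsr.
  rewrite {2}/flat s0/=; apply: (near_eq_is_derive E).
  have s1 : s != 0 by rewrite gt_eqF.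
  have di : is_derive s (1 : R) (fun x : R => x^-1) (- s ^- 2).
    by rewrite -[- s ^- 2]mulr1; apply: (@is_deriveV R id).
  have dp : is_derive s^-1 (1 : R) (horner p) p^`().[s^-1].
    by have := derivableP (@derivable_horner R p s^-1); rewrite derivE derive1E.
  have dq := is_derive1_comp dp di.
  have dn : is_derive s (1 : R) (fun x : R => - x^-1) (- - s ^- 2) := is_deriveN di.
  have de := @is_derive1_comp R expR (fun x => - x^-1) s _ _ (is_derive_expR _) dn.
  apply: is_derive_eq (is_deriveM dq de) _ => /=.
  rewrite /flat' hornerM hornerXn hornerD hornerN -![_ *: _]/(_ * _).
  by field.
have f0 q : flat q 0 = 0 by rewrite /flat ltxx.
suff C : (fun h : R => h^-1 *: ((flat p \o shift 0) (h *: 1) - flat p 0)) @ 0^' --> (0 : R).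
  by rewrite f0; split; [apply/cvg_ex; eexists; exact: C|exact/cvg_lim].
(* The difference quotient at 0 is [flat p h / h], that is [flat ('X * p) h], which the linear bound
   forces to 0. *)
have [C C0 HC] := flat_small ('X * p).
have C1 : 0 < C + 1 by rewrite ltr_wpDl.
apply/cvgrPdist_le => e e0; near=> h.
have h0 : h != 0 by near: h; exact: nbhs_dnbhs_neq.
rewrite f0 subr0 sub0r normrN /= [h%:A]mulr1 addr0 -[_ *: _]/(h^-1 * _) mulrC flatX//.
apply: le_trans (HC h) _.
have he : `|h| <= e / (C + 1) by near: h; apply: dnbhs0_le; exact: divr_gt0.
apply: le_trans (_ : (C + 1) * `|h| <= _); first by rewrite ler_wpM2r// lerDl.
by rewrite mulrC -ler_pdivlMr.
Unshelve. all: by end_near. Qed.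

Lemma flat_continuous p : continuous (flat p).
Proof.
move=> s; apply/differentiable_continuous/derivable1_diffP.
by have [] := is_derive_flat p s.
Qed.

Lemma smooth_flat d p (q : 'rV[R]_d -> R) : affine_fun q -> smooth (flat p \o q).
Proof.
move=> aq k; elim: k p => [|k IH] p.
  move=> x; apply: continuous_comp; first exact: affine_fun_continuous.
  exact: flat_continuous.
split; first exact: (contdiff_continuous (IH p)).
have [c [a qE]] := aq => i.
have dx x : is_derive x (delta_mx ord0 i) (flat p \o q) (flat (flat' p) (q x) * a ord0 i).
  have -> : flat p \o q = (fun y => flat p (c + dot a y)).
    by apply/funext => y /=; rewrite qE.
  rewrite qE -dot_delta; apply: is_derive_ridge; exact: is_derive_flat.
split=> [x|]; first by have [] := dx x.
have -> : partial i (flat p \o q) = (cst (a ord0 i)) \* (flat (flat' p) \o q).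
  by apply/funext => x; rewrite /partial; have [_ ->] := dx x; rewrite mulrC.
by apply: contdiffM; [exact: contdiff_cst|exact: IH].
Qed.

(* exp(- 1 / (k s - 1)) if k s > 1 and 0 otherwise *)
Definition cutoff (k : nat) s : R := flat 1 (k%:R * s - 1).

Lemma cutoff_ge0 k s : 0 <= cutoff k s.
Proof. by rewrite /cutoff /flat; case: ifP; rewrite // hornerC mul1r expR_ge0. Qed.

Lemma cutoff_le1 k s : cutoff k s <= 1.
Proof.
rewrite /cutoff /flat; case: ifP => // H; rewrite hornerC mul1r expR_le1.
by rewrite oppr_le0 invr_ge0 ltW.
Qed.

Lemma cutoff_eq0 k s : k%:R * s <= 1 -> cutoff k s = 0.
Proof. by move=> H; rewrite /cutoff /flat ifF//; apply/negbTE; rewrite -leNgt subr_le0. Qed.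

Lemma cutoff_cvg s : 0 < s -> cutoff k s @[k --> \oo] --> (1 : R).
Proof.
move=> s0.
have H : expR (- (k%:R * s - 1)^-1) @[k --> \oo] --> (1 : R).
  rewrite -[X in _ --> X](expR0 R) -(oppr0 R).
  apply: continuous_cvg; first exact: continuous_expR.
  apply: cvgN; apply/gtr0_cvgV0.
    near=> k; rewrite subr_gt0 -ltr_pdivrMr//; near: k; exact: nbhs_infty_gtr.
  apply/cvgryPgt => A; near=> k; rewrite ltrBrDr -ltr_pdivrMr//.
  by near: k; exact: nbhs_infty_gtr.
apply: cvg_trans H; apply: near_eq_cvg; near=> k.
rewrite /cutoff /flat ifT ?hornerC ?mul1r// subr_gt0 -ltr_pdivrMr//.
by near: k; exact: nbhs_infty_gtr.
Unshelve. all: by end_near. Qed.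

Lemma smooth_cutoff d k (q : 'rV[R]_d -> R) : affine_fun q ->
  smooth (fun x => cutoff k (q x)).
Proof.
move=> [c [a qE]].
apply: (@smooth_flat d 1 (fun x => k%:R * q x - 1)).
exists (k%:R * c - 1), (k%:R *: a) => x; rewrite qE.
by rewrite dotZl; ring.
Qed.
End flat.

(** * Barycentric coordinates *)

Section barycentric.
Context {R : realType} {d : nat} {V : finType}.
Variable pos : V -> 'rV[R]_d.
Implicit Types (S F : {set V}) (x : 'rV[R]_d) (v u : V).

(** Vertices in homogeneous coordinates: the row [l] of barycentric coordinates of [x] solves
    [l *m bary_mx S = row_mx 1 x]. *)
Definition bary_mx S : 'M[R]_(#|S|, 1 + d) :=
  \matrix_i (row_mx 1%:M (pos (enum_val i)) : 'rV_(1 + d)).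

(** Constant term of the coordinate at [v], read off the pseudo-inverse. The sum has one term if [v]
    is in [S] and none otherwise, which avoids choosing an index for [v]. *)
Definition bary_cst S v : R :=
  \sum_(i < #|S| | enum_val i == v) pinvmx (bary_mx S) (lshift d ord0) i.

Definition bary_grad S v : 'rV[R]_d :=
  \row_j \sum_(i < #|S| | enum_val i == v) pinvmx (bary_mx S) (rshift 1 j) i.

Definition bary S v x : R := bary_cst S v + dot (bary_grad S v) x.

Lemma bary_def S v x : bary S v x = bary_cst S v + dot (bary_grad S v) x.
Proof. by []. Qed.

Lemma affine_bary S v : affine_fun (bary S v).
Proof. by exists (bary_cst S v), (bary_grad S v). Qed.

Lemma bary_continuous S v : continuous (bary S v).
Proof. exact/affine_fun_continuous/affine_bary. Qed.

Let baryE S (i : 'I_#|S|) x : bary S (enum_val i) x =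
  ((row_mx 1%:M x : 'rV_(1 + d)) *m pinvmx (bary_mx S)) ord0 i.
Proof.
rewrite /bary /bary_cst /bary_grad /dot !mxE big_split_ord /= big_ord1.
rewrite row_mxEl mxE eqxx mul1r (big_pred1 i) => [|j]; last exact: (inj_eq enum_val_inj).
congr (_ + _); apply: eq_bigr => j _; rewrite row_mxEr mxE mulrC.
by rewrite (big_pred1 i) => [//|k]; exact: (inj_eq enum_val_inj).
Qed.

Let bmxl S (i : 'I_#|S|) : bary_mx S i (lshift d ord0) = 1.
Proof. by rewrite mxE row_mxEl mxE eqxx. Qed.

Let bmxr S (i : 'I_#|S|) k : bary_mx S i (rshift 1 k) = pos (enum_val i) ord0 k.
Proof. by rewrite mxE row_mxEr. Qed.

Lemma baryD S v x y : bary S v (x + y) = bary S v x + dot (bary_grad S v) y.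
Proof. by rewrite /bary dotDr addrA. Qed.

Section full_simplex.
Variable S : {set V}.
Hypotheses (indS : affinely_independent pos S) (cardS : #|S| = d.+1).

Let rfree : row_free (bary_mx S).
Proof.
rewrite -kermx_eq0; apply/eqP/row_matrixP => i; rewrite row0.
set l := row i _.
have : l *m bary_mx S = 0.
  by apply/eqP; rewrite -sub_kermx; exact: row_sub.
move=> lM; pose f v := \sum_(j < #|S| | enum_val j == v) l ord0 j.
have fE (j : 'I_#|S|) : f (enum_val j) = l ord0 j.
  by rewrite /f (big_pred1 j) => [//|k]; exact: (inj_eq enum_val_inj).
have f0 := indS (l := f).
have l0 (j : 'I_#|S|) : l ord0 j = 0.
  rewrite -fE f0 ?enum_valP//.
    rewrite big_enum_val/=; under eq_bigr do rewrite fE.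
    have /rowP/(_ (lshift d ord0)) := lM; rewrite !mxE => lM0.
    rewrite -[RHS]lM0; apply: eq_bigr => k _.
    by rewrite bmxl mulr1.
  rewrite big_enum_val/=; under eq_bigr do rewrite fE.
  apply/rowP => k; have /rowP/(_ (rshift 1 k)) := lM; rewrite !mxE => lM0.
  rewrite -[RHS]lM0 summxE; apply: eq_bigr => h _.
  by rewrite bmxr mxE.
by apply/rowP => j; rewrite l0 mxE.
Qed.

Let rfull : row_full (bary_mx S).
Proof. by rewrite /row_full (eqP rfree); apply/eqP. Qed.

Let baryM x : \sum_(i < #|S|) bary S (enum_val i) x *: row i (bary_mx S) =
  row_mx 1%:M x.
Proof.
have /mulmxKpV <- : (row_mx 1%:M x <= bary_mx S)%MS by rewrite submx_full ?rfull.
rewrite [RHS]mulmx_sum_row; apply: eq_bigr => i _; by rewrite baryE.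
Qed.

Lemma bary_sum x : \sum_(v in S) bary S v x = 1.
Proof.
rewrite big_enum_val/=; have /rowP/(_ (lshift d ord0)) := baryM x.
rewrite row_mxEl [1%:M _ _]mxE eqxx => E; rewrite -[RHS]E summxE; apply: eq_bigr => i _.
by rewrite mxE [row _ _ _ _]mxE bmxl mulr1.
Qed.

Lemma bary_comb x : \sum_(v in S) bary S v x *: pos v = x.
Proof.
rewrite big_enum_val/=; apply/rowP => k.
have /rowP/(_ (rshift 1 k)) := baryM x.
rewrite row_mxEr => <-; rewrite !summxE; apply: eq_bigr => i _.
by rewrite mxE [in RHS]mxE [row _ _ _ _]mxE bmxr.
Qed.

Lemma bary_uniq (l : V -> R) x : \sum_(v in S) l v = 1 ->
  \sum_(v in S) l v *: pos v = x -> forall v, v \in S -> bary S v x = l v.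
Proof.
move=> l1 lx v vS; apply/eqP; rewrite -subr_eq0; apply/eqP.
apply: (indS (l := fun v => bary S v x - l v)) vS.
  by rewrite sumrB bary_sum l1 subrr.
by under eq_bigr do rewrite scalerBl; rewrite sumrB bary_comb lx subrr.
Qed.

Lemma bary_pos v u : v \in S -> u \in S -> bary S v (pos u) = (v == u)%:R.
Proof.
move=> vS uS; apply: (bary_uniq (l := fun v => (v == u)%:R)) vS.
  by rewrite (bigD1 u)//= eqxx big1 ?addr0// => i /andP[_ /negbTE ->].
rewrite (bigD1 u)//= eqxx scale1r big1 ?addr0// => i /andP[_ /negbTE ->].
by rewrite scale0r.
Qed.

Lemma dot_bary_grad v u a : v \in S -> u \in S -> a \in S ->
  dot (bary_grad S v) (pos u - pos a) = (v == u)%:R - (v == a)%:R.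
Proof.
move=> vS uS aS; have := baryD S v (pos a) (pos u - pos a).
by rewrite addrC subrK !bary_pos// => ->; rewrite [RHS]addrC addKr.
Qed.

Lemma bary_grad_sum : \sum_(v in S) bary_grad S v = 0.
Proof.
apply/rowP => i; rewrite summxE [RHS]mxE.
under eq_bigr do rewrite -dot_delta.
apply: (addrI (\sum_(v in S) bary S v 0)).
rewrite -big_split/= addr0 [RHS]bary_sum -[RHS](bary_sum (delta_mx ord0 i)).
by apply: eq_bigr => v _; rewrite -[in RHS](add0r (delta_mx _ _)) baryD.
Qed.

Lemma bary_grad_comb i :
  \sum_(v in S) bary_grad S v ord0 i *: pos v = delta_mx ord0 i.
Proof.
apply: (addrI (\sum_(v in S) bary S v 0 *: pos v)).
rewrite -big_split/= bary_comb add0r -[RHS]bary_comb.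
apply: eq_bigr => v _.
by rewrite -scalerDl -[in RHS](add0r (delta_mx _ _)) baryD dot_delta.
Qed.

Lemma hullE : hull pos S = [set x | forall v, v \in S -> 0 <= bary S v x].
Proof.
apply/seteqP; split=> [x [l [l0 l1 ->]] v vS|x bx].
  by rewrite (bary_uniq l1 erefl)// l0.
by exists (bary S ^~ x); rewrite bary_sum bary_comb.
Qed.

Lemma face_bary F (l : V -> R) x : F \subset S -> \sum_(v in F) l v = 1 ->
  \sum_(v in F) l v *: pos v = x ->
  forall v, v \in S -> bary S v x = if v \in F then l v else 0.
Proof.
move=> FS l1 lx; have FSE : (fun v => (v \in S) && (v \in F)) =1 mem F.
  by move=> v; apply/andb_idl => /(fintype.subsetP FS).
apply: bary_uniq.
  by rewrite -big_mkcondr (eq_bigl _ _ FSE).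
rewrite -lx -[RHS](eq_bigl _ _ FSE) big_mkcondr.
by apply: eq_bigr => v _; case: ifP => // _; rewrite scale0r.
Qed.

Lemma hull_faceP F x : F \subset S -> hull pos F x <->
  hull pos S x /\ forall v, v \in S -> v \notin F -> bary S v x = 0.
Proof.
move=> FS; split=> [[l [l0 l1 xE]]|].
  have b := face_bary FS l1 (esym xE); split=> [|v vS vF]; last by rewrite b// (negbTE vF).
  by rewrite hullE => v vS; rewrite b//; case: ifP => // /l0.
rewrite {1}hullE => -[b0 bF]; exists (bary S ^~ x).
have FSE : (fun v => (v \in S) && (v \in F)) =1 mem F.
  by move=> v; apply/andb_idl => /(fintype.subsetP FS).
split=> [v vF||]; first exact/b0/(fintype.subsetP FS).
  rewrite -(eq_bigl _ _ FSE) big_mkcondr -[RHS](bary_sum x).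
  by apply: eq_bigr => v vS; case: ifPn => // /bF ->.
rewrite -[RHS](eq_bigl _ _ FSE) big_mkcondr -[LHS]bary_comb.
by apply: eq_bigr => v vS; case: ifPn => // /bF -> //; rewrite scale0r.
Qed.

Lemma open_bary_gt0 F : open [set x | forall v, v \in F -> 0 < bary S v x].
Proof.
rewrite openE => x bx; apply: (@filter_forall _ V (fun v y => v \in F -> 0 < bary S v y) (nbhs x)) => v.
have [vF|vF] := boolP (v \in F); last exact: nearW.
have /cvgr_gt/(_ _ (bx v vF)) := @bary_continuous S v x.
by apply: filterS.
Qed.

Lemma bary_grad_neq0 v : v \in S -> (0 < d)%N -> bary_grad S v != 0.
Proof.
move=> vS d0.
have /card_gt0P[u] : (0 < #|S :\ v|)%N.
  by have := cardsD1 v S; rewrite vS cardS add1n => -[<-].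
rewrite !inE => /andP[uv uS]; apply: contraTneq isT => g0.
have := dot_bary_grad vS vS uS; rewrite g0 eqxx eq_sym (negbTE uv) subr0.
by rewrite /dot big1 => [/eqP|i _]; rewrite ?mxE ?mul0r// eq_sym oner_eq0.
Qed.

Lemma dot_gt0 (g : 'rV[R]_d) : g != 0 -> 0 < dot g g.
Proof.
move=> g0; rewrite lt_neqAle eq_sym sumr_ge0 ?andbT; last first.
  by move=> i _; rewrite -expr2 sqr_ge0.
apply: contra_neq g0; move/eqP; rewrite psumr_eq0; last first.
  by move=> i _; rewrite -expr2 sqr_ge0.
move=> /allP h; apply/rowP => i; rewrite mxE.
by have := h i (mem_index_enum _); rewrite /= mulf_eq0 orbb => /eqP.
Qed.

Lemma interior_hullE : (0 < d)%N ->
  interior (hull pos S) = [set x | forall v, v \in S -> 0 < bary S v x].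
Proof.
move=> d0; apply/seteqP; split=> [x ix v vS|]; last first.
  rewrite -open_subsetE; last exact: open_bary_gt0.
  by rewrite hullE => x bx v vS; exact/ltW/bx.
have b0 : 0 <= bary S v x by move: (interior_subset ix); rewrite hullE; exact.
rewrite lt_neqAle b0 andbT; apply: contraTneq isT => bx0.
(* Moving against the gradient from a point where the coordinate at [v] is zero makes it negative,
   so arbitrarily close points leave the hull. *)
set g := bary_grad S v; have gg := dot_gt0 (bary_grad_neq0 vS d0).
have cl : (fun t : R => x - t *: g) @ 0^'+ --> x.
  rewrite -[X in _ --> X]subr0 -(scale0r g); apply: cvgB; first exact: cvg_cst.
  by apply: cvgZr_tmp; apply: cvg_at_right_filter; exact: cvg_id.
have [t [t0 ht]] : exists t : R, 0 < t /\ hull pos S (x - t *: g).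
  have H := cl _ ix.
  near (0 : R)^'+ => t; exists t; split; near: t; [exact: nbhs_right_gt|exact: H].
move: ht; rewrite hullE => /(_ v vS).
rewrite baryD -bx0 add0r -scaleNr dotZr mulNr oppr_ge0 leNgt.
by rewrite mulr_gt0.
Unshelve. all: by end_near. Qed.

End full_simplex.
End barycentric.

(** * Cubes, the standard simplex and integrability on bounded sets *)

Section measure_facts.
Context {R : realType}.

Definition cube n (a b : R) : set 'rV[R]_n :=
  [set x | forall i, a <= x ord0 i <= b].

Lemma measurable_cube n (a b : R) : measurable (@cube n a b).
Proof.
have -> : @cube n a b = \bigcap_(i in [set: 'I_n])
    ((fun x : 'rV[R]_n => x ord0 i) @^-1` `[a, b]).
  apply/seteqP; split=> x /=; first by move=> h i _; rewrite /= in_itv/=; exact: h.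
  by move=> h i; have := h i I; rewrite /= in_itv.
apply: fin_bigcap_measurable; first exact: finite_finset.
move=> i _; rewrite -[X in measurable X]setTI.
exact: (measurable_rV_coord i).
Qed.

Lemma lebesgue_cube n (a b : R) : a <= b ->
  lebesgue_rV n (@cube n a b) = ((b - a) ^+ n)%:E.
Proof.
move=> ab; elim: n => [|n IH].
  by rewrite /= diracE mem_set//; case.
rewrite /= /lebesgue_rV_step /pushforward.
have -> : (rV_cons (n:=n)) @^-1` (@cube n.+1 a b) = `[a, b] `*` (@cube n a b).
  apply/seteqP; split=> -[x v] /=.
    move=> h; split; first by have := h ord0; rewrite rV_cons0 in_itv.
    by move=> i; have := h (lift ord0 i); rewrite rV_consS.
  move=> [xab vc] i; case: (unliftP ord0 i) => [j|] ->; first by rewrite rV_consS; exact: vc.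
  by rewrite rV_cons0; move: xab; rewrite in_itv.
rewrite product_measure1E//; last exact: measurable_cube.
transitivity (lebesgue_measure `[a, b]%classic * ((b - a) ^+ n)%:E)%E.
  by rewrite IH.
rewrite lebesgue_measure_itv/= lte_fin; case: ltgtP ab => //= [_ _|-> _].
  by rewrite -EFinB -EFinM exprS.
by rewrite mul0e subrr exprS mul0r.
Qed.

Lemma mx_normP n (x : 'rV[R]_n) (M : R) i : `|x| <= M -> `|x ord0 i| <= M.
Proof.
apply: le_trans; have -> : `|x| = mx_norm x by [].
by rewrite mx_normrE; exact: (le_bigmax _ (fun k => `|x k.1 k.2|) (ord0, i)).
Qed.

Lemma bounded_sub_cube n (A : set 'rV[R]_n) : bounded_set A ->
  exists2 M : R, 0 <= M & A `<=` @cube n (- M) M.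
Proof.
move=> [M [_ /(_ (`|M| + 1))]].
have -> : M < `|M| + 1 by rewrite (le_lt_trans (ler_norm _))// ltrDl.
move=> /(_ isT) H; exists (`|M| + 1); first by rewrite addr_ge0.
by move=> x /H xM i; rewrite -ler_norml; exact: mx_normP.
Qed.

Lemma bounded_finite_measure n (A : set 'rV[R]_n) : measurable A ->
  bounded_set A -> (lebesgue_rV n A < +oo)%E.
Proof.
move=> mA /bounded_sub_cube[M M0 AM].
apply: le_lt_trans (_ : (lebesgue_rV n (@cube n (- M) M) < +oo)%E).
  by apply: le_measure => //; rewrite inE//; exact: measurable_cube.
rewrite lebesgue_cube; first by rewrite ltry.
by rewrite (le_trans _ M0)// oppr_le0.
Qed.

Lemma closed_measurable_rV n (A : set 'rV[R]_n) : closed A -> measurable A.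
Proof.
by move/closed_openC/open_measurable_rV/measurableC; rewrite setCK.
Qed.

Lemma compact_closed_rV n (K : set 'rV[R]_n) : compact K -> closed K.
Proof. by apply: compact_closed; exact: norm_hausdorff. Qed.

Lemma continuous_compact_bounded n (K : set 'rV[R]_n) (f : 'rV[R]_n -> R) :
  compact K -> continuous f -> exists2 M : R, 0 <= M & forall x, K x -> `|f x| <= M.
Proof.
move=> cK cf.
have /compact_bounded[M [_ /(_ (`|M| + 1))]] :
  compact (f @` K) by apply: continuous_compact => //; exact: continuous_subspaceT.
have -> : M < `|M| + 1 by rewrite (le_lt_trans (ler_norm _))// ltrDl.
move=> /(_ isT) H; exists (`|M| + 1); first by rewrite addr_ge0.
by move=> x Kx; apply: H; exists x.
Qed.

Lemma bounded_integrable n (D : set 'rV[R]_n) (f : 'rV[R]_n -> R) (M : R) :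
  measurable D -> bounded_set D -> measurable_fun D f ->
  (forall x, D x -> `|f x| <= M) -> (lebesgue_rV n).-integrable D (EFin \o f).
Proof.
move=> mD bD mf fM; apply: measurable_bounded_integrable => //.
  exact: bounded_finite_measure.
exists M; split; first exact: num_real.
by move=> N MN x /= Dx; apply: le_trans (fM x Dx) (ltW MN).
Qed.

Lemma continuous_integrable n (D K : set 'rV[R]_n) (f : 'rV[R]_n -> R) :
  measurable D -> compact K -> D `<=` K -> continuous f ->
  (lebesgue_rV n).-integrable D (EFin \o f).
Proof.
move=> mD cK DK cf; have [M _ fM] := continuous_compact_bounded cK cf.
apply: (@bounded_integrable _ _ _ M) => //.
- have [N [Nr NP]] := compact_bounded cK.
  by exists N; split=> // P NP' x /DK; exact: NP.
- by apply: measurable_funTS; exact: continuous_measurable_rV.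
- by move=> x /DK; exact: fM.
Qed.

Lemma closed_ge0 n (f : 'rV[R]_n -> R) : continuous f -> closed [set x | 0 <= f x].
Proof.
move=> cf; apply: (@closed_comp _ _ f [set y : R | 0 <= y]); last exact: closed_ge.
by move=> x _; exact: cf.
Qed.

Lemma closed_std_simplex n : closed (@std_simplex R n).
Proof.
have -> : @std_simplex R n =
    (\bigcap_(i in [set: 'I_n]) [set t : 'rV[R]_n | 0 <= t ord0 i]) `&`
    [set t : 'rV[R]_n | 0 <= 1 + dot (const_mx (-1)) t].
  have E (t : 'rV[R]_n) : 1 + dot (const_mx (-1)) t = 1 - \sum_i t ord0 i.
    by rewrite -sumrN; congr (1 + _); apply: eq_bigr => i _; rewrite mxE mulN1r.
  apply/seteqP; split=> t [h1 h2]; split.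
  - by move=> i _; exact: h1.
  - by rewrite /= E subr_ge0.
  - by move=> i; exact: h1.
  - by move: h2; rewrite /= E subr_ge0.
apply: closedI; last first.
  by apply: closed_ge0; apply: affine_fun_continuous; exists 1, (const_mx (-1)).
by apply: closed_bigI => i _; apply: closed_ge0; exact: coord_continuous.
Qed.

Lemma std_simplex_sub_cube n : @std_simplex R n `<=` @cube n 0 1.
Proof.
move=> t [t0 t1] i; rewrite t0/=; apply: le_trans t1.
by rewrite (bigD1 i)//= lerDl sumr_ge0.
Qed.

Lemma compact_std_simplex n : compact (@std_simplex R n).
Proof.
apply: (@subclosed_compact _ _ (@cube n 0 1)).
- exact: closed_std_simplex.
- have := @rV_compact R n (fun=> `[0, 1]%classic) (fun=> @segment_compact R 0 1).
  congr compact; by apply/seteqP; split=> x h i; have := h i; rewrite /= in_itv.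
- exact: std_simplex_sub_cube.
Qed.

Lemma measurable_std_simplex n : measurable (@std_simplex R n).
Proof. by apply: closed_measurable_rV; exact: closed_std_simplex. Qed.

Lemma std_simplex_finite n : (lebesgue_rV n (@std_simplex R n) < +oo)%E.
Proof.
apply: bounded_finite_measure; first exact: measurable_std_simplex.
by apply: compact_bounded; exact: compact_std_simplex.
Qed.

Lemma std_simplex_gt0 n : (0 < lebesgue_rV n (@std_simplex R n))%E.
Proof.
(* The side 1/(n+1) keeps the sum of n coordinates below 1 and makes sense for n = 0. *)
apply: (@lt_le_trans _ _ (lebesgue_rV n (@cube n 0 (n.+1%:R^-1)))).
  by rewrite lebesgue_cube// subr0 lte_fin exprn_gt0// invr_gt0.
apply: le_measure; rewrite ?inE//; [exact: measurable_cube|exact: measurable_std_simplex|].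
move=> t ht; split=> [i|]; first by have /andP[] := ht i.
apply: (@le_trans _ _ (\sum_(i < n) n.+1%:R^-1)).
  by apply: ler_sum => i _; have /andP[] := ht i.
by rewrite sumr_const card_ord -[_ *+ n]mulr_natl ler_pdivrMr// mul1r ler_nat.
Qed.

Lemma std_simplex_int1 n : \int[lebesgue_rV n]_(t in @std_simplex R n) 1 != 0.
Proof.
rewrite Rintegral_cst; last exact: measurable_std_simplex.
by rewrite mul1r gt_eqF// fine_gt0// std_simplex_gt0 std_simplex_finite.
Qed.

Lemma integral_rVS_swap n (f : 'rV[R]_n.+1 -> \bar R) :
  (lebesgue_rV n.+1).-integrable setT f ->
  (\int[lebesgue_rV n.+1]_x f x =
   \int[lebesgue_rV n]_v \int[lebesgue_measure]_a f (rV_cons (a, v)))%E.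
Proof.
move=> fi.
have mf := measurable_int _ fi.
have mfc : measurable_fun setT (f \o rV_cons (n:=n)).
  by apply: measurableT_comp => //; exact: measurable_rV_cons.
have fci : (@lebesgue_measure R \x lebesgue_rV n)%E.-integrable setT (f \o rV_cons (n:=n)).
  apply/integrableP; split => //.
  have /integrableP[_] := fi; rewrite /= ge0_integral_pushforward//.
    exact: measurable_rV_cons.
  by apply: measurableT_comp.
have mc : measurable_fun [set: (measurableTypeR R * 'rV[R]_n)%type] (rV_cons (n:=n)).
  exact: measurable_rV_cons.
have E := integral_pushforward mc mf fci measurableT.
rewrite preimage_setT in E.
by apply: (etrans E); rewrite -integral21_prod_meas1.
Qed.
End measure_facts.

(** * Stokes' formula on a cell *)

Section simplex_param.
Context {R : realType}.

Definition sparam m n (q : 'I_m.+1 -> 'rV[R]_n) (t : 'rV[R]_m) : 'rV[R]_n :=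
  q ord0 + t *m \matrix_i (q (lift ord0 i) - q ord0).

(** No Jacobian here: the factors [cell_scale] and [face_jac] are kept apart, so that the
    fundamental theorem of calculus applies to the bare parameters. *)
Definition sint m n (q : 'I_m.+1 -> 'rV[R]_n) (f : 'rV[R]_n -> R) : R :=
  \int[lebesgue_rV m]_(t in @std_simplex R m) f (sparam q t).

Lemma sparamE m n (q : 'I_m.+1 -> 'rV[R]_n) (t : 'rV[R]_m) :
  sparam q t = q ord0 + \sum_i t ord0 i *: (q (lift ord0 i) - q ord0).
Proof.
rewrite /sparam mulmx_sum_row; congr (_ + _); apply: eq_bigr => i _.
by congr (_ *: _); apply/rowP => j; rewrite !mxE.
Qed.

Lemma sparam_continuous m n (q : 'I_m.+1 -> 'rV[R]_n) : continuous (sparam q).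
Proof.
rewrite (_ : sparam q = (fun t => q ord0 +
    \sum_i t ord0 i *: (q (lift ord0 i) - q ord0))); last exact/funext/sparamE.
have H : continuous (fun t : 'rV[R]_m =>
    \sum_i t ord0 i *: (q (lift ord0 i) - q ord0)).
  apply: continuous_big => [|i _ t]; first exact: add_continuous.
  have := @coord_continuous R 1 m ord0 i t.
  move=> h; apply: cvgZr_tmp; [exact: nbhs_filter|exact: h].
by move=> t; exact: (cvgD (cvg_cst (q ord0)) (H t)).
Qed.

Lemma continuous_sparam m n (q : 'I_m.+1 -> 'rV[R]_n) (f : 'rV[R]_n -> R) :
  continuous f -> continuous (f \o sparam q).
Proof.
by move=> cf t; apply: continuous_comp; [exact: sparam_continuous|exact: cf].
Qed.

Lemma sint_integrable m n (q : 'I_m.+1 -> 'rV[R]_n) (f : 'rV[R]_n -> R) :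
  continuous f ->
  (lebesgue_rV m).-integrable (@std_simplex R m) (fun t => (f (sparam q t))%:E).
Proof.
move=> cf; apply: (@continuous_integrable _ _ _ (@std_simplex R m) (f \o sparam q)) => //.
- exact: measurable_std_simplex.
- exact: compact_std_simplex.
- exact: continuous_sparam.
Qed.

Lemma dot_mulmx n (x y : 'rV[R]_n) : dot x y = (x *m y^T) ord0 ord0.
Proof. by rewrite mxE; apply: eq_bigr => i _; rewrite mxE. Qed.

Lemma fine_pmul (r : R) (x : \bar R) : 0 < r -> fine (r%:E * x)%E = r * fine x.
Proof.
move=> r0; case: x => [x| |]; first by [].
  by rewrite gt0_muley ?lte_fin//= mulr0.
by rewrite gt0_muleNy ?lte_fin//= mulr0.
Qed.

Section cell.
Context {V : finType} {n : nat} (pos : V -> 'rV[R]_n) (S : {set V}).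
Variable r : 'I_n.+1 -> V.
Hypotheses (indS : affinely_independent pos S) (cardS : #|S| = n.+1).
Hypotheses (rinj : injective r) (rS : forall i, r i \in S).

Lemma cell_order v : v \in S -> exists i, v = r i.
Proof.
suff <- : [set r i | i in [set: 'I_n.+1]]%SET = S.
  by move=> /imsetP[i _ ->]; exists i.
apply/eqP; rewrite eqEcard; apply/andP; split.
  by apply/fintype.subsetP => u /imsetP[i _ ->].
by rewrite cardS card_imset// cardsT card_ord.
Qed.

Let A : 'M[R]_n := \matrix_i (pos (r (lift ord0 i)) - pos (r ord0)).

Lemma cell_det_neq0 : \det A != 0.
Proof.
(* The gradients of the barycentric coordinates are dual to the edges issued from [r ord0], hence
   are the columns of the inverse matrix. *)
pose G := \matrix_(k, j) bary_grad pos S (r (lift ord0 j)) ord0 k.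
suff /mulmx1_unit[] : A *m G = 1%:M by rewrite unitmxE unitfE.
apply/matrixP => i j; rewrite !mxE.
have := dot_bary_grad indS cardS (rS (lift ord0 j)) (rS (lift ord0 i)) (rS ord0).
rewrite (inj_eq rinj) (inj_eq lift_inj) (inj_eq rinj) [lift _ _ == ord0]eq_sym.
rewrite (negbTE (neq_lift _ _)) subr0 eq_sym => <-.
by apply: eq_bigr => k _; rewrite !mxE mulrC.
Qed.

Lemma bary_sparam t i : bary pos S (r i) (sparam (pos \o r) t) =
  if unlift ord0 i is Some j then t ord0 j else 1 - \sum_j t ord0 j.
Proof.
rewrite sparamE baryD/= bary_pos//.
have -> : dot (bary_grad pos S (r i))
    (\sum_k t ord0 k *: (pos (r (lift ord0 k)) - pos (r ord0))) =
    \sum_k t ord0 k * ((i == lift ord0 k)%:R - (i == ord0)%:R).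
  rewrite (big_morph (dot _) (dotDr _) (id1 := 0)); last first.
    by rewrite /dot big1// => k _; rewrite [X in _ * X]mxE mulr0.
  by apply: eq_bigr => k _; rewrite dotZr dot_bary_grad// !(inj_eq rinj).
rewrite (inj_eq rinj); case: unliftP => [j|] ->.
  rewrite eq_sym (negbTE (neq_lift _ _)) add0r (bigD1 j)//= eqxx subr0 mulr1.
  rewrite big1 ?addr0// => k kj.
  by rewrite (inj_eq lift_inj) eq_sym (negbTE kj) subr0 mulr0.
rewrite eqxx -sumrN; congr (_ + _); apply: eq_bigr => k _.
by rewrite (negbTE (neq_lift _ _)) sub0r mulrN1.
Qed.

Lemma sparam_hull t : hull pos S (sparam (pos \o r) t) <-> @std_simplex R n t.
Proof.
rewrite hullE//; split=> [h|[t0 t1] v].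
  split=> [i|]; first by have := h _ (rS (lift ord0 i)); rewrite bary_sparam liftK.
  by have := h _ (rS ord0); rewrite bary_sparam unlift_none subr_ge0.
by move=> /cell_order[i ->]; rewrite bary_sparam; case: unliftP => // _; rewrite subr_ge0.
Qed.

Lemma cell_integral (f : 'rV[R]_n -> R) : measurable (hull pos S) ->
  measurable_fun (hull pos S) f ->
  \int[lebesgue_rV n]_(x in hull pos S) f x =
  `|\det A| * sint (pos \o r) f.
Proof.
move=> mS mf; rewrite /Rintegral.
have := @integral_rV_affine _ _ A (pos (r ord0)) _ (EFin \o f) cell_det_neq0 mS.
have E : [set x | hull pos S (x *m A + pos (r ord0))] = @std_simplex R n.
  by apply/seteqP; split=> t /=; rewrite addrC; exact: (sparam_hull t).1 + exact: (sparam_hull t).2.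
move=> /(_ _)/esym ->; last exact/measurable_EFinP.
rewrite fine_pmul ?normr_gt0 ?cell_det_neq0// E; congr (_ * fine _).
by apply: eq_integral => t _ /=; rewrite addrC.
Qed.
End cell.

(** Presents the standard simplex as the hull of its own vertices, so that the results on simplices
    apply to it. *)
Definition std_vertex m (i : 'I_m.+1) : 'rV[R]_m :=
  if unlift ord0 i is Some j then delta_mx ord0 j else 0.

Lemma std_vertex_comb m (l : 'I_m.+1 -> R) :
  \sum_(i in [set: 'I_m.+1]%SET) l i *: std_vertex i = \row_j l (lift ord0 j).
Proof.
rewrite (eq_bigl xpredT) => [|i]; last by rewrite finset.in_setT.
rewrite big_ord_recl /std_vertex unlift_none scaler0 add0r.
rewrite [RHS]row_sum_delta; apply: eq_bigr => i _.
by rewrite liftK mxE.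
Qed.

Lemma std_vertex_indep m :
  affinely_independent (@std_vertex m) [set: 'I_m.+1]%SET.
Proof.
move=> l l1; rewrite std_vertex_comb => lS.
have lj j : l (lift ord0 j) = 0 by have /rowP/(_ j) := lS; rewrite !mxE.
move=> v _; case: (unliftP ord0 v) => [j|] -> //.
move: l1; rewrite (eq_bigl xpredT) => [|i]; last by rewrite finset.in_setT.
by rewrite big_ord_recl big1 ?addr0.
Qed.

Lemma hull_std_vertex m :
  hull (@std_vertex m) [set: 'I_m.+1]%SET = @std_simplex R m.
Proof.
apply/seteqP; split=> [x [l [l0 l1 ->]]|x [x0 x1]].
  rewrite std_vertex_comb; split=> [i|]; first by rewrite mxE l0// finset.in_setT.
  have <- : \sum_i l i = 1.
    by rewrite -l1; apply: eq_bigl => i; rewrite finset.in_setT.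
  rewrite big_ord_recl ler_wpDl ?l0 ?finset.in_setT//.
  by under eq_bigr do rewrite mxE.
exists (fun i => if unlift ord0 i is Some j then x ord0 j else 1 - \sum_j x ord0 j).
split=> [v _||].
- by case: unliftP => // _; rewrite subr_ge0.
- rewrite (eq_bigl xpredT) => [|i]; last by rewrite finset.in_setT.
  rewrite big_ord_recl unlift_none; under [X in _ + X]eq_bigr do rewrite liftK.
  by rewrite subrK.
by rewrite std_vertex_comb; apply/rowP => j; rewrite mxE liftK.
Qed.

Lemma sparam_std_vertex m n (q : 'I_m.+1 -> 'rV[R]_n) i :
  sparam q (std_vertex i) = q i.
Proof.
rewrite /sparam /std_vertex; case: unliftP => [j|] ->; last by rewrite mul0mx addr0.
by rewrite -rowE; apply/rowP => k; rewrite !mxE addrC subrK.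
Qed.

Lemma sparam_comp m n k (q : 'I_m.+1 -> 'rV[R]_n) (e : 'I_k.+1 -> 'rV[R]_m) t :
  sparam q (sparam e t) = sparam (sparam q \o e) t.
Proof.
rewrite /sparam mulmxDl addrA -mulmxA; congr (_ + _ *m _).
apply/row_matrixP => i; rewrite row_mul !rowK/= mulmxBl.
by rewrite opprD addrACA subrr add0r.
Qed.

(** Renumbering the vertices is an affine automorphism of the standard simplex. Its determinant is
    not computed: the change of variables applied to the constant 1 shows that it has absolute value
    1. *)
Lemma sint_perm m n (q : 'I_m.+1 -> 'rV[R]_n) (s : 'I_m.+1 -> 'I_m.+1)
    (f : 'rV[R]_n -> R) : injective s -> continuous f ->
  sint (q \o s) f = sint q f.
Proof.
move=> sinj cf.
have card : #|[set: 'I_m.+1]%SET| = m.+1 by rewrite cardsT card_ord.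
have sT i : s i \in [set: 'I_m.+1]%SET by rewrite finset.in_setT.
have H := @cell_integral _ _ _ _ s (@std_vertex_indep m) card sinj sT.
rewrite hull_std_vertex in H.
set D := \det _ in H.
have mS := @measurable_std_simplex R m.
have D1 : `|D| = 1.
  have := H (cst 1) mS (measurable_cst _).
  rewrite {1}/cst /sint /cst => H1.
  by apply: (mulIf (std_simplex_int1 m)); rewrite mul1r.
have mf : measurable_fun (@std_simplex R m) (f \o sparam q).
  by apply: measurable_funTS; apply: continuous_measurable_rV; exact: continuous_sparam.
have := H _ mS mf; rewrite D1 mul1r => E; apply/esym/(etrans E).
apply: eq_Rintegral => t _; rewrite /= sparam_comp; congr (f (sparam _ _)).
by apply/funext => i /=; rewrite sparam_std_vertex.
Qed.

End simplex_param.

Section hull_topology.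
Context {R : realType} {n : nat} {V : finType} (pos : V -> 'rV[R]_n).
Variable S : {set V}.
Hypotheses (indS : affinely_independent pos S) (cardS : #|S| = n.+1).

Lemma closed_hull : closed (hull pos S).
Proof.
rewrite hullE// (_ : [set x | _] =
    \bigcap_(v in [set` S]) [set x | 0 <= bary pos S v x]).
  by apply: closed_bigI => v _; apply: closed_ge0; exact: bary_continuous.
by apply/seteqP; split=> x.
Qed.

Lemma compact_hull : compact (hull pos S).
Proof.
apply: bounded_closed_compact; last exact: closed_hull.
exists (\sum_(v in S) `|pos v|); split; first exact: num_real.
move=> M MS x [l [l0 l1 ->]]; apply: le_trans (ltW MS).
apply: le_trans (ler_norm_sum _ _ _) _; apply: ler_sum => v vS.
rewrite normrZ -[leRHS]mul1r ler_wpM2r// ger0_norm ?l0//.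
by rewrite -l1 (bigD1 v)//= lerDl sumr_ge0// => u /andP[uS _]; exact: l0.
Qed.

Lemma measurable_hull : measurable (hull pos S).
Proof. by apply: closed_measurable_rV; exact: closed_hull. Qed.

End hull_topology.

Section stokes.
Context {R : realType}.

Let one m : 'I_m.+2 := lift ord0 ord0.

Let lift10 m : lift (one m) ord0 = ord0. Proof. exact: val_inj. Qed.

Let lift1S m (j : 'I_m) : lift (one m) (lift ord0 j) = lift ord0 (lift ord0 j).
Proof. exact: val_inj. Qed.

Lemma std_simplex_cons m (a : R) (v : 'rV[R]_m) :
  @std_simplex R m.+1 (rV_cons (a, v)) <->
  @std_simplex R m v /\ 0 <= a <= 1 - \sum_i v ord0 i.
Proof.
rewrite /std_simplex /= big_ord_recl rV_cons0.
under [X in _ + X]eq_bigr do rewrite rV_consS.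
split=> /=.
  move=> [h1 h2]; have a0 : 0 <= a by have := h1 ord0; rewrite rV_cons0.
  split; last by rewrite a0/= lerBrDr.
  split=> [i|]; first by have := h1 (lift ord0 i); rewrite rV_consS.
  by apply: le_trans h2; rewrite lerDr.
move=> [[h1 h2] /andP[a0 ab]]; split; last by rewrite -lerBrDr.
by move=> i; case: (unliftP ord0 i) => [j|] ->; rewrite ?rV_consS ?rV_cons0.
Qed.

Lemma sparam_cons m n (q : 'I_m.+2 -> 'rV[R]_n) (a : R) (v : 'rV[R]_m) :
  sparam q (rV_cons (a, v)) =
  a *: (q (one m) - q ord0) + sparam (q \o lift (one m)) v.
Proof.
rewrite !sparamE big_ord_recl rV_cons0 /= lift10 addrCA; congr (_ + (_ + _)).
by apply: eq_bigr => i _; rewrite rV_consS lift1S.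
Qed.

Lemma sparam_top m n (q : 'I_m.+2 -> 'rV[R]_n) (v : 'rV[R]_m) :
  (1 - \sum_i v ord0 i) *: (q (one m) - q ord0) + sparam (q \o lift (one m)) v =
  sparam (q \o lift ord0) v.
Proof.
rewrite !sparamE/= lift10 scalerBl scale1r scaler_suml -/(one m).
rewrite addrAC addrA subrK -addrA; congr (_ + _).
rewrite -sumrB; apply: eq_bigr => i _; rewrite lift1S -scalerBr.
by congr (_ *: _); rewrite opprB addrA subrK.
Qed.

(** The first parameter runs along the edge from [q 0] to [q 1], from 0 up to 1 minus the sum of the
    others. The two ends of that segment parametrize the faces opposite [q 1] and [q 0]. *)
Lemma sint_FTC m n (q : 'I_m.+2 -> 'rV[R]_n) (u : 'rV[R]_n -> R) :
  contdiff 1 u ->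
  sint q (fun x => dot (q (lift ord0 ord0) - q ord0) (grad u x)) =
  sint (q \o lift ord0) u - sint (q \o lift (lift ord0 ord0)) u.
Proof.
move=> cu; set e := q _ - q _.
have cf : continuous (fun x => dot e (grad u x)) by exact: dgrad_continuous.
have uc : continuous u by case: cu.
rewrite /sint -RintegralB; last 3 first.
- exact: measurable_std_simplex.
- exact: sint_integrable.
- exact: sint_integrable.
congr fine; pose G t := (dot e (grad u (sparam q t)))%:E.
rewrite integral_mkcond integral_rVS_swap; last first.
  have mS := @measurable_std_simplex R m.+1.
  by have /(integrable_mkcond _ mS) := sint_integrable q cf.
rewrite [RHS]integral_mkcond; apply: eq_integral => v _; rewrite [RHS]patchE.
pose x0 := sparam (q \o lift (one m)) v.
case: ifPn => [/set_mem vs|/negP vs]; last first.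
  apply: integral0_eq => a _; rewrite patchE ifF//; apply/negbTE/negP.
  by move=> /set_mem/std_simplex_cons[vs' _]; apply: vs; exact: mem_set.
have b0 : 0 <= 1 - \sum_i v ord0 i by rewrite subr_ge0; case: vs.
have := contdiff1_FTC x0 e b0 cu; rewrite sparam_top => <-.
rewrite [RHS]integral_mkcond; apply: eq_integral => a _; rewrite !patchE.
have -> : (rV_cons (a, v) \in @std_simplex R m.+1) =
    (a \in `[0, 1 - \sum_i v ord0 i]%classic).
  apply/idP/idP; rewrite !inE/= in_itv/= => h.
    by have [] := (std_simplex_cons a v).1 h.
  by apply/std_simplex_cons; split.
by case: ifP => // _; rewrite sparam_cons.
Qed.

(** Face integrals list the vertices by [enum], while the edge formula prescribes which two vertices
    of the cell come first; this reconciles the two orders. *)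
Lemma sint_perm_eq (V : eqType) m n (pos : V -> 'rV[R]_n) (s s' : seq V)
    (u : 'rV[R]_n -> R) : continuous u -> size s = m.+1 -> perm_eq s s' ->
  sint (fun i : 'I_m.+1 => nth 0 (map pos s) i) u =
  sint (fun i : 'I_m.+1 => nth 0 (map pos s') i) u.
Proof.
move=> cu sm ss'; have s'm : size s' == m.+1 by rewrite -(perm_size ss') sm.
have /tuple_permP[p sE] : perm_eq s (Tuple s'm) by [].
rewrite -(@sint_perm _ _ _ (fun i : 'I_m.+1 => nth 0 (map pos s') i) p) //;
  last exact: perm_inj.
suff -> : (fun i : 'I_m.+1 => (map pos s)`_i) =
    (fun i : 'I_m.+1 => (map pos s')`_i) \o p by [].
apply/funext => i /=.
rewrite sE -map_comp (nth_map i) ?size_enum_ord// nth_ord_enum /=.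
have x0 := thead (Tuple s'm).
by rewrite (nth_map x0) ?(eqP s'm)// (tnth_nth x0).
Qed.

End stokes.

Section dot_sums.
Context {R : realType} {d : nat}.
Implicit Types x : 'rV[R]_d.

Lemma dot0r x : dot x 0 = 0.
Proof. by rewrite /dot big1// => k _; rewrite [X in _ * X]mxE mulr0. Qed.

Lemma dot0l x : dot 0 x = 0.
Proof. by rewrite dotC dot0r. Qed.

Lemma dot_sumr (I : Type) (s : seq I) (P : pred I) (F : I -> 'rV[R]_d) x :
  dot x (\sum_(i <- s | P i) F i) = \sum_(i <- s | P i) dot x (F i).
Proof. exact: (big_morph (dot x) (dotDr x) (dot0r x)). Qed.

Lemma dot_suml (I : Type) (s : seq I) (P : pred I) (F : I -> 'rV[R]_d) x :
  dot (\sum_(i <- s | P i) F i) x = \sum_(i <- s | P i) dot (F i) x.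
Proof. by rewrite dotC dot_sumr; apply: eq_bigr => i _; rewrite dotC. Qed.

Lemma dotNr x y : dot x (- y) = - dot x y.
Proof. by rewrite -scaleN1r dotZr mulN1r. Qed.

Lemma dot_extl x y : (forall z, dot x z = dot y z) -> x = y.
Proof. by move=> H; apply/rowP => i; rewrite -!dot_delta H. Qed.
End dot_sums.

Section Rintegral_sum.
Context d (T : measurableType d) (R : realType).
Variables (mu : {measure set T -> \bar R}) (D : set T) (mD : measurable D).

Lemma integrable_Rsum (I : Type) (s : seq I) (P : pred I) (f : I -> T -> R) :
  (forall i, P i -> mu.-integrable D (EFin \o f i)) ->
  mu.-integrable D (EFin \o (fun x => \sum_(i <- s | P i) f i x)).
Proof.
move=> fi; rewrite (_ : EFin \o _ =
    (fun x => (\sum_(i <- s | P i) (EFin \o f i) x)%E)).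
  exact: integrable_sum.
by apply/funext => x /=; rewrite sumEFin.
Qed.

Lemma Rintegral_sum (I : Type) (s : seq I) (P : pred I) (f : I -> T -> R) :
  (forall i, P i -> mu.-integrable D (EFin \o f i)) ->
  \int[mu]_(x in D) (\sum_(i <- s | P i) f i x) =
  \sum_(i <- s | P i) \int[mu]_(x in D) f i x.
Proof.
move=> fi; elim: s => [|i s IH].
  rewrite big_nil; under eq_Rintegral do rewrite big_nil.
  by rewrite Rintegral_cst// mul0r.
rewrite big_cons -IH; case: ifPn => Pi; last first.
  by apply: eq_Rintegral => x _; rewrite big_cons (negbTE Pi).
rewrite -RintegralD//; [|exact: fi|exact: integrable_Rsum].
by apply: eq_Rintegral => x _; rewrite big_cons Pi.
Qed.
End Rintegral_sum.

Section cell_stokes.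
Context {R : realType} {m : nat} (Th : simplicial_mesh R m.+1).
Implicit Types (T F : {set Th}) (u : 'rV[R]_m.+1 -> R) (a b v : Th).
Local Notation pos := (@pos R m.+1 Th).
Local Notation hull := (hull pos).
Local Notation bgrad := (bary_grad pos).

Definition sface F u : R := sint (fun i : 'I_m.+1 => face_pt F i) u.

Lemma face_paramE F t : face_param F t = sparam (fun i : 'I_m.+1 => face_pt F i) t.
Proof. by []. Qed.

Lemma face_intE F u : 0 < face_jac F -> face_int F u = face_jac F * sface F u.
Proof.
by move=> j0; rewrite /face_int /face_eint fine_pmul.
Qed.

(** The absolute value of the determinant of any affine parametrization of [T], written as a ratio
    of volumes so that no ordering of the vertices enters. *)
Definition cell_scale T : R := (\int[lebesgue_rV m.+1]_(x in hull T) 1) /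
  (\int[lebesgue_rV m.+1]_(t in @std_simplex R m.+1) 1).

Section cell.
Variable T : {set Th}.
Hypothesis cT : T \in cells Th.
Let indT := cell_indep cT.
Let cardT := card_cell cT.

Lemma face_card a : a \in T -> #|T :\ a| = m.+1.
Proof. by move=> aT; have := cardsD1 a T; rewrite aT cardT add1n => -[<-]. Qed.

Lemma measurable_cell : measurable (hull T).
Proof. exact: measurable_hull. Qed.

Lemma cell_scaleE (r : 'I_m.+2 -> Th) : injective r -> (forall i, r i \in T) ->
  cell_scale T = `|\det (\matrix_(i < m.+1) (pos (r (lift ord0 i)) - pos (r ord0)))|.
Proof.
move=> rinj rT; rewrite /cell_scale (cell_integral indT cardT rinj rT)//.
  by rewrite mulfK// std_simplex_int1.
exact: measurable_cell.
Qed.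

Lemma cell_integral_scale (r : 'I_m.+2 -> Th) u : injective r ->
  (forall i, r i \in T) -> continuous u ->
  \int[lebesgue_rV m.+1]_(x in hull T) u x = cell_scale T * sint (pos \o r) u.
Proof.
move=> rinj rT cu; rewrite (cell_scaleE rinj rT).
apply: cell_integral => //; first exact: measurable_cell.
by apply: measurable_funTS; exact: continuous_measurable_rV.
Qed.

Let r_of (a : Th) (s : seq Th) (i : 'I_m.+2) : Th := nth a s i.

Let r_of_inj a s : uniq s -> size s = m.+2 -> injective (r_of a s).
Proof.
move=> us ss i j /eqP; rewrite nth_uniq ?ss// => /eqP ij; exact: val_inj.
Qed.

Let r_of_in a s : {subset s <= T} -> size s = m.+2 -> forall i, r_of a s i \in T.
Proof. by move=> sT ss i; apply: sT; rewrite mem_nth// ss. Qed.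

Lemma cell_scale_gt0 : 0 < cell_scale T.
Proof.
have sz : size (enum T) = m.+2 by rewrite -cardE.
have /card_gt0P[a aT] : (0 < #|T|)%N by rewrite cardT.
have ri := @r_of_inj a _ (enum_uniq T) sz.
have rT : forall i, r_of a (enum T) i \in T.
  by apply: r_of_in => // v; rewrite mem_enum.
by rewrite (cell_scaleE ri rT) normr_gt0; exact: (cell_det_neq0 indT cardT ri rT).
Qed.

Let sface_pt_perm a s u : a \in T -> continuous u -> a \notin s -> uniq s ->
  {subset s <= T} -> size s = m.+1 ->
  sint (fun i : 'I_m.+1 => nth 0 (map pos s) i) u = sface (T :\ a) u.
Proof.
move=> aT cu as_ us sT ss; apply: sint_perm_eq => //.
apply: uniq_perm => //; first exact: enum_uniq.
have H : {subset s <= enum (T :\ a)}.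
  move=> v vs; rewrite mem_enum !inE sT// andbT.
  by apply: contraNneq as_ => <-.
have sz : (size (enum (T :\ a)) <= size s)%N by rewrite -cardE face_card// ss.
by have [_ sE] := uniq_min_size us H sz.
Qed.

Lemma cell_edge_stokes a b u : a \in T -> b \in T -> a != b -> contdiff 1 u ->
  \int[lebesgue_rV m.+1]_(x in hull T) dot (pos a - pos b) (grad u x) =
  cell_scale T * (sface (T :\ b) u - sface (T :\ a) u).
Proof.
move=> aT bT ab cu; set s0 := enum (T :\ b :\ a).
have cu0 : continuous u by case: cu.
have aTb : a \in T :\ b by rewrite !inE ab.
have sz0 : size s0 = m.
  by rewrite -cardE; have := cardsD1 a (T :\ b); rewrite aTb face_card// add1n => -[].
pose s := [:: b, a & s0].
have us : uniq s.
  by rewrite /s /= !inE mem_enum !mem_enum !inE !eqxx/= enum_uniq eq_sym (negbTE ab) !andbF.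
have sz : size s = m.+2 by rewrite /= sz0.
have sT : {subset s <= T}.
  move=> v; rewrite /s !inE => /or3P[/eqP->|/eqP->|] //.
  by rewrite mem_enum !inE => /and3P[].
have ri := @r_of_inj b _ us sz; have rT := @r_of_in b _ sT sz.
rewrite (cell_integral_scale ri rT); last exact: dgrad_continuous.
have := sint_FTC (pos \o r_of b s) cu.
rewrite [(pos \o _) (lift _ _)]/= [(pos \o _) ord0]/= => ->.
have usb : uniq (b :: s0) by move: us; rewrite /s/= !inE negb_or => /and3P[/andP[_ ->] _ ->].
have usa : uniq (a :: s0) by move: us => /andP[].
have -> : (pos \o r_of b s) \o lift ord0 =
    (fun i : 'I_m.+1 => (map pos (a :: s0))`_i).
  by apply/funext => i /=; rewrite -[in RHS](map_cons pos) (nth_map b)//= sz0.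
have -> : (pos \o r_of b s) \o lift (lift ord0 ord0) =
    (fun i : 'I_m.+1 => (map pos (b :: s0))`_i).
  apply/funext => i /=; rewrite -[in RHS](map_cons pos) (nth_map b)/= ?sz0//.
  by case: (unliftP ord0 i) => [j|] ->.
rewrite (@sface_pt_perm b (a :: s0))//; last 3 first.
- by case/andP: us.
- by move=> v vs; apply: sT; rewrite inE vs orbT.
- by rewrite /= sz0.
rewrite (@sface_pt_perm a (b :: s0))//; last 3 first.
- by rewrite inE negb_or ab/=; case/and3P: us.
- by move=> v; rewrite inE => vs; apply: sT; rewrite !inE; case/orP: vs => -> //; rewrite !orbT.
- by rewrite /= sz0.
Qed.

(** The i-th unit vector is a combination of the edges from a fixed vertex [b], with the i-th
    components of the barycentric gradients as coefficients. These sum to zero, which also removes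
    the contributions of the face opposite [b] produced by the edge formula. *)
Lemma cell_stokes i u : contdiff 1 u ->
  \int[lebesgue_rV m.+1]_(x in hull T) partial i u x =
  \sum_(a in T) - (cell_scale T * bgrad T a ord0 i) * sface (T :\ a) u.
Proof.
move=> cu; have /card_gt0P[b bT] : (0 < #|T|)%N by rewrite cardT.
have pE x : partial i u x =
    \sum_(a in T) bgrad T a ord0 i * dot (pos a - pos b) (grad u x).
  have -> : partial i u x = dot (delta_mx ord0 i) (grad u x).
    by rewrite dotC dot_delta mxE.
  rewrite -[in LHS](bary_grad_comb indT cardT i).
  transitivity (dot (\sum_(a in T) bgrad T a ord0 i *: (pos a - pos b)) (grad u x)).
    congr dot; under [RHS]eq_bigr do rewrite scalerBr.
    rewrite sumrB -scaler_suml.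
    have -> : \sum_(v in T) bgrad T v ord0 i = 0.
      by have /rowP/(_ i) := bary_grad_sum indT cardT; rewrite summxE mxE.
    by rewrite scale0r subr0.
  by rewrite dot_suml; apply: eq_bigr => a _; rewrite dotZl.
under eq_Rintegral do rewrite pE.
have di a : (lebesgue_rV m.+1).-integrable (hull T)
    (EFin \o (fun x => dot (pos a - pos b) (grad u x))).
  apply: (@continuous_integrable _ _ _ (hull T)) => //.
  - exact: measurable_cell.
  - exact: compact_hull.
  - exact: dgrad_continuous.
rewrite Rintegral_sum; last 2 first.
- exact: measurable_cell.
- by move=> a _; apply: (integrableZl (measurable_cell) (bgrad T a ord0 i) (di a)).
have E a : a \in T -> \int[lebesgue_rV m.+1]_(x in hull T)
    (bgrad T a ord0 i * dot (pos a - pos b) (grad u x)) =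
    bgrad T a ord0 i * (cell_scale T * sface (T :\ b) u) -
    bgrad T a ord0 i * (cell_scale T * sface (T :\ a) u).
  move=> aT; rewrite RintegralZl//; last exact: measurable_cell.
  have [->|ab] := eqVneq a b.
    rewrite subrr.
    by under eq_Rintegral do rewrite dot0l; rewrite Rintegral_cst ?mul0r ?mulr0 ?subrr//;
      exact: measurable_cell.
  by rewrite cell_edge_stokes// mulrBr mulrBr.
have G (X : Th -> R) : \sum_(a in T) (bgrad T a ord0 i * X b - bgrad T a ord0 i * X a) =
    \sum_(a in T) - (bgrad T a ord0 i * X a).
  rewrite sumrB -mulr_suml sumrN.
  have -> : \sum_(v in T) bgrad T v ord0 i = 0.
    by have /rowP/(_ i) := bary_grad_sum indT cardT; rewrite summxE mxE.
  by rewrite mul0r sub0r.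
rewrite (eq_bigr _ E) (G (fun a => cell_scale T * sface (T :\ a) u)).
by apply: eq_bigr => a _; rewrite mulrCA mulrA mulNr.
Qed.

(** In the expansion of [y] along the edges issued from [b], all edges but the one to [a] lie in the
    face and are orthogonal to [n]. Hence [n] is parallel to the gradient of the coordinate of
    [a]. *)
Lemma unit_normal_dot a b (y : 'rV[R]_m.+1) n : a \in T -> b \in T :\ a ->
  unit_normal (T :\ a) n -> dot n y = dot (bgrad T a) y * dot n (pos a - pos b).
Proof.
move=> aT bTa [_ nF].
have bT : b \in T by move: bTa; rewrite !inE => /andP[].
have -> : y = \sum_(v in T) dot (bgrad T v) y *: (pos v - pos b).
  under eq_bigr do rewrite scalerBr.
  rewrite sumrB -scaler_suml.
  have -> : \sum_(v in T) dot (bgrad T v) y = 0.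
    by rewrite -dot_suml (bary_grad_sum indT cardT) dot0l.
  rewrite scale0r subr0 [LHS]row_sum_delta.
  under eq_bigr do rewrite -(bary_grad_comb indT cardT) scaler_sumr.
  rewrite exchange_big/=; apply: eq_bigr => v _.
  rewrite /dot scaler_suml; apply: eq_bigr => k _; by rewrite scalerA mulrC.
rewrite !dot_sumr.
rewrite (bigD1 a)//= [X in _ = X * _](bigD1 a)//= !dotZr.
rewrite big1 => [|v /andP[vT va]]; last first.
  by rewrite dotZr nF ?mulr0// !inE ?va ?vT//; move: bTa; rewrite !inE.
rewrite addr0 big1 ?addr0 => [|v /andP[vT va]]; last first.
  rewrite dotZr dot_bary_grad// eq_sym (negbTE va).
  by move: bTa; rewrite !inE eq_sym => /andP[/negbTE -> _]; rewrite subrr mulr0.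
rewrite dot_bary_grad// eqxx.
by move: bTa; rewrite !inE eq_sym => /andP[/negbTE -> _]; rewrite subr0 mulr1.
Qed.

End cell.
End cell_stokes.

(** * Outward normals and the area of a face *)

Section cell_normals.
Context {R : realType} {m : nat} (Th : simplicial_mesh R m.+1).
Implicit Types (T F : {set Th}) (u : 'rV[R]_m.+1 -> R) (a b v : Th).
Local Notation pos := (@pos R m.+1 Th).
Local Notation hull := (hull pos).
Local Notation bgrad := (bary_grad pos).
Variables (T : {set Th}) (a : Th).
Hypotheses (cT : T \in cells Th) (aT : a \in T).
Let indT := cell_indep cT.
Let cardT := card_cell cT.
Let g := bgrad T a.

Let g0 : 0 < dot g g.
Proof. exact/dot_gt0/(bary_grad_neq0 indT cardT). Qed.

Lemma face_vertex : exists b, b \in T :\ a.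
Proof. by apply/card_gt0P; rewrite face_card. Qed.

Lemma unit_normalE n : unit_normal (T :\ a) n ->
  exists k, n = k *: g /\ k ^+ 2 * dot g g = 1.
Proof.
move=> un; have [b bF] := face_vertex; exists (dot n (pos a - pos b)).
have nE : n = dot n (pos a - pos b) *: g.
  by apply: dot_extl => y; rewrite dotZl mulrC; exact: (unit_normal_dot cT).
split=> //; have [n1 _] := un; rewrite -n1 [X in _ = dot X X]nE dotZl dotZr.
by rewrite mulrA -expr2.
Qed.

Lemma outward_normalE n : outward_normal T (T :\ a) n ->
  exists h, [/\ 0 < h, n = - h *: g & h ^+ 2 * dot g g = 1].
Proof.
move=> [un out]; have [b bF] := face_vertex; exists (- dot n (pos a - pos b)).
have nE : n = dot n (pos a - pos b) *: g.
  by apply: dot_extl => y; rewrite dotZl mulrC; exact: (unit_normal_dot cT).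
rewrite opprK; split=> //.
  by rewrite oppr_gt0; apply: out => //; rewrite !inE eqxx.
have [n1 _] := un; rewrite -n1 sqrrN [X in _ = dot X X]nE dotZl dotZr.
by rewrite mulrA -expr2.
Qed.

Lemma outward_normal_opp k : k < 0 -> k ^+ 2 * dot g g = 1 ->
  outward_normal T (T :\ a) (k *: g).
Proof.
move=> k0 k1; have gF v b : v \in T -> b \in T :\ a ->
    dot g (pos v - pos b) = (a == v)%:R.
  rewrite !inE => vT /andP[ba bT]; rewrite dot_bary_grad//.
  by rewrite [a == b]eq_sym (negbTE ba) subr0.
split; first split.
- by rewrite dotZl dotZr mulrA -expr2.
- move=> v b vF bF; rewrite dotZl gF//; last by move: vF; rewrite !inE => /andP[].
  by move: vF; rewrite !inE eq_sym => /andP[/negbTE -> _]; rewrite mulr0.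
move=> b v bF vT vF; rewrite dotZl gF//.
by move: vF; rewrite !inE vT andbT negbK eq_sym => /eqP ->; rewrite eqxx mulr1.
Qed.

Lemma outward_normal_exists : exists n, outward_normal T (T :\ a) n.
Proof.
exists (- (Num.sqrt (dot g g))^-1 *: g); apply: outward_normal_opp.
  by rewrite oppr_lt0 invr_gt0 sqrtr_gt0.
by rewrite sqrrN exprVn sqr_sqrtr ?ltW// mulVf// gt_eqF.
Qed.

Lemma outward_normal_uniq n n' : outward_normal T (T :\ a) n ->
  outward_normal T (T :\ a) n' -> n = n'.
Proof.
move=> /outward_normalE[h [h0 -> h1]] /outward_normalE[k [k0 -> k1]].
congr (- _ *: _); have gg : dot g g != 0 by rewrite gt_eqF.
have : h ^+ 2 = k ^+ 2 by apply: (mulIf gg); rewrite h1 k1.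
by move/eqP; rewrite eqrXn2// ?ltW// => /eqP.
Qed.

(** In the edge matrix [A] of the cell, replace the edge from [b] to [a] by the unit normal and call
    the result [N]. Since [n] is orthogonal to the face, N N^T is block diagonal with blocks 1 and
    the Gram matrix, so [face_jac] is |det N|. As [G] inverts [A], [N *m G] differs from the
    identity only in its first row, and its determinant is [dot n g]. *)
Lemma face_jac_unit n : unit_normal (T :\ a) n ->
  face_jac (T :\ a) = `|dot n g| * cell_scale T.
Proof.
move=> [n1 nF]; set F := T :\ a.
have szF : size (enum F) = m.+1 by rewrite -cardE face_card.
case EF : (enum F) szF => [//|b s] [sz].
have ub : uniq (b :: s) by rewrite -EF enum_uniq.
have inF v : (v \in F) = (v \in b :: s) by rewrite -EF mem_enum.
pose r (i : 'I_m.+2) := nth b [:: b, a & s] i.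
have us : uniq [:: b, a & s].
  have aF : a \notin F by rewrite !inE eqxx.
  move: aF; rewrite inF !inE negb_or => /andP[ab as_].
  by move: ub => /= /andP[bs ->]; rewrite !inE negb_or eq_sym ab bs as_.
have rinj : injective r.
  by move=> i j /eqP; rewrite nth_uniq//= ?sz// => /eqP ij; exact: val_inj.
have rT i : r i \in T.
  have : r i \in [:: b, a & s] by rewrite mem_nth//= sz.
  have FT v : v \in F -> v \in T by rewrite !inE => /andP[].
  rewrite !inE => /or3P[/eqP->|/eqP->//|vs]; apply: FT; rewrite inF !inE ?eqxx//.
  by rewrite vs orbT.
pose A := \matrix_(i < m.+1) (pos (r (lift ord0 i)) - pos (r ord0)).
pose G := \matrix_(k < m.+1, j < m.+1) bgrad T (r (lift ord0 j)) ord0 k.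
have AG : A *m G = 1%:M.
  apply/matrixP => i j; rewrite !mxE.
  have := dot_bary_grad indT cardT (rT (lift ord0 j)) (rT (lift ord0 i)) (rT ord0).
  rewrite (inj_eq rinj) (inj_eq lift_inj) (inj_eq rinj) [lift _ _ == ord0]eq_sym.
  rewrite (negbTE (neq_lift _ _)) subr0 eq_sym => <-.
  by apply: eq_bigr => k _; rewrite !mxE mulrC.
have ptE (i : nat) : face_pt F i = nth 0 (map pos (b :: s)) i by rewrite /face_pt EF.
have rowE (i : 'I_m) k : A (lift ord0 i) k = face_edges F i k.
  rewrite !mxE !ptE /r /= (nth_map b) ?sz//.
pose N : 'M[R]_(1 + m) := col_mx n (face_edges F).
have N0 k : N ord0 k = n ord0 k.
  have <- : lshift m ord0 = ord0 :> 'I_(1 + m) by exact: val_inj.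
  by rewrite /N col_mxEu.
have NS i k : N (lift ord0 i) k = face_edges F i k.
  have <- : rshift 1 i = lift ord0 i :> 'I_(1 + m) by exact: val_inj.
  by rewrite /N col_mxEd.
have NG : \det (N *m G) = dot n g.
  rewrite (expand_det_col _ ord0) big_ord_recl big1 => [|i _]; last first.
    rewrite mxE; under eq_bigr do rewrite NS -rowE.
    have /matrixP/(_ (lift ord0 i) ord0) := AG; rewrite !mxE => ->.
    by rewrite mul0r.
  rewrite addr0 mxE; under eq_bigr do rewrite N0 mxE.
  rewrite -[X in X * _]/(dot n g) /cofactor expr0 mul1r.
  rewrite (_ : row' _ _ = 1%:M) ?det1 ?mulr1//.
  apply/matrixP => i j; rewrite !mxE; under eq_bigr do rewrite NS -rowE.
  have /matrixP/(_ (lift ord0 i) (lift ord0 j)) := AG; rewrite !mxE => ->.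
  by rewrite (inj_eq lift_inj).
have detN : \det N = dot n g * \det A.
  have := congr1 determinant AG; rewrite det1 det_mulmx => AG1.
  by rewrite -NG det_mulmx -mulrA [\det G * _]mulrC AG1 mulr1.
have NN : \det (face_edges F *m (face_edges F)^T) = \det N ^+ 2.
  rewrite expr2 -[in X in _ = _ * X]det_tr -det_mulmx /N tr_col_mx mul_col_row.
  rewrite (_ : face_edges F *m n^T = 0).
    rewrite det_ublock det_mx11 -dot_mulmx n1 mul1r//.
  apply/matrixP => i j; rewrite [RHS]mxE ord1 mxE.
  have b0 : b \in F by rewrite inF inE eqxx.
  have si : nth b (b :: s) i.+1 \in F by rewrite inF mem_nth//= sz ltnS.
  apply: etrans (nF _ _ si b0); rewrite /dot; apply: eq_bigr => k _.
  rewrite [face_edges _ _ _]mxE !ptE mxE mulrC; congr (_ * _).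
    by rewrite mxE.
  by rewrite /= (nth_map b) ?sz// !mxE.
by rewrite /face_jac -/F NN sqrtr_sqr detN normrM (cell_scaleE cT rinj rT).
Qed.

Lemma face_jac_gt0 : 0 < face_jac (T :\ a).
Proof.
have [n [un _]] := outward_normal_exists; rewrite (face_jac_unit un).
have [k [-> k1]] := unit_normalE un.
rewrite mulr_gt0 ?cell_scale_gt0// normr_gt0 dotZl mulf_neq0//; last by rewrite gt_eqF.
by apply: contra_eq_neq k1 => ->; rewrite expr0n/= mul0r eq_sym oner_eq0.
Qed.

(** Turns the coefficients of [cell_stokes] into components of outward normals weighted by area. *)
Lemma face_jac_normal n : outward_normal T (T :\ a) n ->
  face_jac (T :\ a) *: n = - (cell_scale T *: g).
Proof.
move=> on; have [un _] := on; rewrite (face_jac_unit un).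
have [h [h0 -> h1]] := outward_normalE on.
rewrite dotZl mulNr normrN gtr0_norm ?mulr_gt0//.
rewrite scalerA -scaleNr; congr (_ *: _).
rewrite -[cell_scale T in RHS]mul1r -h1; ring.
Qed.

End cell_normals.

(** * Green's formula for traces *)

Section L2_limits.
Context dd (X : measurableType dd) (R : realType).
Variables (mu : {measure set X -> \bar R}) (D : set X).
Hypotheses (mD : measurable D) (Dfin : (mu D < +oo)%E).

(** [L2] for an arbitrary measure, to serve on cells and, through the parametrization, on faces. *)
Definition sq_integrable (f : X -> R) :=
  measurable_fun D f /\ (\int[mu]_(x in D) ((f x) ^+ 2)%:E < +oo)%E.

(** Takes the place of the Cauchy-Schwarz inequality when passing from L^2 to L^1 on a set of finite
    measure. *)
Let le_sqr (x e : R) : 0 < e -> `|x| <= e + e^-1 * x ^+ 2.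
Proof.
move=> e0; have [xe|ex] := leP `|x| e.
  by apply: le_trans xe _; rewrite lerDl mulr_ge0// ?sqr_ge0// invr_ge0 ltW.
have -> : x ^+ 2 = `|x| ^+ 2 by rewrite real_normK ?num_real.
apply: ler_wpDl; first exact: ltW.
by rewrite mulrC ler_pdivlMr// expr2 ler_wpM2l// ltW.
Qed.

Lemma sq_integrable_integrable f : sq_integrable f -> mu.-integrable D (EFin \o f).
Proof.
move=> [mf f2]; have i2 : mu.-integrable D (fun x => ((f x) ^+ 2)%:E).
  apply/integrableP; split; first exact/measurable_EFinP/measurable_funX.
  by under eq_integral do rewrite gee0_abs ?lee_fin ?sqr_ge0//.
have i1 : mu.-integrable D (EFin \o cst (1 : R)).
  apply: measurable_bounded_integrable => //; exists 1; split; first exact: num_real.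
  by move=> N N1 x _; rewrite /= normr1 ltW.
have i12 := integrableD mD i1 i2.
apply: le_integrable i12 => //; first exact/measurable_EFinP.
move=> x Dx /=; rewrite !lee_fin; have := le_sqr (f x) ltr01.
by rewrite invr1 mul1r => h; apply: le_trans h (ler_norm _).
Qed.

Lemma integrable_mulbd f (h : X -> R) (M : R) : mu.-integrable D (EFin \o f) ->
  measurable_fun D h -> (forall x, D x -> `|h x| <= M) ->
  mu.-integrable D (EFin \o (f \* h)).
Proof.
move=> fi mh hM; have := @integrableMl _ _ _ mu D mD (EFin \o f) h fi mh.
apply; exists M; split; first exact: num_real.
by move=> N MN x Dx; apply: le_trans (hM x Dx) (ltW MN).
Qed.

Lemma sq_integral_cvg (u : nat -> X -> R) (f h : X -> R) (M : R) :
  (forall k, mu.-integrable D (EFin \o u k)) -> mu.-integrable D (EFin \o f) ->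
  measurable_fun D h -> (forall x, D x -> `|h x| <= M) ->
  (\int[mu]_(x in D) ((u k x - f x) ^+ 2)%:E @[k --> \oo] --> 0)%E ->
  \int[mu]_(x in D) (u k x * h x) @[k --> \oo] --> \int[mu]_(x in D) (f x * h x).
Proof.
move=> ui fi mh hM u2.
pose M1 : R := `|M| + 1; have M0 : 0 < M1 by rewrite ltr_wpDl.
have hM1 x : D x -> `|h x| <= M1.
  by move=> /hM hx; rewrite (le_trans hx)// (le_trans (ler_norm _))// lerDl.
pose V := fine (mu D) + 1; have V0 : 0 < V by rewrite ltr_wpDl// fine_ge0.
apply/cvgrPdist_le => e e0.
(* Chosen so that the two terms of the final bound, [M1 * s * V] and [M1 * s^-1] times the squared
   distance bound [e * s / (2 * M1)], are [e / 2] each. *)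
pose s : R := e / (2 * M1 * V).
have s0 : 0 < s by apply: divr_gt0 => //; do 2 apply: mulr_gt0 => //.
have t0 : 0 < e * s / (2 * M1) by apply: divr_gt0; apply: mulr_gt0.
have : \forall k \near \oo,
    (\int[mu]_(x in D) ((u k x - f x) ^+ 2)%:E < (e * s / (2 * M1))%:E)%E.
  have /fine_cvgP[ufin /cvgr_lt/(_ _ t0)] := u2.
  by apply: filterS2 ufin => k kfin; rewrite -[in X in _ -> X](fineK kfin) lte_fin.
apply: filterS => k uk.
have uhi : mu.-integrable D (EFin \o (u k \* h)) by exact: integrable_mulbd (ui k) mh hM.
have fhi : mu.-integrable D (EFin \o (f \* h)) by exact: integrable_mulbd fi mh hM.
rewrite -RintegralB//.
have ufi : mu.-integrable D (EFin \o (fun x => f x * h x - u k x * h x)).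
  exact: (integrableB mD fhi uhi).
rewrite -lee_fin EFin_normr_Rintegral//.
apply: le_trans (le_abse_integral mu mD (measurable_int _ ufi)) _.
have mu2 : measurable_fun D (fun x => ((u k x - f x) ^+ 2)%:E).
  apply/measurable_EFinP/measurable_funX/measurable_funB.
    exact/measurable_EFinP/(measurable_int _ (ui k)).
  exact/measurable_EFinP/(measurable_int _ fi).
apply: (@le_trans _ _ (\int[mu]_(x in D)
    ((M1 * s)%:E + (M1 * s^-1)%:E * ((u k x - f x) ^+ 2)%:E))%E).
  apply: ge0_le_integral => //.
  - by apply: measurableT_comp => //; exact: measurable_int ufi.
  - apply: emeasurable_funD => //; exact: emeasurable_funM.
  - move=> x Dx /=; rewrite -EFinM -EFinD lee_fin -mulrBl normrM mulrC.
    rewrite -mulrA -mulrDr; apply: ler_pM => //; first exact: hM1.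
    by rewrite distrC; exact: le_sqr.
rewrite ge0_integralD//; last 3 first.
- by move=> x Dx; rewrite lee_fin; apply: mulr_ge0; exact: ltW.
- by move=> x Dx; rewrite -EFinM lee_fin; apply: mulr_ge0; [apply: mulr_ge0; [exact: ltW|rewrite invr_ge0; exact: ltW]|exact: sqr_ge0].
- exact: emeasurable_funM.
rewrite integral_cst// ge0_integralZl//; last 2 first.
- by move=> x Dx; rewrite lee_fin sqr_ge0.
- by rewrite lee_fin; apply: mulr_ge0; [exact: ltW|rewrite invr_ge0; exact: ltW].
apply: (@le_trans _ _ ((M1 * s)%:E * V%:E + (M1 * s^-1)%:E * (e * s / (2 * M1))%:E)%E).
  apply: leeD; apply: lee_wpmul2l.
  - by rewrite lee_fin; apply: mulr_ge0; exact: ltW.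
  - by rewrite -(@fineK _ (mu D)) ?ge0_fin_numE// lee_fin lerDl.
  - by rewrite lee_fin; apply: mulr_ge0; [exact: ltW|rewrite invr_ge0; exact: ltW].
  - exact: ltW.
rewrite -!EFinM -EFinD lee_fin le_eqVlt; apply/orP; left; apply/eqP.
by rewrite /s; field; rewrite !gt_eqF.
Qed.

Lemma dominated_Rcvg (f : X -> R) (c : nat -> X -> R) :
  mu.-integrable D (EFin \o f) -> (forall k, measurable_fun D (c k)) ->
  (forall k x, D x -> `|c k x| <= 1) ->
  {ae mu, forall x, D x -> c k x @[k --> \oo] --> (1 : R)} ->
  \int[mu]_(x in D) (f x * c k x) @[k --> \oo] --> \int[mu]_(x in D) f x.
Proof.
move=> fi mc c1 cc.
have [] := @dominated_convergence _ X R mu D mD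
  (fun k x => (f x * c k x)%:E) (EFin \o f) (fun x => `|(f x)%:E|)%E.
- move=> k; apply/measurable_EFinP/measurable_funM => //.
  exact/measurable_EFinP/(measurable_int _ fi).
- exact: measurable_int fi.
- apply: filterS cc => x cx Dx; apply: cvg_EFin; first exact: nearW.
  have := cvgM (cvg_cst (f x)) (cx Dx); rewrite mulr1; apply.
- exact: integrable_abse.
- apply: nearW => x k Dx; rewrite lee_fin normrM -[leRHS]mulr1.
  by apply: ler_wpM2l => //; exact: c1.
move=> _ _ H; apply: fine_cvg; rewrite fineK; first exact: H.
exact: integrable_fin_num.
Qed.

End L2_limits.

Section ae_bary.
Context {R : realType}.

Lemma ae_bary_gt0 d (V : finType) (pos : V -> 'rV[R]_d) (S : {set V}) :
  affinely_independent pos S -> #|S| = d.+1 ->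
  {ae lebesgue_rV d, forall x, hull pos S x -> forall v, v \in S -> 0 < bary pos S v x}.
Proof.
move=> indS cardS; suff : {ae lebesgue_rV d, forall x, hull pos S x ->
    forall v, v \in S -> bary pos S v x != 0}.
  apply: filterS => x H Sx v vS; rewrite lt_neqAle eq_sym H//=.
  by move: Sx; rewrite hullE//; apply.
have H v : {ae lebesgue_rV d, forall x, v \in S -> hull pos S x -> bary pos S v x != 0}.
  case vS : (v \in S); last by apply: nearW.
  case: (posnP d) => [d0|d0].
    (* In dimension 0 the gradient is zero and defines no hyperplane; the only coordinate is
       constantly 1. *)
    apply: nearW => x _ _; have S1 : #|S| = 1%N by rewrite cardS d0.
    have /eqP/finset.cards1P[w Sw] := S1; move: vS; rewrite Sw inE => /eqP vw.
    have := bary_sum indS cardS x; rewrite [in X in X -> _]Sw finset.big_set1 -vw => b1.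
    by rewrite b1 oner_eq0.
  exists [set x | dot (bary_grad pos S v) x = - bary_cst pos S v]; split.
  - by apply: closed_measurable_rV; rewrite (_ : mkset _ =
      (dot (bary_grad pos S v)) @^-1` [set - bary_cst pos S v])//;
    apply: closed_comp; [move=> x _; exact: dot_continuous|exact: closed_eq].
  - by rewrite hyperplane_null//; exact: (bary_grad_neq0 indS cardS).
  - move=> x /=; apply: contra_notP => nx _ _; apply/eqP => b0; apply: nx.
    by apply/eqP; rewrite -subr_eq0 opprK addrC; apply/eqP.
have : {ae lebesgue_rV d, forall x v, v \in S -> hull pos S x -> bary pos S v x != 0}.
  exact: filter_forall.
by apply: filterS => x Hx Sx v vS; exact: Hx.
Qed.

Lemma sparam_bary m n (q : 'I_m.+1 -> 'rV[R]_n) (t : 'rV[R]_m) :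
  sparam q t = \sum_i bary (@std_vertex R m) [set: 'I_m.+1]%SET i t *: q i.
Proof.
have card : #|[set: 'I_m.+1]%SET| = m.+1 by rewrite cardsT card_ord.
set b := bary _ _.
have b1 : \sum_i b i t = 1.
  rewrite -(bary_sum (@std_vertex_indep R m) card t).
  by apply: eq_bigl => i; rewrite finset.in_setT.
have bt j : t ord0 j = b (lift ord0 j) t.
  have := bary_comb (@std_vertex_indep R m) card t; rewrite std_vertex_comb.
  by move=> /rowP/(_ j); rewrite mxE.
rewrite sparamE big_ord_recl; under eq_bigr do rewrite scalerBr bt.
rewrite sumrB -scaler_suml addrCA; rewrite [RHS]addrC; congr (_ + _).
have -> : \sum_(i < m) b (lift ord0 i) t = 1 - b ord0 t.
  by rewrite -b1 big_ord_recl addrC addKr.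
by rewrite -[X in X - _]scale1r -scalerBl opprB addrC subrK.
Qed.
End ae_bary.

Section face_points.
Context {R : realType} {m : nat} (Th : simplicial_mesh R m.+1).
Implicit Types (T F : {set Th}) (u : 'rV[R]_m.+1 -> R) (a b v : Th).
Local Notation pos := (@pos R m.+1 Th).
Local Notation hull := (hull pos).

Definition face_vtx (F : {set Th}) (b : Th) (i : 'I_m.+1) : Th := nth b (enum F) i.

Section face.
Variables (F : {set Th}) (b : Th).
Hypothesis cardF : #|F| = m.+1.
Local Notation r := (face_vtx F b).

Lemma face_vtx_in i : r i \in F.
Proof. by rewrite -mem_enum mem_nth// -cardE cardF. Qed.

Lemma face_vtx_surj v : v \in F -> exists i, r i = v.
Proof.
move=> vF; have iv : (index v (enum F) < m.+1)%N.
  have sz : size (enum F) = m.+1 by rewrite -cardE.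
  by have := index_mem v (enum F); rewrite mem_enum vF sz.
by exists (Ordinal iv); rewrite /face_vtx nth_index ?mem_enum.
Qed.

Lemma face_pt_vtx (i : 'I_m.+1) : face_pt F i = pos (r i).
Proof. by rewrite /face_pt (nth_map b)// -cardE cardF. Qed.

(** Barycentric coordinates of the parameter, carried from positions in [enum F] to vertices. They
    do not refer to a cell, so every cell containing F sees the same ones. *)
Definition face_weight v (t : 'rV[R]_m) : R :=
  \sum_(i | r i == v) bary (@std_vertex R m) [set: 'I_m.+1]%SET i t.

Lemma face_weight_sum t : \sum_(v in F) face_weight v t = 1.
Proof.
have card : #|[set: 'I_m.+1]%SET| = m.+1 by rewrite cardsT card_ord.
rewrite -(bary_sum (@std_vertex_indep R m) card t).
rewrite [RHS](partition_big r (mem F)) => [|i _]; last exact: face_vtx_in.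
by apply: eq_bigr => v _; apply: eq_bigl => i; rewrite finset.in_setT.
Qed.

Lemma face_weight_comb t : \sum_(v in F) face_weight v t *: pos v = face_param F t.
Proof.
rewrite face_paramE sparam_bary [RHS](partition_big r (mem F)) => [|i _]; last exact: face_vtx_in.
apply: eq_bigr => v _; rewrite scaler_suml.
by apply: eq_bigr => i /eqP <-; rewrite face_pt_vtx.
Qed.

Lemma face_weight_ge0 v t : @std_simplex R m t -> 0 <= face_weight v t.
Proof.
have card : #|[set: 'I_m.+1]%SET| = m.+1 by rewrite cardsT card_ord.
rewrite -hull_std_vertex (hullE (@std_vertex_indep R m) card) => ht.
by apply: sumr_ge0 => i _; apply: ht; rewrite finset.in_setT.
Qed.

Lemma ae_face_weight_gt0 : {ae lebesgue_rV m, forall t, @std_simplex R m t ->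
  forall v, v \in F -> 0 < face_weight v t}.
Proof.
have card : #|[set: 'I_m.+1]%SET| = m.+1 by rewrite cardsT card_ord.
have := ae_bary_gt0 (@std_vertex_indep R m) card.
rewrite hull_std_vertex; apply: filterS => t H st v vF.
have [i ri] := face_vtx_surj vF; rewrite /face_weight (bigD1 i) ?ri//=.
apply: ltr_pwDl; first by apply: H => //; rewrite finset.in_setT.
by apply: sumr_ge0 => j _; apply/ltW/H => //; rewrite finset.in_setT.
Qed.

Lemma bary_face_param T t : T \in cells Th -> F \subset T -> forall v, v \in T ->
  bary pos T v (face_param F t) = if v \in F then face_weight v t else 0.
Proof.
move=> cT FT; apply: (face_bary (cell_indep cT) (card_cell cT) FT).
  exact: face_weight_sum.
exact: face_weight_comb.
Qed.
End face.

Lemma face_param_hull F (t : 'rV[R]_m) : #|F| = m.+1 ->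
  @std_simplex R m t -> hull F (face_param F t).
Proof.
move=> cF st; have /card_gt0P[b _] : (0 < #|F|)%N by rewrite cF.
exists (fun v => face_weight F b v t); split.
- by move=> v _; exact: face_weight_ge0.
- exact: face_weight_sum.
- by rewrite face_weight_comb.
Qed.

Lemma face_param_continuous F : continuous (@face_param R m.+1 Th F).
Proof. exact: (@sparam_continuous R m m.+1 (fun i : 'I_m.+1 => face_pt F i)). Qed.

End face_points.

Section trace_green.
Context {R : realType} {m : nat} (Th : simplicial_mesh R m.+1).
Implicit Types (T F : {set Th}) (u phi : 'rV[R]_m.+1 -> R) (a b v : Th).
Local Notation pos := (@pos R m.+1 Th).
Local Notation hull := (hull pos).
Local Notation icell T := (interior (hull T)).
Local Notation mu := (@lebesgue_rV R m.+1).

Lemma eq_face_int F u phi : (forall x, hull F x -> u x = phi x) -> #|F| = m.+1 ->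
  face_int F u = face_int F phi.
Proof.
move=> H cF; rewrite /face_int /face_eint; congr (fine (_ * _)%E).
apply: eq_integral => t; rewrite inE => st; rewrite H//; exact: face_param_hull.
Qed.

Lemma face_int0 F u : (forall x, hull F x -> u x = 0) -> #|F| = m.+1 -> face_int F u = 0.
Proof.
move=> H cF; rewrite (@eq_face_int _ _ (cst 0))//.
by rewrite /face_int /face_eint integral0 mule0.
Qed.

Section cell.
Variable T : {set Th}.
Hypothesis cT : T \in cells Th.
Let indT := cell_indep cT.
Let cardT := card_cell cT.

Lemma icellE : icell T = [set x | forall v, v \in T -> 0 < bary pos T v x].
Proof. exact: interior_hullE. Qed.

Lemma measurable_icell : measurable (icell T).
Proof. apply: open_measurable_rV; exact: open_interior. Qed.

Lemma icell_sub : icell T `<=` hull T.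
Proof. exact: interior_subset. Qed.

Lemma icell_finite : (mu (icell T) < +oo)%E.
Proof.
apply: bounded_finite_measure; first exact: measurable_icell.
have [N [Nr NP]] := compact_bounded (compact_hull (cell_indep cT) (card_cell cT)).
by exists N; split=> // P NP' x /icell_sub; exact: NP.
Qed.

Lemma ae_icell : {ae mu, forall x, hull T x -> icell T x}.
Proof. by rewrite icellE; exact: ae_bary_gt0. Qed.

Lemma Rintegral_icell u : mu.-integrable (hull T) (EFin \o u) ->
  \int[mu]_(x in hull T) u x = \int[mu]_(x in icell T) u x.
Proof.
move=> iu; have mN : measurable (hull T `\` icell T).
  by apply: measurableD; [exact: measurable_cell|exact: measurable_icell].
rewrite /Rintegral (negligible_integral mN (measurable_cell cT) iu).
  by rewrite setDD (setIidr icell_sub).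
apply/negligibleP => //; have [N [mN' N0 HN]] := ae_icell.
by exists N; split=> // x [Tx ix]; apply: HN => /= H; exact/ix/H.
Qed.

Lemma continuous_integrable_icell u : continuous u -> mu.-integrable (icell T) (EFin \o u).
Proof.
apply: continuous_integrable icell_sub; first exact: measurable_icell.
exact: compact_hull.
Qed.

Lemma cell_green (nrm : Th -> 'rV[R]_m.+1) i u : contdiff 1 u ->
  (forall a, a \in T -> outward_normal T (T :\ a) (nrm a)) ->
  \int[mu]_(x in icell T) partial i u x =
  \sum_(a in T) nrm a ord0 i * face_int (T :\ a) u.
Proof.
move=> cu Hn; have [_ /(_ i)[_ cpu]] := cu.
rewrite -Rintegral_icell; last first.
  apply: (@continuous_integrable _ _ _ (hull T)) => //; first exact: measurable_cell.
  exact: compact_hull.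
rewrite (cell_stokes cT i cu); apply: eq_bigr => a aT.
rewrite (face_intE _ (face_jac_gt0 cT aT)) mulrA; congr (_ * _).
have := face_jac_normal cT aT (Hn a aT) => /rowP/(_ i).
by rewrite !mxE mulrC => ->.
Qed.

End cell.

Section trace.
Variables (T : {set Th}) (a : Th).
Hypotheses (cT : T \in cells Th) (aT : a \in T).
Local Notation F := (T :\ a).
Variables (f g : 'rV[R]_m.+1 -> R) (n : 'rV[R]_m.+1).
Hypotheses (L2f : L2 (icell T) f) (tr : is_trace T F f g) (on : outward_normal T F n).

Let jac0 : 0 < face_jac F. Proof. exact: face_jac_gt0. Qed.

Lemma L2_face_integrable h : L2_face F h ->
  (lebesgue_rV m).-integrable (@std_simplex R m) (EFin \o (h \o face_param F)).
Proof.
move=> [mh h2]; apply: sq_integrable_integrable.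
- exact: measurable_std_simplex.
- exact: std_simplex_finite.
- split=> //; move: h2; rewrite /face_eint => h2.
  have : ((face_jac F)^-1%:E * ((face_jac F)%:E *
      \int[lebesgue_rV m]_(t in @std_simplex R m) ((h (face_param F t)) ^+ 2)%:E) < +oo)%E.
    by apply: lte_mul_pinfty => //; rewrite ?lee_fin ?invr_ge0 ?ltW//.
  by rewrite muleA -EFinM mulVf ?gt_eqF// mul1e.
Qed.

(** [is_trace] informs about one face only, so [phi] has to vanish on the others. The classical
    formula for the products of [phi] with the smooth approximations then passes to the limit. [df]
    is the weak gradient that comes with the trace; it is matched with the one on the domain
    later. *)
Lemma trace_green : exists df : 'I_m.+1 -> 'rV[R]_m.+1 -> R,
  (forall i, L2 (icell T) (df i) /\ weak_partial (icell T) i f (df i)) /\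
  forall i phi, contdiff 1 phi ->
    (forall b x, b \in T -> b != a -> hull (T :\ b) x -> phi x = 0) ->
    \int[mu]_(x in icell T) (f x * partial i phi x) +
    \int[mu]_(x in icell T) (df i x * phi x) =
    n ord0 i * face_int F (fun x => g x * phi x).
Proof.
have [L2g [df [u [dfw su uf duf ug]]]] := tr; exists df; split=> // i phi cphi phi0.
have [cphi0 /(_ i)[dphi cpphi]] := cphi.
have miT := measurable_icell T; have fT := icell_finite cT.
have cu k : continuous (u k) by exact: (contdiff_continuous (su k 0%N)).
have cdu k : continuous (partial i (u k)).
  by have [_ /(_ i)[_ ]] := su k 1%N.
have [M1 _ HM1] := continuous_compact_bounded (compact_hull (cell_indep cT) (card_cell cT)) cphi0.
have [M2 _ HM2] := continuous_compact_bounded (compact_hull (cell_indep cT) (card_cell cT)) cpphi.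
have fi : mu.-integrable (icell T) (EFin \o f) by exact: sq_integrable_integrable.
have dfi : mu.-integrable (icell T) (EFin \o df i).
  by apply: sq_integrable_integrable => //; exact: (dfw i).1.
have C1 : \int[mu]_(x in icell T) (u k x * partial i phi x) @[k --> \oo] -->
    \int[mu]_(x in icell T) (f x * partial i phi x).
  apply: (@sq_integral_cvg _ _ _ mu _ miT fT u f (partial i phi) M2) => //.
  - by move=> k; exact: continuous_integrable_icell.
  - apply: measurable_funTS; exact: continuous_measurable_rV.
  - by move=> x /icell_sub; exact: HM2.
have C2 : \int[mu]_(x in icell T) (partial i (u k) x * phi x) @[k --> \oo] -->
    \int[mu]_(x in icell T) (df i x * phi x).
  apply: (@sq_integral_cvg _ _ _ mu _ miT fT (fun k => partial i (u k)) (df i) phi M1) => //.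
  - by move=> k; exact: continuous_integrable_icell.
  - apply: measurable_funTS; exact: continuous_measurable_rV.
  - by move=> x /icell_sub; exact: HM1.
have cF : #|F| = m.+1 by exact: face_card.
have C3 : sface F (fun x => u k x * phi x) @[k --> \oo] --> sface F (fun x => g x * phi x).
  have cpar := @face_param_continuous _ _ Th F.
  change (\int[lebesgue_rV m]_(t in @std_simplex R m)
      ((u k \o face_param F) t * (phi \o face_param F) t) @[k --> \oo] -->
    \int[lebesgue_rV m]_(t in @std_simplex R m)
      ((g \o face_param F) t * (phi \o face_param F) t)).
  have mS : measurable (@std_simplex R m) by exact: measurable_std_simplex.
  have fS : (lebesgue_rV m (@std_simplex R m) < +oo)%E by exact: std_simplex_finite.
  have K := @sq_integral_cvg _ 'rV[R]_m R (lebesgue_rV m) _ mS fS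
    (fun k => u k \o face_param F) (g \o face_param F) (phi \o face_param F) M1.
  apply: K.
  - move=> k; exact: (sint_integrable (fun i : 'I_m.+1 => face_pt F i) (cu k)).
  - exact: L2_face_integrable.
  - apply: measurable_funTS; apply: continuous_measurable_rV.
    by move=> t; apply: continuous_comp; [exact: cpar|exact: cphi0].
  - move=> t st; apply: HM1; have := face_param_hull cF st.
    by case/(hull_faceP (cell_indep cT) (card_cell cT) _ (subsetDl _ _)).
  have := @cvgeZl _ _ _ _ _ (face_jac F)^-1%:E _ ug.
  rewrite mule0 => /(_ isT); apply: cvg_trans; apply: near_eq_cvg; apply: nearW => k.
  by rewrite /face_eint muleA -EFinM mulVf ?gt_eqF// mul1e.
have E k : \int[mu]_(x in icell T) (u k x * partial i phi x) +
    \int[mu]_(x in icell T) (partial i (u k) x * phi x) =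
    n ord0 i * (face_jac F * sface F (fun x => u k x * phi x)).
  have i1 : mu.-integrable (icell T) (EFin \o (fun x => u k x * partial i phi x)).
    apply: continuous_integrable_icell => // x.
    by apply: continuousM; [exact: cu|exact: cpphi].
  have i2 : mu.-integrable (icell T) (EFin \o (fun x => partial i (u k) x * phi x)).
    apply: continuous_integrable_icell => // x.
    by apply: continuousM; [exact: cdu|exact: cphi0].
  rewrite -RintegralD//.
  have cup : contdiff 1 (u k \* phi) := contdiffM (su k 1%N) cphi.
  have -> : \int[mu]_(x in icell T) (u k x * partial i phi x + partial i (u k) x * phi x) =
      \int[mu]_(x in icell T) partial i (u k \* phi) x.
    apply: eq_Rintegral => x _; rewrite partialM//.
      by rewrite [phi x * _]mulrC.
    by have [_ /(_ i)[]] := su k 1%N.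
  (* On the other faces any outward normal will do, as the integrals there vanish; on F it has to be
     the given [n]. *)
  pose nrm b := if b == a then n else get [set n' | outward_normal T (T :\ b) n'].
  have nrmP b : b \in T -> outward_normal T (T :\ b) (nrm b).
    rewrite /nrm => bT; case: eqP => [->//|_].
    have [n' on'] := outward_normal_exists cT bT.
    exact: (@getPex _ [set n' | outward_normal T (T :\ b) n'] (ex_intro _ n' on')).
  rewrite (cell_green cT i cup nrmP) (bigD1 a)//= big1 ?addr0 => [|b /andP[bT ba]].
    by rewrite /nrm eqxx -face_intE.
  rewrite face_int0 ?mulr0 ?face_card// => x Fx.
  by rewrite /= (phi0 b)// mulr0.
rewrite (face_intE _ jac0).
have L := cvgD C1 C2.
have L' := cvgM (cvg_cst (n ord0 i)) (cvgM (cvg_cst (face_jac F)) C3).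
have LE : (fun k => \int[mu]_(x in icell T) (u k x * partial i phi x)) +
    (fun k => \int[mu]_(x in icell T) (partial i (u k) x * phi x)) =
    (fun k => n ord0 i * (face_jac F * sface F (fun x => u k x * phi x))).
  by apply/funext => k; exact: E.
rewrite LE in L.
have fo : Filter \oo by exact: filter_filter.
exact: (cvg_unique _ (L fo) (L' fo fo fo fo)).
Qed.
End trace.
End trace_green.

(** * Cutoffs as test functions, and weak derivatives *)

Section Rintegral_pieces.
Context dd (X : measurableType dd) (R : realType).
Variables (mu : {measure set X -> \bar R}).

Lemma Rintegral_supp (D E : set X) (f : X -> R) : D `<=` E ->
  (forall x, ~ D x -> f x = 0) -> \int[mu]_(x in E) f x = \int[mu]_(x in D) f x.
Proof.
move=> DE f0; rewrite Rintegral_mkcond [RHS]Rintegral_mkcond; congr Rintegral.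
apply/funext => x; rewrite !patchE; case: ifPn => [|/negP]; rewrite inE => Ex.
  by case: ifPn => // /negP; rewrite inE => /f0.
by rewrite ifF//; apply/negP; rewrite inE => /DE.
Qed.

Lemma Rintegral_pieces (I : finType) (P : pred I) (D : I -> set X) (E : set X)
    (f : X -> R) : measurable E ->
  (forall i, P i -> measurable (D i) /\ D i `<=` E) ->
  (forall i j x, P i -> P j -> D i x -> D j x -> i = j) ->
  {ae mu, forall x, E x -> (exists2 i, P i & D i x) \/ f x = 0} ->
  mu.-integrable E (EFin \o f) ->
  \int[mu]_(x in E) f x = \sum_(i | P i) \int[mu]_(x in D i) f x.
Proof.
move=> mE mD dD aeD fi.
have fDi i : P i -> mu.-integrable E (EFin \o (f \_ (D i))).
  move=> /mD[mDi DE]; rewrite -restrict_EFin.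
  by apply/integrable_restrict => //; rewrite setIidr//; exact: integrableS fi.
transitivity (\int[mu]_(x in E) (\sum_(i | P i) (f \_ (D i)) x)).
  rewrite /Rintegral; congr fine; apply: ae_eq_integral => //.
  - exact: measurable_int fi.
  - exact: (measurable_int _ (integrable_Rsum mE _ fDi)).
  - apply: filterS aeD => x Hx Ex; congr EFin.
    have [[i Pi Dx]|fx0] := Hx Ex; last first.
      by rewrite fx0 big1// => i _; rewrite patchE fx0; case: ifP.
    rewrite (bigD1 i)//= big1 => [|j /andP[Pj ji]].
      by rewrite addr0 patchE ifT// inE.
    rewrite patchE ifF//; apply/negP; rewrite inE => Dj.
    by move/eqP: ji; apply; exact: dD Pj Pi Dj Dx.
rewrite Rintegral_sum//; apply: eq_bigr => i /mD[_ DE].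
by rewrite -Rintegral_mkcondr setIidr.
Qed.
End Rintegral_pieces.

Section multi_cutoff.
Context {R : realType} {d : nat} (I : finType) (P : pred I).
Variable q : I -> 'rV[R]_d -> R.
Hypothesis affq : forall i, affine_fun (q i).

Definition cutoffs k x : R := \prod_(i | P i) cutoff k (q i x).

Lemma smooth_cutoffs k : smooth (cutoffs k).
Proof.
rewrite (_ : cutoffs k = fun x => \prod_(i <- [seq i <- index_enum I | P i]) cutoff k (q i x)).
  by apply: smooth_prod => i; exact: smooth_cutoff.
by apply/funext => x; rewrite big_filter.
Qed.

Lemma cutoffs_ge0 k x : 0 <= cutoffs k x.
Proof. by apply: prodr_ge0 => i _; exact: cutoff_ge0. Qed.

Lemma cutoffs_le1 k x : cutoffs k x <= 1.
Proof.
by apply: prodr_ile1 => i _; rewrite cutoff_ge0 cutoff_le1.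
Qed.

Lemma cutoffs_eq0 k x i : P i -> k%:R * q i x <= 1 -> cutoffs k x = 0.
Proof. by move=> Pi qx; rewrite /cutoffs (bigD1 i)//= cutoff_eq0// mul0r. Qed.

Lemma cutoffs_cvg x : (forall i, P i -> 0 < q i x) ->
  cutoffs k x @[k --> \oo] --> (1 : R).
Proof.
move=> qx; have -> : (1 : R) = \prod_(i | P i) 1 by rewrite big1.
by apply: cvg_big => [|i Pi]; [exact: mul_continuous|exact/cutoff_cvg/qx].
Qed.

(** The cutoff is zero wherever some k q_i <= 1. The points of [C] with all k q_i >= 1 form a
    compact set on which every q_i is positive, hence a compact subset of [D] carrying the
    function. *)
Lemma cutoffs_test (D C : set 'rV[R]_d) k phi : compact C ->
  [set x | forall i, P i -> 0 < q i x] `<=` C `&` D -> smooth phi ->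
  test_function D (fun x => phi x * cutoffs k x).
Proof.
move=> cC sub sphi; split; first by apply: smoothM => //; exact: smooth_cutoffs.
exists (C `&` \bigcap_(i in [set i | P i]) [set x | 0 <= k%:R * q i x - 1]); split.
- apply: (subclosed_compact _ cC) => [|x []//].
  apply: closedI; first exact: compact_closed_rV.
  apply: closed_bigI => i _; apply: closed_ge0; apply: affine_fun_continuous.
  have [c [g qE]] := affq i; exists (k%:R * c - 1), (k%:R *: g) => y.
  by rewrite qE dotZl; ring.
- move=> x [_ qx]; suff [] : (C `&` D) x by [].
  apply: sub => i Pi; have /= := qx i Pi; rewrite subr_ge0 => k1.
  rewrite ltNge; apply/negP => q0; move: k1; rewrite leNgt => /negP; apply.
  by apply: le_lt_trans ltr01; rewrite mulr_ge0_le0.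
- move=> x nK; have [/existsP[i /andP[Pi qi]]|/existsPn H] :=
    boolP [exists i, P i && (k%:R * q i x <= 1)].
    by rewrite (cutoffs_eq0 Pi qi) mulr0.
  have {}H i : P i -> 1 < k%:R * q i x.
    by move=> Pi; have := H i; rewrite Pi/= -ltNge.
  exfalso; apply: nK; split; last by move=> i /H; rewrite /= subr_ge0 => /ltW.
  suff [] : (C `&` D) x by [].
  apply: sub => i /H k1; have : 0 < k%:R * q i x by exact: lt_trans k1.
  by rewrite pmulr_rgt0// ltr0n lt0n; apply: contraTneq k1 => ->; rewrite mul0r ltr10.
Qed.
End multi_cutoff.

Section weak.
Context {R : realType} {d : nat}.
Implicit Types (D E : set 'rV[R]_d) (f g h phi : 'rV[R]_d -> R).
Local Notation mu := (@lebesgue_rV R d).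

Lemma test_function_out D phi i x : test_function D phi -> ~ D x ->
  phi x = 0 /\ partial i phi x = 0.
Proof.
move=> [_ [K [cK KD phi0]]] nDx; have nK : ~ K x by move=> /KD.
split; first exact: phi0.
rewrite /partial (@near_eq_derive _ _ _ _ (cst 0)); first by rewrite derive_cst.
have : open (~` K) by apply: closed_openC; exact: compact_closed_rV.
by move=> oK; apply: filterS (open_nbhs_nbhs (conj oK nK)) => y /phi0.
Qed.

Lemma weak_partialS D E i f g : D `<=` E -> weak_partial E i f g -> weak_partial D i f g.
Proof.
move=> DE wE phi tphi; have out := @test_function_out _ _ i _ tphi.
rewrite -(Rintegral_supp _ DE); last by move=> x /out[_ ->]; rewrite mulr0.
rewrite -(Rintegral_supp _ DE); last by move=> x /out[-> _]; rewrite mulr0.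
apply: wE; have [sphi [K [cK KD phi0]]] := tphi.
by split=> //; exists K; split=> // x /KD /DE.
Qed.

Lemma cutoffs_Rcvg (I : finType) (P : pred I) (q : I -> 'rV[R]_d -> R)
   (D : set 'rV[R]_d) f :
  (forall i, affine_fun (q i)) -> measurable D -> mu.-integrable D (EFin \o f) ->
  {ae mu, forall x, D x -> forall i, P i -> 0 < q i x} ->
  \int[mu]_(x in D) (f x * cutoffs P q k x) @[k --> \oo] --> \int[mu]_(x in D) f x.
Proof.
move=> affq mD fi aeq; apply: dominated_Rcvg => //.
- move=> k; apply: measurable_funTS; apply: continuous_measurable_rV.
  exact: (contdiff_continuous (smooth_cutoffs P affq k 0%N)).
- by move=> k x _; rewrite ger0_norm ?cutoffs_ge0// cutoffs_le1.
- by apply: filterS aeq => x H Dx; apply: cutoffs_cvg; exact: H.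
Qed.

(** Uniqueness of the weak derivative in tested form, but against smooth functions that need not
    vanish at the boundary: the product of [phi] with the cutoffs is a test function, and dominated
    convergence removes the cutoffs. *)
Lemma weak_partial_uniq (I : finType) (P : pred I) (q : I -> 'rV[R]_d -> R) C i f g h phi :
  (forall i, affine_fun (q i)) -> compact C ->
  let D := [set x | forall i, P i -> 0 < q i x] in
  measurable D -> D `<=` C -> L2 D g -> L2 D h ->
  weak_partial D i f g -> weak_partial D i f h -> smooth phi ->
  \int[mu]_(x in D) (g x * phi x) = \int[mu]_(x in D) (h x * phi x).
Proof.
move=> affq cC D mD DC L2g L2h wg wh sphi.
have fD : (mu D < +oo)%E.
  apply: bounded_finite_measure => //; have [N [Nr NP]] := compact_bounded cC.
  by exists N; split=> // p NP' x /DC; exact: NP.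
have cphi : continuous phi by exact: (contdiff_continuous (sphi 0%N)).
have [M _ HM] := continuous_compact_bounded cC cphi.
have L u : L2 D u ->
    \int[mu]_(x in D) (u x * (phi x * cutoffs P q k x)) @[k --> \oo] -->
    \int[mu]_(x in D) (u x * phi x).
  move=> L2u; under eq_fun do under eq_Rintegral do rewrite mulrA.
  apply: (cutoffs_Rcvg (f := fun x => u x * phi x)) => //; last exact: nearW.
  apply: (@integrable_mulbd _ _ _ _ _ mD _ _ M).
  - exact: sq_integrable_integrable.
  - by apply: measurable_funTS; exact: continuous_measurable_rV.
  - by move=> x /DC; exact: HM.
have E k : \int[mu]_(x in D) (g x * (phi x * cutoffs P q k x)) =
    \int[mu]_(x in D) (h x * (phi x * cutoffs P q k x)).
  have tk : test_function D (fun x => phi x * cutoffs P q k x).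
    by apply: (@cutoffs_test R d I P q affq D C k phi cC) => // x Dx; split=> //; exact: DC.
  by apply: oppr_inj; rewrite -wg// -wh.
have Lg := L _ L2g; have Lh := L _ L2h.
rewrite (funext E) in Lg.
exact: (cvg_unique _ Lg Lh).
Qed.
End weak.

(** * Neighbouring cells *)

Section neighbours.
Context {R : realType} {m : nat} (Th : simplicial_mesh R m.+1).
Implicit Types (T F : {set Th}) (a b v : Th).
Local Notation pos := (@pos R m.+1 Th).
Local Notation hull := (hull pos).
Local Notation icell T := (interior (hull T)).
Local Notation mu := (@lebesgue_rV R m.+1).
Local Notation bary := (bary pos).

Lemma bary_affine_comb T a (I : finType) (P : pred I) (l : I -> R)
    (p : I -> 'rV[R]_m.+1) : \sum_(i | P i) l i = 1 ->
  bary T a (\sum_(i | P i) l i *: p i) = \sum_(i | P i) l i * bary T a (p i).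
Proof.
move=> l1; rewrite !bary_def dot_sumr; under [RHS]eq_bigr do rewrite mulrDr.
rewrite big_split/= -mulr_suml l1 mul1r; congr (_ + _).
by apply: eq_bigr => i _; rewrite dotZr.
Qed.

(** By conformity a common point lies in the hull of common vertices; an interior point has all its
    coordinates positive, so these are all the vertices of either cell. *)
Lemma icell_disjoint T T' x : T \in cells Th -> T' \in cells Th ->
  icell T x -> icell T' x -> T = T'.
Proof.
move=> cT cT'; have [S [ST ST' hS]] := conformal cT cT'.
move=> Tx T'x; have Sx : hull S x by rewrite -hS; split; exact: interior_subset.
suff H U : U \in cells Th -> S \subset U -> icell U x -> S = U.
  by rewrite -(H T)// -(H T').
move=> cU SU; rewrite icellE// => Ux; apply/eqP; rewrite finset.eqEsubset SU.
apply/fintype.subsetP => v vU; apply: contraT => vS.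
have [_ /(_ v vU vS) v0] := (hull_faceP (cell_indep cU) (card_cell cU) x SU).1 Sx.
by have := Ux v vU; rewrite v0 ltxx.
Qed.

Section pair.
Variables (T1 T2 : {set Th}) (a1 a2 : Th).
Hypotheses (cT1 : T1 \in cells Th) (cT2 : T2 \in cells Th) (T12 : T1 != T2).
Hypotheses (aT1 : a1 \in T1) (aT2 : a2 \in T2) (FE : T1 :\ a1 = T2 :\ a2).
Local Notation F := (T1 :\ a1).
Let ind1 := cell_indep cT1.
Let ind2 := cell_indep cT2.
Let card1 := card_cell cT1.
Let card2 := card_cell cT2.
Let c := bary T1 a1 (pos a2).

Let inF1 v : v \in F -> v \in T1 /\ v != a1.
Proof. by rewrite !inE => /andP[]. Qed.

Let inF2 v : v \in F -> v \in T2 /\ v != a2.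
Proof. by rewrite FE !inE => /andP[]. Qed.

(** Both coordinates are affine and vanish at the vertices of the common face, so they are
    proportional, and [c] is the value at [a2]. *)
Lemma bary_neighbour x : bary T1 a1 x = bary T2 a2 x * c.
Proof.
rewrite -{1}(bary_comb ind2 card2 x) bary_affine_comb ?bary_sum//.
rewrite (bigD1 a2)//= big1 ?addr0// => v /andP[vT2 va2].
have vF : v \in F by rewrite FE !inE va2.
have [vT1 va1] := inF1 vF.
by rewrite (bary_pos ind1 card1)// eq_sym (negbTE va1) mulr0.
Qed.

(** If [c] were zero, the coordinate of [a1] would vanish identically. If it were positive, moving
    slightly from the barycentre [y] of F towards [a2] would lead to a point interior to both
    cells. *)
Lemma neighbour_side : c < 0.
Proof.
rewrite ltNge le_eqVlt; apply/negP => /orP[/eqP c0|c0].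
  have := bary_neighbour (pos a1); rewrite -c0 mulr0 bary_pos// eqxx.
  by move/eqP; rewrite oner_eq0.
have cF : #|F| = m.+1 by exact: face_card.
pose l (_ : Th) : R := m.+1%:R^-1.
have l0 : 0 < m.+1%:R^-1 :> R by rewrite invr_gt0.
have l1 : \sum_(v in F) l v = 1.
  by rewrite sumr_const cF -[_ *+ _]mulr_natr mulVf.
pose y := \sum_(v in F) l v *: pos v.
have y1 v : v \in F -> bary T1 v y = m.+1%:R^-1.
  move=> vF; have [vT1 _] := inF1 vF.
  by rewrite (face_bary ind1 card1 (subsetDl T1 _) l1 erefl vT1) vF.
have y2 v : v \in T2 -> bary T2 v y = if v \in F then m.+1%:R^-1 else 0.
  move=> vT2; rewrite (face_bary ind2 card2 _ l1 erefl vT2)//.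
  by rewrite FE; exact: subsetDl.
have cvg : y + s *: (pos a2 - y) @[s --> 0^'+] --> y.
  rewrite -[in X in _ --> X](addr0 y) -(scale0r (pos a2 - y)).
  apply: cvgD; first exact: cvg_cst.
  by apply: cvgZr_tmp; apply: cvg_within_filter; exact: cvg_id.
have yO : nbhs y [set x | forall v, v \in F -> 0 < bary T1 v x].
  apply: open_nbhs_nbhs; split; first exact: open_bary_gt0.
  by move=> v vF; rewrite y1.
have := cvg _ yO; rewrite /nbhs/= => near1.
near (0 : R)^'+ => s.
have s0 : 0 < s by near: s; exact: nbhs_right_gt.
have s1 : s < 1 by near: s; exact: nbhs_right_lt.
have B1 v : v \in F -> 0 < bary T1 v (y + s *: (pos a2 - y)).
  by move: v; near: s.
set x := y + _ in B1.
have B2 v : v \in T2 -> 0 < bary T2 v x.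
  move=> vT2; rewrite baryD dotZr dotC.
  have -> : dot (pos a2 - y) (bary_grad pos T2 v) = bary T2 v (pos a2) - bary T2 v y.
    by rewrite dotC dotDr dotNr !bary_def; ring.
  rewrite bary_pos// y2//; case: ifPn => vF.
    have [_ va2] := inF2 vF; rewrite (negbTE va2) sub0r mulrN -[X in X - _]mul1r -mulrBl.
    by rewrite mulr_gt0// subr_gt0.
  have -> : v = a2 by move: vF; rewrite FE !inE vT2 andbT negbK => /eqP.
  by rewrite eqxx subr0 add0r mulr1.
have : T1 = T2.
  apply: (@icell_disjoint _ _ x) => //; rewrite icellE//= => v vT1.
  have [->|va1] := eqVneq v a1; first by rewrite bary_neighbour mulr_gt0// B2.
  by apply: B1; rewrite !inE va1.
by apply/eqP.
Unshelve. all: by end_near. Qed.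

(** An open set containing the relative interior of F and, as shown next, covered by the two cells:
    the coordinates of the two opposite vertices are left free. The index in [bool * Th] makes it
    the positivity set of one family of affine functions, the form used by [cutoffs]. *)
Definition face_patch := [set x | forall i : bool * Th, i.2 \in F ->
  0 < bary (if i.1 then T1 else T2) i.2 x].

(** The sign of the coordinate of [a1] selects the cell, since the coordinate of [a2] has the
    opposite sign. *)
Lemma face_patch_sub : face_patch `<=` hull T1 `|` hull T2.
Proof.
move=> x Ux; have [a0|a0] := leP 0 (bary T1 a1 x).
  left; rewrite hullE// => v vT1; have [->//|va1] := eqVneq v a1.
  by apply/ltW/(Ux (true, v)); rewrite !inE va1.
right; rewrite hullE// => v vT2; have [->|va2] := eqVneq v a2.
  by move: a0; rewrite bary_neighbour nmulr_llt0 ?neighbour_side// => /ltW.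
by apply/ltW/(Ux (false, v)); rewrite FE !inE va2.
Qed.

Lemma open_face_patch : open face_patch.
Proof.
rewrite (_ : face_patch = [set x | forall v, v \in F -> 0 < bary T1 v x] `&`
                     [set x | forall v, v \in F -> 0 < bary T2 v x]).
  by apply: openI; exact: open_bary_gt0.
apply/seteqP; split=> [x Ux|x [x1 x2] [[] v] /= vF]; last 2 first.
- exact: x1.
- exact: x2.
by split=> v vF; [apply: (Ux (true, v))|apply: (Ux (false, v))].
Qed.

Lemma bary_grad_neighbour : bary_grad pos T1 a1 = c *: bary_grad pos T2 a2.
Proof.
apply: dot_extl => y; have := bary_neighbour (0 + y); rewrite !baryD bary_neighbour.
by rewrite dotZl; move: (bary T2 a2 0) (dot _ y) (dot _ y) => B x z; lra.
Qed.

(** The gradients of the two opposite coordinates differ by the negative factor [c]. *)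
Lemma outward_normal_neighbour n : outward_normal T1 F n -> outward_normal T2 F (- n).
Proof.
move=> /(outward_normalE cT1 aT1)[h [h0 -> h1]]; rewrite scaleNr opprK.
rewrite bary_grad_neighbour scalerA [X in outward_normal _ X _]FE.
apply: outward_normal_opp => //; first by rewrite nmulr_llt0 ?neighbour_side.
by rewrite -h1 bary_grad_neighbour dotZl dotZr exprMn; ring.
Qed.

End pair.
End neighbours.

(** * Equal integrals of the two traces on an interior face *)

Section single_trace.
Context {R : realType} {m : nat} (Th : simplicial_mesh R m.+1).
Implicit Types (T F : {set Th}) (a b v : Th).
Local Notation pos := (@pos R m.+1 Th).
Local Notation hull := (hull pos).
Local Notation icell T := (interior (hull T)).
Local Notation mu := (@lebesgue_rV R m.+1).
Local Notation bary := (bary pos).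

Lemma L2S (D E : set 'rV[R]_m.+1) f : measurable D -> measurable E -> D `<=` E ->
  L2 E f -> L2 D f.
Proof.
move=> mD mE DE [mf f2]; split; first exact: measurable_funS mf.
apply: le_lt_trans f2; apply: ge0_subset_integral => //.
- exact/measurable_EFinP/measurable_funX.
- by move=> x _; rewrite lee_fin sqr_ge0.
Qed.

Lemma face_int_cutoffs_cvg T a (I : finType) (P : pred I) (q : I -> 'rV[R]_m.+1 -> R) g :
  T \in cells Th -> a \in T -> L2_face (T :\ a) g ->
  (forall i, affine_fun (q i)) ->
  {ae lebesgue_rV m, forall t, @std_simplex R m t ->
     forall i, P i -> 0 < q i (face_param (T :\ a) t)} ->
  face_int (T :\ a) (fun x => g x * cutoffs P q k x) @[k --> \oo] -->
  face_int (T :\ a) g.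
Proof.
move=> cT aT L2g affq aeq; have jac0 := face_jac_gt0 cT aT.
under eq_fun do rewrite (face_intE _ jac0); rewrite (face_intE _ jac0).
have cpar := @face_param_continuous _ _ Th (T :\ a).
have mS : measurable (@std_simplex R m) by exact: measurable_std_simplex.
have K := @dominated_Rcvg _ 'rV[R]_m R (lebesgue_rV m) _ mS (g \o face_param (T :\ a))
  (fun k => cutoffs P q k \o face_param (T :\ a)).
have L : sface (T :\ a) (fun x => g x * cutoffs P q k x) @[k --> \oo] --> sface (T :\ a) g.
  apply: K.
  - exact: (L2_face_integrable cT aT L2g).
  - move=> k; apply: measurable_funTS; apply: continuous_measurable_rV => t.
    apply: continuous_comp; first exact: cpar.
    exact: (contdiff_continuous (smooth_cutoffs P affq k 0%N)).
  - by move=> k x _; rewrite /= ger0_norm ?cutoffs_ge0// cutoffs_le1.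
  - by apply: filterS aeq => t H st; apply: cutoffs_cvg; exact: H.
exact: (cvgM (cvg_cst (face_jac (T :\ a))) L).
Qed.

Section pair.
Variables (T1 T2 : {set Th}) (a1 a2 : Th).
Hypotheses (cT1 : T1 \in cells Th) (cT2 : T2 \in cells Th) (T12 : T1 != T2).
Hypotheses (aT1 : a1 \in T1) (aT2 : a2 \in T2) (FE : T1 :\ a1 = T2 :\ a2).
Local Notation F := (T1 :\ a1).
Variable Omega : set 'rV[R]_m.+1.
Hypotheses (mO : measurable Omega) (fO : (mu Omega < +oo)%E).
Hypotheses (T1O : icell T1 `<=` Omega) (T2O : icell T2 `<=` Omega).
Hypothesis patchO : face_patch T1 T2 a1 `<=` Omega.
Variables (f g1 g2 : 'rV[R]_m.+1 -> R).
Hypotheses (H1f : H1 Omega f) (tr1 : is_trace T1 F f g1) (tr2 : is_trace T2 F f g2).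

Let q (i : bool * Th) := bary (if i.1 then T1 else T2) i.2.
Let P (i : bool * Th) := i.2 \in F.
Let phi k := cutoffs P q k.
Let affq i : affine_fun (q i). Proof. exact: affine_bary. Qed.

Let sphi k : smooth (phi k). Proof. exact: smooth_cutoffs. Qed.

Let cC : compact (hull T1 `|` hull T2).
Proof.
apply: compactU; first exact: (compact_hull (cell_indep cT1) (card_cell cT1)).
exact: (compact_hull (cell_indep cT2) (card_cell cT2)).
Qed.

Let tphi k : test_function (face_patch T1 T2 a1) (phi k).
Proof.
have -> : phi k = (fun x => cst 1 x * cutoffs P q k x).
  by apply/funext => x; rewrite mul1r.
have s1 : smooth (cst 1 : 'rV[R]_m.+1 -> R) by move=> j; exact: contdiff_cst.
apply: (@cutoffs_test R m.+1 _ P q affq _ _ k _ cC _ s1).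
by move=> x Ux; split=> //; exact: (face_patch_sub cT1 cT2 T12 aT1 aT2 FE).
Qed.

Let tphiO k : test_function Omega (phi k).
Proof.
have [s [K [cK KU K0]]] := tphi k.
by split=> //; exists K; split=> // x /KU /patchO.
Qed.

Let phi0 (T : {set Th}) (a : Th) k b x : T \in cells Th ->
  (T = T1 \/ T = T2) -> T :\ a = F -> b \in T -> b != a -> hull (T :\ b) x ->
  phi k x = 0.
Proof.
move=> cT T_ TF bT ba Tx; have bF : b \in F by rewrite -TF !inE ba.
have b0 : bary T b x = 0.
  apply: (((hull_faceP (cell_indep cT) (card_cell cT) x (subsetDl T [set b]%SET)).1 Tx).2 b bT).
  by rewrite !inE eqxx.
have [j jP qj] : exists2 j : bool * Th, P j & q j x = 0.
  by case: T_ => TE; [exists (true, b)|exists (false, b)] => //; rewrite /q/= -TE.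
by apply: (@cutoffs_eq0 _ _ _ _ _ _ _ j jP); rewrite qj mulr0.
Qed.

(** Green's formula on one of the two cells, with the weak derivative [G] on the whole domain
    instead of the one that comes with the trace. Both are weak derivatives of [f] inside the cell
    and so agree against the smooth [phi k]. *)
Let half T a n g i G k : T \in cells Th -> a \in T -> (T = T1 \/ T = T2) ->
  T :\ a = F -> outward_normal T F n -> is_trace T F f g -> icell T `<=` Omega ->
  L2 Omega G -> weak_partial Omega i f G ->
  \int[mu]_(x in icell T) (f x * partial i (phi k) x) +
  \int[mu]_(x in icell T) (G x * phi k x) =
  n ord0 i * face_int F (fun x => g x * phi k x).
Proof.
move=> cT aT T_ TF on trg TO L2G wG; move: on trg; rewrite -TF => on trg.
have mT := measurable_icell T.
have [df [dfP green]] := trace_green cT aT (L2S mT mO TO H1f.1) trg on.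
rewrite -green => [||b x bT ba Tx]; last 2 first.
- exact: smooth_contdiff.
- exact: (phi0 k cT T_ TF bT ba Tx).
congr (_ + _); have [L2df wdf] := dfP i.
have L2G' := L2S mT mO TO L2G.
have wG' := weak_partialS TO wG.
have cH := compact_hull (cell_indep cT) (card_cell cT).
have iE := icellE cT.
(* The open cell has to appear as the positivity set of its barycentric coordinates, the shape
   required by [weak_partial_uniq]. *)
rewrite iE in mT L2G' L2df wG' wdf *.
apply: (@weak_partial_uniq _ _ Th (mem T) (bary T) _ i f) cH _ _ _ _ _ _ _ => //.
- by move=> v; exact: affine_bary.
- by move=> x Dx; apply: interior_subset; rewrite iE.
Qed.

(** A point of the patch is in one of the two cells, and almost surely in its interior; elsewhere
    [h] is zero. *)
Let split_int h : (forall x, ~ face_patch T1 T2 a1 x -> h x = 0) ->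
  mu.-integrable Omega (EFin \o h) ->
  \int[mu]_(x in Omega) h x =
  \int[mu]_(x in icell T1) h x + \int[mu]_(x in icell T2) h x.
Proof.
move=> h0 hi; pose D (b : bool) := icell (if b then T1 else T2).
rewrite (@Rintegral_pieces _ _ _ _ bool xpredT D)//.
- by rewrite big_bool.
- by case=> _; split=> //; exact: measurable_icell.
- move=> [] [] x _ _ //= D1 D2.
    by have := icell_disjoint cT1 cT2 D1 D2 => /eqP; rewrite (negbTE T12).
  by have := icell_disjoint cT2 cT1 D1 D2 => /esym/eqP; rewrite (negbTE T12).
apply: filterS2 (ae_icell cT1) (ae_icell cT2) => x i1 i2 _.
have [Ux|/h0] := pselect (face_patch T1 T2 a1 x); last by right.
left; have [/i1|/i2] := face_patch_sub cT1 cT2 T12 aT1 aT2 FE Ux.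
- by exists true.
- by exists false.
Qed.

Lemma trace_single : face_int F g1 = face_int F g2.
Proof.
have [n on1] := outward_normal_exists cT1 aT1.
have on2 := outward_normal_neighbour cT1 cT2 T12 aT1 aT2 FE on1.
(* One partial derivative is enough, provided that its component of the normal can be divided out at
   the end. *)
have [i ni] : exists i, n ord0 i != 0.
  apply/existsP; rewrite -[X in is_true X]negbK negb_exists; apply/negP => /forallP n0.
  have [[n1 _] _] := on1; have := oner_neq0 R; rewrite -n1 /dot big1 ?eqxx// => j _.
  by have := n0 j; rewrite negbK => /eqP ->; rewrite mul0r.
have [L2f /(_ i)[G [L2G wG]]] := H1f.
have fi := sq_integrable_integrable mO fO L2f.
have Gi := sq_integrable_integrable mO fO L2G.
have bd (h : 'rV[R]_m.+1 -> R) : continuous h -> (forall x, ~ face_patch T1 T2 a1 x -> h x = 0) ->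
    exists M, forall x, Omega x -> `|h x| <= M.
  move=> ch h0; have [M M0 HM] := continuous_compact_bounded cC ch; exists M => x _.
  have [Ux|/h0 ->] := pselect (face_patch T1 T2 a1 x); last by rewrite normr0.
  by apply/HM/(face_patch_sub cT1 cT2 T12 aT1 aT2 FE).
(* The two half formulas carry opposite normals. Their volume terms add up to the pairing of [f] and
   [G] with [phi k] on the domain, which is zero by the definition of the weak derivative. *)
have E k : face_int F (fun x => g1 x * phi k x) = face_int F (fun x => g2 x * phi k x).
  have out := test_function_out i (tphi k).
  have [cphi /(_ i)[_ cdphi]] := sphi k 1%N.
  have [M1 HM1] := bd _ cphi (fun x nx => (out x nx).1).
  have [M2 HM2] := bd _ cdphi (fun x nx => (out x nx).2).
  have e1 := half k cT1 aT1 (or_introl erefl) erefl on1 tr1 T1O L2G wG.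
  have e2 := half k cT2 aT2 (or_intror erefl) (esym FE) on2 tr2 T2O L2G wG.
  have := wG _ (tphiO k); rewrite !split_int//; first last.
  - apply: (integrable_mulbd mO fi _ HM2).
    by apply: measurable_funTS; exact: continuous_measurable_rV.
  - by move=> x /out[_ ->]; rewrite mulr0.
  - apply: (integrable_mulbd mO Gi _ HM1).
    by apply: measurable_funTS; exact: continuous_measurable_rV.
  - by move=> x /out[-> _]; rewrite mulr0.
  move=> e3; apply: (mulfI ni); apply/eqP; rewrite -subr_eq0 -mulNr -e1.
  rewrite mxE in e2; rewrite -e2 addrACA; apply/eqP.
  by apply: etrans (congr1 (fun z => z + _) e3) _; exact: addNr.
(* At almost every point of F the weights at the vertices of F are positive. They are its
   barycentric coordinates in both cells, so the cutoffs tend to 1 there. *)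
have aeF : {ae lebesgue_rV m, forall t, @std_simplex R m t ->
     forall i, P i -> 0 < q i (face_param F t)}.
  have cF : #|F| = m.+1 by exact: face_card.
  have := ae_face_weight_gt0 a1 cF; apply: filterS => t H st [b v] vF.
  rewrite /q/=; have T1F : F \subset T1 by exact: subsetDl.
  have T2F : F \subset T2 by rewrite FE; exact: subsetDl.
  have {}vF : v \in F by [].
  have vT1 := fintype.subsetP T1F v vF; have vT2 := fintype.subsetP T2F v vF.
  by case: b; rewrite (bary_face_param a1)// vF; exact: H.
have L2g1 := tr1.1; have L2g2 := tr2.1.
have C1 := face_int_cutoffs_cvg cT1 aT1 L2g1 affq aeF.
have C2 := face_int_cutoffs_cvg cT1 aT1 L2g2 affq aeF.
have fo : Filter \oo by exact: filter_filter.
rewrite (funext E) in C1.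
exact: (cvg_unique _ C1 C2).
Qed.
End pair.
End single_trace.

(** * Interior and boundary faces *)

Section mesh_geometry.
Context {R : realType} {m : nat} (Th : simplicial_mesh R m.+1).
Implicit Types (T F : {set Th}) (a b v : Th).
Local Notation pos := (@pos R m.+1 Th).
Local Notation hull := (hull pos).
Local Notation icell T := (interior (hull T)).
Local Notation mu := (@lebesgue_rV R m.+1).
Local Notation bary := (bary pos).

Lemma bary_line T v x y s :
  bary T v (x + s *: (y - x)) = bary T v x + s * (bary T v y - bary T v x).
Proof. by rewrite baryD dotZr dotDr dotNr !bary_def; ring. Qed.

Lemma line_cvg (x y : 'rV[R]_m.+1) : x + s *: y @[s --> 0^'+] --> x.
Proof.
rewrite -[in X in _ --> X](addr0 x) -(scale0r y).
apply: cvgD; first exact: cvg_cst.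
by apply: cvgZr_tmp; apply: cvg_within_filter; exact: cvg_id.
Qed.

Lemma face_ofP T F : T \in cells Th ->
  reflect (exists2 a, a \in T & F = T :\ a) (face_of T F).
Proof.
move=> cT; apply: (iffP andP) => [[FT /eqP cF]|[a aT ->]]; last first.
  by rewrite subsetDl face_card.
have : #|T :\: F| = 1%N by rewrite finset.cardsDS// (card_cell cT) cF subSnn.
move=> /eqP/finset.cards1P[a TF]; exists a.
  have : a \in T :\: F by rewrite TF !inE.
  by rewrite !inE => /andP[].
by rewrite -TF finset.setDDr finset.setDv finset.set0U; apply/esym/finset.setIidPr.
Qed.

Lemma relint_bary T F x : T \in cells Th -> F \subset T -> relint F x ->
  (forall v, v \in F -> 0 < bary T v x) /\
  (forall v, v \in T -> v \notin F -> bary T v x = 0).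
Proof.
move=> cT FT [l [l0 l1 ->]].
have b := face_bary (cell_indep cT) (card_cell cT) FT l1 erefl.
split=> v vF; last by move=> nF; rewrite b// (negbTE nF).
by rewrite b ?vF ?l0//; exact: fintype.subsetP FT v vF.
Qed.

Lemma relint_exists F : (0 < #|F|)%N -> exists x, relint F x.
Proof.
move=> F0; exists (\sum_(v in F) #|F|%:R^-1 *: pos v), (fun _ => #|F|%:R^-1).
split=> // [v _|]; first by rewrite invr_gt0 ltr0n.
by rewrite sumr_const -[_ *+ _]mulr_natr mulVf// pnatr_eq0 -lt0n.
Qed.

Lemma relint_hull F : relint F `<=` hull F.
Proof. by move=> x [l [l0 l1 ->]]; exists l; split=> // v /l0/ltW. Qed.

(** Counting vertices: the intersection contains F and is a proper subset of T, which has only one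
    vertex more than F. *)
Lemma interior_faceI T T' F : T \in cells Th -> T' \in cells Th -> T != T' ->
  face_of T F -> face_of T' F -> interior_face F /\ F = T :&: T'.
Proof.
move=> cT cT' TT' /andP[FT cF] /andP[FT' _].
suff FE : F = T :&: T'.
  split=> //; rewrite /interior_face cF; apply/existsP; exists T; rewrite cT.
  by apply/existsP; exists T'; rewrite cT' TT' FE eqxx.
apply/eqP; rewrite finset.eqEcard finset.subsetI FT FT' (eqP cF)/=.
rewrite -ltnS -(card_cell cT); apply: fintype.proper_card.
rewrite fintype.properE finset.subsetIl; apply/negP => /finset.subsetIP[_ sub].
move/eqP: TT'; apply; apply/eqP.
by rewrite finset.eqEcard sub (card_cell cT) (card_cell cT') leqnn.
Qed.

(** Distinct cells on a face lie pairwise on opposite sides of it. Three are impossible, because the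
    ratio for [T] and [T''] would be the product of two negative ratios. *)
Lemma face_two_cells T T' T'' F : T \in cells Th -> T' \in cells Th ->
  T'' \in cells Th -> face_of T F -> face_of T' F -> face_of T'' F ->
  T != T' -> T'' = T \/ T'' = T'.
Proof.
move=> cT cT' cT'' /(face_ofP _ cT)[a aT FT] /(face_ofP _ cT')[a' aT' FT'].
move=> /(face_ofP _ cT'')[a'' aT'' FT''] TT'.
have [->|TT''] := eqVneq T'' T; first by left.
have [->|T'T''] := eqVneq T'' T'; first by right.
rewrite eq_sym in TT''; rewrite eq_sym in T'T''.
have E : T :\ a = T' :\ a' by rewrite -FT.
have E' : T :\ a = T'' :\ a'' by rewrite -FT.
have E'' : T' :\ a' = T'' :\ a'' by rewrite -FT'.
have := neighbour_side cT cT'' TT'' aT aT'' E'.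
rewrite (bary_neighbour cT cT' aT aT' E) nmulr_llt0 ?(neighbour_side cT cT')//.
by rewrite ltNge (ltW (neighbour_side cT' cT'' T'T'' aT' aT'' E'')).
Qed.

Section domain.
Variable Omega : set 'rV[R]_m.+1.
Hypotheses (PO : polyhedral_domain Omega) (mesh : mesh_of Th Omega).

Let intO : interior (closure Omega) = Omega. Proof. by case: PO => _ _ _ _ []. Qed.
Let openO : open Omega. Proof. by case: PO. Qed.

Lemma measurable_domain : measurable Omega.
Proof. exact: open_measurable_rV. Qed.

Lemma domain_finite : (mu Omega < +oo)%E.
Proof. by apply: bounded_finite_measure; [exact: measurable_domain|case: PO]. Qed.

Lemma hull_sub_closure T : T \in cells Th -> hull T `<=` closure Omega.
Proof. by move=> cT x Tx; rewrite mesh; exists T. Qed.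

Lemma icell_sub_domain T : T \in cells Th -> icell T `<=` Omega.
Proof. by move=> cT; rewrite -intO; apply/interiorS/hull_sub_closure. Qed.

(** This is where [interior (closure Omega) = Omega] rules out a slit along F: the patch is open and
    contained in the closure. *)
Lemma patch_sub_domain T1 T2 a1 a2 : T1 \in cells Th -> T2 \in cells Th -> T1 != T2 ->
  a1 \in T1 -> a2 \in T2 -> T1 :\ a1 = T2 :\ a2 -> face_patch T1 T2 a1 `<=` Omega.
Proof.
move=> cT1 cT2 T12 aT1 aT2 FE; rewrite -intO -open_subsetE; last exact: open_face_patch.
move=> x /(face_patch_sub cT1 cT2 T12 aT1 aT2 FE)[].
  exact: hull_sub_closure.
exact: hull_sub_closure.
Qed.

Lemma interior_face_not_boundary F : interior_face F -> ~~ boundary_face Omega F.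
Proof.
move=> /andP[/eqP cF /existsP[T /andP[cT /existsP[T' /andP[cT' /andP[TT' /eqP FE]]]]]].
have fT : face_of T F by rewrite /face_of FE finset.subsetIl -FE cF eqxx.
have fT' : face_of T' F by rewrite /face_of FE finset.subsetIr -FE cF eqxx.
have /(face_ofP _ cT)[a aT FT] := fT; have /(face_ofP _ cT')[a' aT' FT'] := fT'.
apply/negP => /andP[_ /asboolP FO].
have [x Fx] : exists x, relint F x by apply: relint_exists; rewrite cF.
have [_] := FO x (relint_hull Fx); apply.
apply: (patch_sub_domain cT cT' TT' aT aT'); first by rewrite -FT -FT'.
move=> [[] v] /=; rewrite -FT => vF.
  by have [+ _] := relint_bary cT (proj1 (andP fT)) Fx; apply.
by have [+ _] := relint_bary cT' (proj1 (andP fT')) Fx; apply.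
Qed.

(** Suppose that a point of F is in the domain. Just across F, points of the domain would remain,
    outside [T] and outside every other cell, although the cells cover the closure. *)
Lemma cell_face_boundary T F : T \in cells Th -> face_of T F -> ~~ interior_face F ->
  boundary_face Omega F.
Proof.
move=> cT fT nF; apply/andP; split; first by apply/existsP; exists T; rewrite cT.
have indT := cell_indep cT; have cardT := card_cell cT.
have /(face_ofP _ cT)[a aT FT] := fT; have /andP[sFT /eqP cF] := fT.
apply/asboolP => x Fx; have [Tx x0] := (hull_faceP indT cardT x sFT).1 Fx.
split; first exact: hull_sub_closure cT _ Tx.
move=> Ox; have [z Fz] : exists z, relint F z by apply: relint_exists; rewrite cF.
have [z1 z0] := relint_bary cT sFT Fz.
have aF : a \notin F by rewrite FT !inE eqxx.
(* The point [x] may lie on an edge of F; a small move towards [z] stays in the open domain and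
   reaches the relative interior of F. *)
have [y [Oy y1 y0]] : exists y, [/\ Omega y, forall v, v \in F -> 0 < bary T v y &
    bary T a y = 0].
  have near1 := @line_cvg x (z - x) _ (open_nbhs_nbhs (conj openO Ox)).
  rewrite /nbhs/= in near1; near (0 : R)^'+ => s.
  have s0 : 0 < s by near: s; exact: nbhs_right_gt.
  have s1 : s < 1 by near: s; exact: nbhs_right_lt.
  exists (x + s *: (z - x)); split; first by near: s.
    move=> v vF; rewrite bary_line.
    have -> : bary T v x + s * (bary T v z - bary T v x) =
      (1 - s) * bary T v x + s * bary T v z by ring.
    apply: ltr_wpDl; last by rewrite mulr_gt0// z1.
    rewrite mulr_ge0 ?subr_ge0 ?(ltW s1)//.
    move: Tx; rewrite hullE//; apply; exact: fintype.subsetP sFT v vF.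
  by rewrite bary_line x0// z0// subrr mulr0 addr0.
(* All coordinates of [y] at F are positive, so by conformity another cell containing [y] would have
   F among its faces, and F would be interior. *)
have H T' : T' \in cells Th -> T' != T -> ~ hull T' y.
  move=> cT' TT' T'y; have [S [ST ST' hS]] := conformal cT cT'.
  have Ty : hull T y.
    rewrite hullE// => v vT; have [->|va] := eqVneq v a; first by rewrite y0.
    by apply/ltW/y1; rewrite FT !inE va.
  have Sy : hull S y by rewrite -hS.
  have FS : F \subset S.
    apply/fintype.subsetP => v vF; apply: contraT => vS.
    have vT := fintype.subsetP sFT v vF.
    have [_ /(_ v vT vS) v0] := (hull_faceP indT cardT y ST).1 Sy.
    by have := y1 v vF; rewrite v0 ltxx.
  have fT' : face_of T' F by rewrite /face_of cF eqxx (fintype.subset_trans FS ST').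
  by have [] := @interior_faceI T' T F cT' cT TT' fT' fT; rewrite (negbTE nF).
(* The direction [y - pos a] points away from the opposite vertex, hence out of [T] across F. *)
have near1 := @line_cvg y (y - pos a) _ (open_nbhs_nbhs (conj openO Oy)).
have near2 : \forall s \near (0 : R)^'+, forall T', T' \in cells Th -> T' != T ->
    ~ hull T' (y + s *: (y - pos a)).
  apply: (filter_forall (F := (0 : R)^'+)) => T'.
  have [cT'|_] := boolP (T' \in cells Th); last exact: nearW.
  have [->|TT'] := eqVneq T' T; first exact: nearW.
  have oT : open (~` hull T').
    by apply: closed_openC; exact: (closed_hull (cell_indep cT') (card_cell cT')).
  have h := @line_cvg y (y - pos a) _ (open_nbhs_nbhs (conj oT (H _ cT' TT'))).
  by rewrite /nbhs/= in h; near=> s => _ _; near: s.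
rewrite /nbhs/= in near1; near (0 : R)^'+ => s.
have s0 : 0 < s by near: s; exact: nbhs_right_gt.
have /subset_closure : Omega (y + s *: (y - pos a)) by near: s.
rewrite mesh => -[T' cT' T'y]; have [TE|TT'] := eqVneq T' T; last first.
  by apply: (_ : forall T', T' \in cells Th -> T' != T -> ~ hull T' _) T'y => //; near: s.
move: T'y; rewrite TE hullE// => /(_ a aT).
rewrite -[y - pos a]opprB scalerN -scaleNr bary_line y0 bary_pos// eqxx subr0 add0r mulr1.
by rewrite oppr_ge0 leNgt s0.
Unshelve. all: by end_near. Qed.

Lemma boundary_cellE T F : T \in cells Th -> face_of T F -> boundary_face Omega F ->
  boundary_cell F = T.
Proof.
move=> cT fT bF; rewrite /boundary_cell; case: pickP => [T' /andP[cT' fT']|/(_ T)] /=.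
  apply/eqP; apply: contraT => TT'.
  have [iF _] := interior_faceI cT' cT TT' fT' fT.
  by have := interior_face_not_boundary iF; rewrite bF.
by rewrite cT fT.
Qed.

(** A unit normal of F is [k] times the gradient of the opposite coordinate. If [k] were
    nonnegative, small steps along [n] from the relative interior of F would stay in [T], hence in
    the closure of the domain. *)
Lemma boundary_normal_outward T F n : T \in cells Th -> face_of T F ->
  boundary_normal Omega F n -> outward_normal T F n.
Proof.
move=> cT fT [un bn]; have /(face_ofP _ cT)[a aT FT] := fT.
have /andP[sFT /eqP cF] := fT.
have [z Fz] : exists z, relint F z by apply: relint_exists; rewrite cF.
have [z1 z0] := relint_bary cT sFT Fz; have [e e0 He] := bn z Fz.
have aF : a \notin F by rewrite FT !inE eqxx.
move: un; rewrite FT => un; have [k [nE k1]] := unit_normalE cT aT un.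
rewrite nE; apply: outward_normal_opp => //; rewrite ltNge; apply/negP => k0.
have zO : nbhs z [set x | forall v, v \in F -> 0 < bary T v x].
  by apply: open_nbhs_nbhs; split=> //; exact: open_bary_gt0.
have near1 := @line_cvg z n _ zO; rewrite /nbhs/= in near1.
near (0 : R)^'+ => t.
have t0 : 0 < t by near: t; exact: nbhs_right_gt.
have te : t < e by near: t; exact: nbhs_right_lt.
have [_] := He t t0 te; apply; apply: (hull_sub_closure cT).
have B v : v \in F -> 0 < bary T v (z + t *: n) by move: v; near: t.
rewrite hullE ?(cell_indep cT) ?(card_cell cT)//; last exact: (cell_indep cT).
move=> v vT; have [->|va] := eqVneq v a.
  rewrite baryD z0// add0r dotZr nE dotZr; apply: mulr_ge0; first exact: ltW.
  by apply: mulr_ge0 => //; apply/ltW/dot_gt0/(bary_grad_neq0 (cell_indep cT) (card_cell cT)).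
by apply/ltW/B; rewrite FT !inE va.
Unshelve. all: by end_near. Qed.

End domain.

Lemma sum_cell_faces (G : {set Th} -> R) T : T \in cells Th ->
  \sum_(a in T) G (T :\ a) = \sum_(F | face_of T F) G F.
Proof.
move=> cT; rewrite -(big_imset (h := fun a => T :\ a) G)/=; last first.
  move=> a b aT bT ab; apply/eqP; apply: contraT => nab.
  have : a \in T :\ a by rewrite ab !inE nab.
  by rewrite !inE eqxx.
apply: eq_bigl => F; apply/imsetP/(face_ofP _ cT) => -[a aT FE]; by exists a.
Qed.
End mesh_geometry.

(** * Raviart-Thomas interpolation *)

Section face_integrals.
Context {R : realType} {m : nat} (Th : simplicial_mesh R m.+1).
Implicit Types (T F : {set Th}) (a b v : Th) (u q : 'rV[R]_m.+1 -> R).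
Local Notation pos := (@pos R m.+1 Th).
Local Notation hull := (hull pos).
Local Notation icell T := (interior (hull T)).
Local Notation mu := (@lebesgue_rV R m.+1).
Local Notation bary := (bary pos).

Let mS : measurable (@std_simplex R m). Proof. exact: measurable_std_simplex. Qed.

Definition face_integrable F u :=
  (lebesgue_rV m).-integrable (@std_simplex R m) (EFin \o (u \o face_param F)).

Lemma continuous_face_integrable F u : continuous u -> face_integrable F u.
Proof. exact: (@sint_integrable R m m.+1 (fun i : 'I_m.+1 => face_pt F i) u). Qed.

Section face.
Variable F : {set Th}.
Hypothesis jac0 : 0 < face_jac F.

Lemma face_intD u q : face_integrable F u -> face_integrable F q ->
  face_int F (fun x => u x + q x) = face_int F u + face_int F q.
Proof.
move=> iu iq; rewrite !face_intE// -mulrDr; congr (_ * _).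
exact: (RintegralD mS iu iq).
Qed.

Lemma face_intZ c u : face_integrable F u ->
  face_int F (fun x => c * u x) = c * face_int F u.
Proof.
move=> iu; rewrite !face_intE// mulrCA; congr (_ * _).
change (\int[lebesgue_rV m]_(t in @std_simplex R m) (c * (u \o face_param F) t) =
  c * \int[lebesgue_rV m]_(t in @std_simplex R m) (u \o face_param F) t).
by rewrite RintegralZl.
Qed.

Lemma face_integrableZ c u : face_integrable F u -> face_integrable F (fun x => c * u x).
Proof. by move=> iu; exact: (integrableZl mS c iu). Qed.

Lemma face_integrableD u q : face_integrable F u -> face_integrable F q ->
  face_integrable F (fun x => u x + q x).
Proof. by move=> iu iq; exact: (integrableD mS iu iq). Qed.

Lemma face_integrable_sum (I : Type) (s : seq I) (f : I -> 'rV[R]_m.+1 -> R) :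
  (forall i, face_integrable F (f i)) ->
  face_integrable F (fun x => \sum_(i <- s) f i x).
Proof.
move=> fi; exact: (@integrable_Rsum _ _ _ _ _ mS _ s xpredT
  (fun i => f i \o face_param F) (fun i _ => fi i)).
Qed.

Lemma face_int_sum (I : Type) (s : seq I) (f : I -> 'rV[R]_m.+1 -> R) :
  (forall i, face_integrable F (f i)) ->
  face_int F (fun x => \sum_(i <- s) f i x) = \sum_(i <- s) face_int F (f i).
Proof.
move=> fi; rewrite face_intE//; under [RHS]eq_bigr do rewrite face_intE//.
rewrite -mulr_sumr; congr (_ * _).
exact: (@Rintegral_sum _ _ _ _ _ mS _ s xpredT
  (fun i => f i \o face_param F) (fun i _ => fi i)).
Qed.

Lemma face_int1_neq0 : face_int F (cst 1) != 0.
Proof.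
rewrite face_intE// mulf_neq0//; first by rewrite gt_eqF.
exact: std_simplex_int1.
Qed.

Lemma face_int_cst c : face_int F (fun=> c) = c * face_int F (cst 1).
Proof.
rewrite -face_intZ; last by apply: continuous_face_integrable; exact: cst_continuous.
by congr face_int; apply/funext => x; rewrite /= mulr1.
Qed.

(** Testing the residual with the constant 1 leaves the mean value as the only candidate. *)
Lemma Pi0E q : continuous q -> Pi0 F q = face_int F q / face_int F (cst 1).
Proof.
move=> cq; have iq := @continuous_face_integrable F q cq.
have ic c : face_integrable F (fun=> c).
  by apply: continuous_face_integrable; exact: cst_continuous.
have E c k : face_int F (fun x => (q x - c) * k) =
    k * (face_int F q - c * face_int F (cst 1)).
  have -> : (fun x => (q x - c) * k) = (fun x => k * (q x + - c)).
    by apply/funext => x; rewrite mulrC.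
  rewrite face_intZ; last exact: face_integrableD.
  by rewrite face_intD// face_int_cst mulNr.
rewrite /Pi0; apply: xget_unique => [k|c Pc] /=.
  by rewrite E divfK ?face_int1_neq0// subrr mulr0.
by have := Pc 1; rewrite E mul1r => /subr0_eq ->; rewrite mulfK// face_int1_neq0.
Qed.

End face.
End face_integrals.

Section raviart_thomas.
Context {R : realType} {m : nat} (Th : simplicial_mesh R m.+1).
Implicit Types (T F : {set Th}) (a b v : Th) (u q : 'rV[R]_m.+1 -> R).
Local Notation pos := (@pos R m.+1 Th).
Local Notation hull := (hull pos).
Local Notation icell T := (interior (hull T)).
Local Notation mu := (@lebesgue_rV R m.+1).
Local Notation bary := (bary pos).
Local Notation bgrad := (bary_grad pos).

Lemma RT0_affine (r : 'rV[R]_m.+1 -> 'rV[R]_m.+1) n : RT0 r -> affine_fun (fun x => dot (r x) n).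
Proof.
move=> [A [b rE]]; exists (dot A n), (b *: n) => x.
by rewrite rE dotDl !dotZl [dot n x]dotC.
Qed.

Section cell.
Variable T : {set Th}.
Hypothesis cT : T \in cells Th.
Let indT := cell_indep cT.
Let cardT := card_cell cT.

(** The normal is a multiple of the gradient of the coordinate of [a], whose product with [x] is
    constant where that coordinate vanishes. *)
Lemma RT0_face_cst r a n x y : RT0 r -> a \in T -> unit_normal (T :\ a) n ->
  hull (T :\ a) x -> hull (T :\ a) y -> dot (r x) n = dot (r y) n.
Proof.
move=> [A [b rE]] aT un Fx Fy; have [k [-> _]] := unit_normalE cT aT un.
have bary0 z : hull (T :\ a) z -> bary T a z = 0.
  move=> Fz; apply: ((hull_faceP indT cardT z (subsetDl T [set a]%SET)).1 Fz).2 => //.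
  by rewrite !inE eqxx.
have : dot (bgrad T a) x = dot (bgrad T a) y.
  by have := bary0 x Fx; rewrite -(bary0 y Fy) => /addrI.
by rewrite !rE !dotDl !dotZl !dotZr ![dot _ (bgrad T a)]dotC => ->.
Qed.

Lemma RT0_face_int r a n q : RT0 r -> a \in T -> unit_normal (T :\ a) n -> continuous q ->
  face_int (T :\ a) (fun x => dot (r x) n * q x) =
  face_int (T :\ a) (fun x => dot (r x) n) * Pi0 (T :\ a) q.
Proof.
move=> Rr aT un cq; have jac0 := face_jac_gt0 cT aT.
have cF : #|T :\ a| = m.+1 by exact: face_card.
have [z /relint_hull Fz] : exists z, relint (T :\ a) z.
  by apply: relint_exists; rewrite cF.
rewrite (@eq_face_int _ _ _ _ _ (fun x => dot (r z) n * q x)) ?cF//; last first.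
  by move=> x Fx; rewrite (RT0_face_cst Rr aT un Fx Fz).
rewrite (@eq_face_int _ _ _ _ (fun x => dot (r x) n) (fun=> dot (r z) n)) ?cF//; last first.
  by move=> x Fx; rewrite (RT0_face_cst Rr aT un Fx Fz).
rewrite face_intZ//; last exact: continuous_face_integrable.
rewrite face_int_cst// Pi0E// -mulrA; congr (_ * _).
by rewrite mulrC divfK// face_int1_neq0.
Qed.

(** The fields [x - pos a] are the usual local basis: each is tangent to the faces that contain [a]
    and has a constant positive normal component on the face opposite [a]. *)
Lemma RT_interpolant_exists tr : exists r, RT_interpolant tr T r.
Proof.
have /boolp.choice[nh nhP] : forall a, exists nh : 'rV[R]_m.+1 * R, a \in T ->
    [/\ outward_normal T (T :\ a) nh.1, 0 < nh.2 & nh.1 = - nh.2 *: bgrad T a].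
  move=> a; have [aT|_] := boolP (a \in T); last by exists (0, 0).
  have [n on] := outward_normal_exists cT aT.
  by have [h [h0 nE _]] := outward_normalE cT aT on; exists (n, h).
(* The prescribed flux divided by the flux of the basis field, whose normal component on the
   opposite face is [(nh a).2]. *)
pose c a := face_int (T :\ a) (fun x => dot (tr T (T :\ a) x) (nh a).1) /
  ((nh a).2 * face_int (T :\ a) (cst 1)).
pose r x := \sum_(a in T) c a *: (x - pos a).
exists r; split.
  exists (- \sum_(a in T) c a *: pos a), (\sum_(a in T) c a) => x.
  rewrite /r scaler_suml addrC -sumrB; apply: eq_bigr => a _; exact: scalerBr.
move=> F /(face_ofP _ cT)[a aT ->] n on; have jac0 := face_jac_gt0 cT aT.
have cF : #|T :\ a| = m.+1 by exact: face_card.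
have [on' h0 nE] := nhP a aT.
rewrite (outward_normal_uniq cT aT on on').
rewrite (@eq_face_int _ _ _ _ _ (fun=> c a * (nh a).2)) ?cF//; last first.
  move=> x Fx; rewrite /r dot_suml (bigD1 a)//= big1 => [|b /andP[bT ba]].
    rewrite addr0 dotZl nE dotC dotZl dotDr dotNr.
    have [Tx x0] := (hull_faceP indT cardT x (subsetDl T [set a]%SET)).1 Fx.
    have b0 : bary T a x = 0 by apply: x0 => //; rewrite !inE eqxx.
    have b1 := bary_pos indT cardT aT aT; rewrite eqxx in b1.
    have -> : dot (bgrad T a) x - dot (bgrad T a) (pos a) = -1.
      by move: b0 b1; rewrite !bary_def /=; lra.
    by rewrite mulrN1 opprK.
  rewrite dotZl nE dotZr dotC dotDr dotNr.
  have [Tx x0] := (hull_faceP indT cardT x (subsetDl T [set a]%SET)).1 Fx.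
  have b0 : bary T a x = 0 by apply: x0 => //; rewrite !inE eqxx.
  have b1 := bary_pos indT cardT aT bT; rewrite eq_sym (negbTE ba) in b1.
  have -> : dot (bgrad T a) x - dot (bgrad T a) (pos b) = 0.
    by move: b0 b1; rewrite !bary_def /=; lra.
  by rewrite !mulr0.
rewrite face_int_cst// /c -mulrA divfK// mulf_neq0// ?face_int1_neq0//.
by rewrite gt_eqF.
Qed.

Lemma RT_localP tr : RT_interpolant tr T (RT_local tr T).
Proof.
have [r Hr] := RT_interpolant_exists tr.
exact: (@xgetPex _ (cst 0) [set r | RT_interpolant tr T r] (ex_intro _ r Hr)).
Qed.

Lemma RT0_green r q (nrm : Th -> 'rV[R]_m.+1) : RT0 r -> affine_fun q ->
  (forall a, a \in T -> outward_normal T (T :\ a) (nrm a)) ->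
  \int[mu]_(x in icell T) (dot (r x) (grad q x) + divergence r x * q x) =
  \sum_(a in T) face_int (T :\ a) (fun x => dot (r x) (nrm a) * q x).
Proof.
move=> Rr aq Hn; pose u (i : 'I_m.+1) := (fun x => r x ord0 i) \* q.
have ar i : affine_fun (fun x => r x ord0 i).
  have [c [g rE]] := RT0_affine (delta_mx ord0 i) Rr.
  by exists c, g => x; rewrite -rE dot_delta.
have su i : smooth (u i) by apply: smoothM; exact: smooth_affine.
have cu i : contdiff 1 (u i) by exact: su.
transitivity (\int[mu]_(x in icell T) \sum_i partial i (u i) x).
  apply: eq_Rintegral => x _; rewrite /dot /divergence mulr_suml -big_split/=.
  apply: eq_bigr => i _; rewrite partialM.
  - by rewrite mxE mulrC [X in _ + X]mulrC [X in X + _]mulrC.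
  - by have [_ /(_ i)[]] := smooth_contdiff 1 (smooth_affine (ar i)).
  - by have [_ /(_ i)[]] := smooth_contdiff 1 (smooth_affine aq).
rewrite Rintegral_sum; last 2 first.
- exact: measurable_icell.
- move=> i _; apply: continuous_integrable_icell => //.
  by have [_ /(_ i)[]] := cu i.
under eq_bigr do rewrite (cell_green cT _ (cu _) Hn).
rewrite exchange_big/=; apply: eq_bigr => a aT.
have jac0 := face_jac_gt0 cT aT.
have iu i : face_integrable (T :\ a) (u i).
  by apply: continuous_face_integrable; exact: (contdiff_continuous (cu i)).
under eq_bigr do rewrite -face_intZ//.
rewrite -face_int_sum//; last by move=> i; exact: face_integrableZ.
congr face_int; apply/funext => x; rewrite /dot mulr_suml; apply: eq_bigr => i _.
by rewrite /u/= mulrCA mulrA.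
Qed.

Lemma cell_identity tr q (nrm : {set Th} -> 'rV[R]_m.+1) : affine_fun q ->
  (forall F, face_of T F -> outward_normal T F (nrm F)) ->
  \int[mu]_(x in icell T)
     (dot (RT_local tr T x) (grad q x) + divergence (RT_local tr T) x * q x) =
  \sum_(F | face_of T F) face_int F (fun x => dot (tr T F x) (nrm F)) * Pi0 F q.
Proof.
move=> aq Hn; have [Rr flux] := RT_localP tr.
have fT a : a \in T -> face_of T (T :\ a) by move=> aT; apply/(face_ofP _ cT); exists a.
rewrite (@RT0_green _ _ (fun a => nrm (T :\ a)))//; last by move=> a /fT; exact: Hn.
rewrite -(sum_cell_faces (fun F => face_int F _ * Pi0 F q) cT).
apply: eq_bigr => a aT; have on := Hn _ (fT a aT).
rewrite (RT0_face_int Rr aT on.1) ?flux ?fT//.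
exact: affine_fun_continuous.
Qed.

End cell.
End raviart_thomas.

(** * Summation over the mesh *)

Section glue_lemmas.
Context {R : realType} {m : nat} (Th : simplicial_mesh R m.+1).
Implicit Types (T : {set Th}).
Local Notation icell T := (interior (hull (@pos R m.+1 Th) T)).

Lemma glue_in (A : nmodType) (f : {set Th} -> 'rV[R]_m.+1 -> A) T x :
  T \in cells Th -> icell T x -> Defs.glue f x = f T x.
Proof.
move=> cT Tx; rewrite /Defs.glue; case: pickP => [T' /andP[cT' /asboolP T'x]|/(_ T)].
  by rewrite (icell_disjoint cT' cT T'x Tx).
by rewrite cT/= => /asboolP.
Qed.

Lemma glue_out (A : nmodType) (f : {set Th} -> 'rV[R]_m.+1 -> A) x :
  (forall T, T \in cells Th -> ~ icell T x) -> Defs.glue f x = 0.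
Proof.
move=> H; rewrite /Defs.glue; case: pickP => // T /andP[cT /asboolP Tx].
by have := H T cT Tx.
Qed.
End glue_lemmas.

Section main.
Context {R : realType} {m : nat}.
Variables (Omega : set 'rV[R]_m.+1) (Th : simplicial_mesh R m.+1).
Hypotheses (hOmega : polyhedral_domain Omega) (hTh : mesh_of Th Omega).
Implicit Types (T F : {set Th}).
Local Notation pos := (@pos R m.+1 Th).
Local Notation hull := (hull pos).
Local Notation icell T := (interior (hull T)).
Local Notation mu := (@lebesgue_rV R m.+1).
Variable tr : {set Th} -> {set Th} -> 'rV[R]_m.+1 -> 'rV[R]_m.+1.

Let mO := measurable_domain hOmega.

Section bulk.
Variable psi : 'rV[R]_m.+1 -> R.
Hypothesis hpsi : P1dc Th Omega psi.

Lemma restrP T : T \in cells Th -> affine_on T psi (restr psi T).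
Proof.
move=> cT; have [q aq] := hpsi.2 T cT.
exact: (@xgetPex _ (cst 0) [set q | affine_on T psi q] (ex_intro _ q aq)).
Qed.

Lemma bulk_cells :
  \int[mu]_(x in Omega)
     (dot (RT_interp tr x) (grad_h Th psi x) + div_RT_interp tr x * psi x) =
  \sum_(T in cells Th) \int[mu]_(x in icell T)
     (dot (RT_local tr T x) (grad (restr psi T) x) +
      divergence (RT_local tr T) x * restr psi T x).
Proof.
pose A T x := dot (RT_local tr T x) (grad (restr psi T) x).
pose B T x := divergence (RT_local tr T) x.
have aq T : T \in cells Th -> affine_fun (restr psi T) by move=> /restrP[].
have Rr T : T \in cells Th -> RT0 (RT_local tr T) by move=> cT; have [] := RT_localP cT tr.
have cA T : T \in cells Th -> continuous (A T).
  move=> cT; have [c [g qE]] := aq T cT.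
  rewrite (_ : A T = fun x => dot (RT_local tr T x) g).
    exact/affine_fun_continuous/RT0_affine/Rr.
  apply/funext => x; congr dot; apply/rowP => i; rewrite mxE.
  by have [] := partial_affine i x qE.
have cB T : T \in cells Th -> continuous (B T).
  move=> cT x; apply: continuous_big; first exact: add_continuous.
  move=> i _; have ar : affine_fun (fun x => RT_local tr T x ord0 i).
    have [c [g rE]] := RT0_affine (delta_mx ord0 i) (Rr T cT).
    by exists c, g => y; rewrite -rE dot_delta.
  by have [_ /(_ i)[_ +]] := smooth_contdiff 1 (smooth_affine ar); apply.
have psii : mu.-integrable Omega (EFin \o psi).
  exact: (sq_integrable_integrable mO (domain_finite hOmega) hpsi.1).
have Pi T : T \in cells Th ->
    mu.-integrable (icell T) (EFin \o (fun x => A T x + B T x * psi x)).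
  move=> cT; have mT := measurable_icell T.
  have iA := continuous_integrable_icell cT (cA T cT).
  have psiT : mu.-integrable (icell T) (EFin \o psi).
    by apply: integrableS psii => //; exact: (icell_sub_domain hOmega hTh).
  have [M _ HM] := continuous_compact_bounded
    (compact_hull (cell_indep cT) (card_cell cT)) (cB T cT).
  have iB : mu.-integrable (icell T) (EFin \o (psi \* B T)).
    apply: (integrable_mulbd mT psiT _ (M := M)).
      by apply: measurable_funTS; apply: continuous_measurable_rV; exact: cB.
    by move=> x /icell_sub; exact: HM.
  have -> : (fun x => A T x + B T x * psi x) = (A T \+ (psi \* B T)).
    by apply/funext => x /=; rewrite [B T x * _]mulrC.
  exact: (integrableD mT iA iB).
transitivity (\int[mu]_(x in Omega) \sum_(T in cells Th)
    ((fun x => A T x + B T x * psi x) \_ (icell T)) x).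
  apply: eq_Rintegral => x _.
  have [[T [cT Tx]]|nT] := pselect (exists T, T \in cells Th /\ icell T x).
    rewrite (bigD1 T)//= big1 ?addr0 => [|T' /andP[cT' TT']].
      rewrite patchE ifT ?inE// /RT_interp /grad_h /div_RT_interp.
      by rewrite !(glue_in _ cT Tx).
    rewrite patchE ifF//; apply/negP; rewrite inE => T'x.
    by move: TT'; rewrite (icell_disjoint cT' cT T'x Tx) eqxx.
  (* Off the open cells [glue] returns 0, so the integrand vanishes and the pointwise identity holds
     there as well. *)
  have {}nT T : T \in cells Th -> ~ icell T x by move=> cT Tx; apply: nT; exists T.
  rewrite /RT_interp /grad_h /div_RT_interp !glue_out// dot0l mul0r addr0 big1// => T cT.
  by rewrite patchE ifF//; apply/negP; rewrite inE => /(nT T cT).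
have TO T : T \in cells Th -> icell T `<=` Omega by exact: (icell_sub_domain hOmega hTh).
rewrite Rintegral_sum//; last first.
  move=> T cT; rewrite -restrict_EFin; apply/integrable_restrict => //.
    exact: measurable_icell.
  by rewrite setIidr; [exact: Pi|exact: TO].
apply: eq_bigr => T cT; rewrite -Rintegral_mkcondr setIidr; last exact: TO.
have iq : continuous (fun x => A T x + B T x * restr psi T x).
  move=> x; apply: continuousD; first exact: cA.
  by apply: continuousM; [exact: cB|exact: (affine_fun_continuous (aq T cT))].
(* [psi] coincides with its polynomial [restr psi T] only almost everywhere on the cell. *)
rewrite /Rintegral; congr fine; apply: ae_eq_integral.
- exact: measurable_icell.
- exact: measurable_int (Pi T cT).
- exact: measurable_int (continuous_integrable_icell cT iq).
- by apply: filterS (restrP cT).2 => x H /icell_sub /H ->.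
Qed.
End bulk.

Section faces.
Variables (T1 T2 : {set Th} -> {set Th}) (n : {set Th} -> 'rV[R]_m.+1).
Hypotheses (hT : orientation T1 T2).
Hypothesis hni : forall F, interior_face F -> outward_normal (T1 F) F (n F).
Hypothesis hnb : forall F, boundary_face Omega F -> boundary_normal Omega F (n F).
Variable w : 'rV[R]_m.+1 -> 'rV[R]_m.+1.
Hypotheses (hw : H1vec Omega w) (htr : traces w tr).

Lemma interior_face_cells F : interior_face F -> exists a1 a2,
  [/\ [/\ T1 F \in cells Th, T2 F \in cells Th & T1 F != T2 F],
      [/\ a1 \in T1 F, a2 \in T2 F, F = T1 F :\ a1 & F = T2 F :\ a2],
      face_of (T1 F) F & face_of (T2 F) F].
Proof.
move=> iF; have [cT1 cT2 T12 FE] := hT iF; have /andP[cF _] := iF.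
have f1 : face_of (T1 F) F by rewrite /face_of cF {1}FE finset.subsetIl.
have f2 : face_of (T2 F) F by rewrite /face_of cF {1}FE finset.subsetIr.
have /(face_ofP _ cT1)[a1 aT1 F1] := f1; have /(face_ofP _ cT2)[a2 aT2 F2] := f2.
by exists a1, a2.
Qed.

Definition cell_normal T F := if interior_face F && (T != T1 F) then - n F else n F.

Lemma cell_normalP T F : T \in cells Th -> face_of T F ->
  outward_normal T F (cell_normal T F).
Proof.
move=> cT fT; rewrite /cell_normal; case: (boolP (interior_face F)) => [iF|nF] /=.
  have [a1 [a2 [[cT1 cT2 T12] [aT1 aT2 F1 F2] f1 f2]]] := interior_face_cells iF.
  case: eqVneq => [->|TT1] /=; first exact: hni.
  have [TE|->] := face_two_cells cT1 cT2 cT f1 f2 fT T12; first by rewrite TE eqxx in TT1.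
  have FE : T1 F :\ a1 = T2 F :\ a2 by rewrite -F1.
  have on : outward_normal (T1 F) (T1 F :\ a1) (n F) by rewrite -F1; exact: hni.
  by have := outward_normal_neighbour cT1 cT2 T12 aT1 aT2 FE on; rewrite -F1.
apply: (boundary_normal_outward hTh cT fT); apply: hnb.
exact: (cell_face_boundary hOmega hTh cT fT nF).
Qed.

Lemma trace_face_integrable T F i : T \in cells Th -> face_of T F ->
  face_integrable F (fun x => tr T F x ord0 i).
Proof.
move=> cT fT; have [L2t _] := htr cT fT i.
have /(face_ofP _ cT)[a aT FT] := fT; rewrite FT in L2t *.
exact: (L2_face_integrable cT aT L2t).
Qed.

Lemma dot_face_integrable T F v : T \in cells Th -> face_of T F ->
  face_integrable F (fun x => dot (tr T F x) v).
Proof.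
move=> cT fT; rewrite (_ : (fun _ => _) = fun x => \sum_i v ord0 i * tr T F x ord0 i).
  by apply: face_integrable_sum => i; apply: face_integrableZ; exact: trace_face_integrable.
by apply/funext => x; apply: eq_bigr => i _; rewrite mulrC.
Qed.

Lemma face_jac_pos T F : T \in cells Th -> face_of T F -> 0 < face_jac F.
Proof. by move=> cT /(face_ofP _ cT)[a aT ->]; exact: face_jac_gt0. Qed.

Lemma face_int_dot T F v : T \in cells Th -> face_of T F ->
  face_int F (fun x => dot (tr T F x) v) =
  \sum_i v ord0 i * face_int F (fun x => tr T F x ord0 i).
Proof.
move=> cT fT; have j0 := face_jac_pos cT fT.
have ti i := @trace_face_integrable T F i cT fT.
under eq_bigr do rewrite -face_intZ//.
rewrite -face_int_sum//; last by move=> i; exact: face_integrableZ.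
by congr face_int; apply/funext => x; apply: eq_bigr => i _; rewrite mulrC.
Qed.

Lemma flux_single F v : interior_face F ->
  face_int F (fun x => dot (tr (T1 F) F x) v) = face_int F (fun x => dot (tr (T2 F) F x) v).
Proof.
move=> iF; have [a1 [a2 [[cT1 cT2 T12] [aT1 aT2 F1 F2] f1 f2]]] := interior_face_cells iF.
rewrite !face_int_dot//; apply: eq_bigr => i _; congr (_ * _).
have FE : T1 F :\ a1 = T2 F :\ a2 by rewrite -F1.
have tr1 := htr cT1 f1 i; have tr2 := htr cT2 f2 i; rewrite F1 in tr1 tr2 *.
apply: (trace_single cT1 cT2 T12 aT1 aT2 FE mO (domain_finite hOmega) _ _ _ (hw i)).
- exact: (icell_sub_domain hOmega hTh).
- exact: (icell_sub_domain hOmega hTh).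
- exact: (patch_sub_domain hOmega hTh cT1 cT2 T12 aT1 aT2 FE).
- by move: tr1; rewrite -F1.
- by move: tr2; rewrite -F1.
Qed.

Lemma regroup_faces (G : {set Th} -> {set Th} -> R) :
  \sum_(T in cells Th) \sum_(F | face_of T F) G T F =
  \sum_(F | interior_face F) (G (T1 F) F + G (T2 F) F) +
  \sum_(F | boundary_face Omega F) G (boundary_cell F) F.
Proof.
rewrite (exchange_big_dep xpredT)//= (bigID (@interior_face R m.+1 Th))/=; congr (_ + _).
  apply: eq_bigr => F iF.
  have [a1 [a2 [[cT1 cT2 T12] [aT1 aT2 F1 F2] f1 f2]]] := interior_face_cells iF.
  rewrite (bigD1 (T1 F)) ?cT1//= (bigD1 (T2 F))/=; last by rewrite cT2 f2 eq_sym.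
  rewrite big1 ?addr0// => T /andP[/andP[/andP[cT fT] TT1] TT2].
  have [TE|TE] := face_two_cells cT1 cT2 cT f1 f2 fT T12.
    by rewrite TE eqxx in TT1.
  by rewrite TE eqxx in TT2.
rewrite big_mkcond [RHS]big_mkcond; apply: eq_bigr => F _.
have [bF|nbF] := boolP (boundary_face Omega F); last first.
  case: ifPn => // niF; rewrite big1// => T /andP[cT fT].
  by have := cell_face_boundary hOmega hTh cT fT niF; rewrite (negbTE nbF).
have -> : ~~ interior_face F.
  by apply: contraL bF => iF; exact: (interior_face_not_boundary hOmega hTh iF).
have /andP[/existsP[T /andP[cT fT]] _] := bF.
have uT T' : T' \in cells Th -> face_of T' F -> boundary_cell F = T'.
  by move=> cT' fT'; exact: (boundary_cellE hOmega hTh cT' fT' bF).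
rewrite (bigD1 T) ?cT//= (uT T)// big1 ?addr0// => T' /andP[/andP[cT' fT'] TT'].
by rewrite -(uT T')// (uT T)// eqxx in TT'.
Qed.

Variable psi : 'rV[R]_m.+1 -> R.
Hypothesis hpsi : P1dc Th Omega psi.
Variable omega : {set Th} -> {set Th} -> R.
Hypothesis homega : forall F, interior_face F ->
    [/\ 0 <= omega (T1 F) F, 0 <= omega (T2 F) F &
        omega (T1 F) F + omega (T2 F) F = 1].

Lemma green_formula :
  \int[mu]_(x in Omega)
     (dot (RT_interp tr x) (grad_h Th psi x) + div_RT_interp tr x * psi x) =
  \sum_(F | interior_face F)
     face_int F (fun x => dot (average T1 T2 omega tr F x) (n F) *
                          Pi0 F (jump T1 T2 psi F)) +
  \sum_(F | boundary_face Omega F)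
     face_int F (fun x => dot (tr (boundary_cell F) F x) (n F) *
                          Pi0 F (restr psi (boundary_cell F))).
Proof.
have aq T : T \in cells Th -> affine_fun (restr psi T) by move=> cT; have [] := restrP hpsi cT.
pose G T F := face_int F (fun x => dot (tr T F x) (cell_normal T F)) * Pi0 F (restr psi T).
rewrite (bulk_cells hpsi).
transitivity (\sum_(T in cells Th) \sum_(F | face_of T F) G T F).
  apply: eq_bigr => T cT; apply: (cell_identity cT tr (aq T cT)) => F.
  exact: cell_normalP.
rewrite regroup_faces; congr (_ + _); apply: eq_bigr => F.
- move=> iF; have [a1 [a2 [[cT1 cT2 T12] _ f1 f2]]] := interior_face_cells iF.
  have j0 := face_jac_pos cT1 f1; have [_ _ w1] := homega iF.
  have cq1 := affine_fun_continuous (aq _ cT1); have cq2 := affine_fun_continuous (aq _ cT2).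
  have PiJ : Pi0 F (jump T1 T2 psi F) =
      Pi0 F (restr psi (T1 F)) - Pi0 F (restr psi (T2 F)).
    have cj : continuous (jump T1 T2 psi F).
      by move=> x; apply: continuousB; [exact: cq1|exact: cq2].
    have jE : jump T1 T2 psi F = (fun x => restr psi (T1 F) x + -1 * restr psi (T2 F) x).
      by apply/funext => x; rewrite mulN1r.
    have i1 := continuous_face_integrable F cq1.
    have i2 := continuous_face_integrable F cq2.
    rewrite !Pi0E// jE face_intD//; last exact: face_integrableZ.
    by rewrite face_intZ// mulN1r mulrBl.
  have G1 : G (T1 F) F = face_int F (fun x => dot (tr (T1 F) F x) (n F)) * Pi0 F (restr psi (T1 F)).
    by rewrite /G /cell_normal eqxx andbF.
  (* The second cell carries the reversed normal; expressing its flux by the trace of the first cell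
     lets the two projections combine into that of the jump. *)
  have G2 : G (T2 F) F = - face_int F (fun x => dot (tr (T1 F) F x) (n F)) * Pi0 F (restr psi (T2 F)).
    have cn : cell_normal (T2 F) F = - n F by rewrite /cell_normal iF eq_sym T12.
    have fN : face_int F (fun x => dot (tr (T2 F) F x) (- n F)) =
        - face_int F (fun x => dot (tr (T2 F) F x) (n F)).
      rewrite (face_int_dot (- n F) cT2 f2) (face_int_dot (n F) cT2 f2) -sumrN.
      by apply: eq_bigr => i _; rewrite mxE mulNr.
    by rewrite (flux_single (n F) iF) -fN -cn.
  rewrite G1 G2 mulNr -mulrBr -PiJ; set c := Pi0 F _.
  have -> : (fun x => dot (average T1 T2 omega tr F x) (n F) * c) =
     (fun x => c * (omega (T1 F) F * dot (tr (T1 F) F x) (n F) +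
                    omega (T2 F) F * dot (tr (T2 F) F x) (n F))).
    by apply/funext => x; rewrite mulrC /average dotDl !dotZl.
  have i1 := dot_face_integrable (n F) cT1 f1.
  have i2 := dot_face_integrable (n F) cT2 f2.
  have Z1 := face_integrableZ (omega (T1 F) F) i1.
  have Z2 := face_integrableZ (omega (T2 F) F) i2.
  rewrite face_intZ//; last exact: face_integrableD.
  rewrite (face_intD j0 Z1 Z2) (face_intZ j0 _ i1) (face_intZ j0 _ i2).
  by rewrite -(flux_single (n F) iF) -mulrDl w1 mul1r mulrC.
move=> bF; have /andP[/existsP[T /andP[cT fT]] _] := bF.
rewrite (boundary_cellE hOmega hTh cT fT bF) /G /cell_normal.
have -> : interior_face F = false.
  apply/negP => iF; have := interior_face_not_boundary hOmega hTh iF.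
  by rewrite bF.
rewrite /= mulrC -face_intZ.
- by congr face_int; apply/funext => x; rewrite mulrC.
- exact: (face_jac_pos cT fT).
- exact: dot_face_integrable.
Qed.

End faces.
End main.

Theorem lemma3 (R : realType) (d : nat) (hd : d = 2%N \/ d = 3%N)
  (Omega : set 'rV[R]_d) (hOmega : polyhedral_domain Omega)
  (Th : simplicial_mesh R d) (hTh : mesh_of Th Omega)
  (T1 T2 : {set Th} -> {set Th}) (hT : orientation T1 T2)
  (n : {set Th} -> 'rV[R]_d)
  (hni : forall F, interior_face F -> outward_normal (T1 F) F (n F))
  (hnb : forall F, boundary_face Omega F -> boundary_normal Omega F (n F))
  (omega : {set Th} -> {set Th} -> R)
  (homega : forall F, interior_face F ->
    [/\ 0 <= omega (T1 F) F, 0 <= omega (T2 F) F &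
        omega (T1 F) F + omega (T2 F) F = 1])
  (w : 'rV[R]_d -> 'rV[R]_d) (hw : H1vec Omega w)
  (tr : {set Th} -> {set Th} -> 'rV[R]_d -> 'rV[R]_d) (htr : traces w tr)
  (psi : 'rV[R]_d -> R) (hpsi : P1dc Th Omega psi) :
  \int[lebesgue_rV d]_(x in Omega)
     (dot (RT_interp tr x) (grad_h Th psi x) + div_RT_interp tr x * psi x) =
  \sum_(F : {set Th} | interior_face F)
     face_int F (fun x => dot (average T1 T2 omega tr F x) (n F) *
                          Pi0 F (jump T1 T2 psi F)) +
  \sum_(F : {set Th} | boundary_face Omega F)
     face_int F (fun x => dot (tr (boundary_cell F) F x) (n F) *
                          Pi0 F (restr psi (boundary_cell F))).
Proof.
case: d hd Omega hOmega Th hTh T1 T2 hT n hni hnb omega homega w hw tr htr psi hpsi.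
  by case.
move=> m _ Omega hOmega Th hTh T1 T2 hT n hni hnb omega homega w hw tr htr psi hpsi.
exact: (green_formula hOmega hTh hT hni hnb hw htr hpsi homega).
Qed.
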